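(* Let $\beta: Y\to Z$ be a dynamical Belyĭ map ($Y=Z=\mathbb{P}^1(\mathbb{C})$) and let $\gamma: X\to Y$ be any Belyĭ map. Identify $E_{\beta\circ\gamma}$ with $E_\gamma\times E_\beta$ via the bijection $e\mapsto(e_\gamma,\gamma\circ e)$, where $e_\gamma$ is the unique edge of $\gamma$ lying in the sheet of $\gamma$ containing $e(1/2)$. Then for every loop $\lambda\in\pi_1(Z\setminus\{0,1,\infty\},1/2)$ and every edge $(e_\gamma,e_\beta)\in E_{\beta\circ\gamma}$, \[ (e_\gamma,e_\beta)^{\lambda} = \big(e_\gamma^{\,f_\lambda(e_\beta)},\ e_\beta^{\,\lambda}\big), \] where each action is the monodromy action of the respective Belyĭ map ($\beta\circ\gamma$ on the left, $\gamma$ and $\beta$ on the right) and $f_\lambda$ is the extending pattern of $\beta$ from $\lambda$.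
   Context: A Belyĭ map is a meromorphic function from a compact Riemann surface to $\mathbb{P}^1(\mathbb{C})$ unbranched outside $\{0,1,\infty\}$; a dynamical Belyĭ map is a Belyĭ map $\beta:\mathbb{P}^1(\mathbb{C})\to\mathbb{P}^1(\mathbb{C})$ with $\beta(\{0,1,\infty\})\subseteq\{0,1,\infty\}$ (then $\beta\circ\gamma$ is Belyĭ). An edge of a Belyĭ map $\gamma$ is a continuous $e:[0,1]\to\gamma^{-1}([0,1])$ with $\gamma\circ e=\mathrm{id}_{[0,1]}$; $E_\gamma$ is the set of edges. Monodromy action (a right action, written $e^\lambda$): for a loop $\lambda$ in $\mathbb{P}^1(\mathbb{C})\setminus\{0,1,\infty\}$ based at $1/2$, $e^\lambda$ is the edge containing the endpoint of the lift of $\lambda$ starting at $e(1/2)$. Sheets of $\gamma$: with $B_1,\dots,B_n$ the path components of $\gamma^{-1}(\mathbb{P}^1(\mathbb{C})\setminus([-\infty,0]\cup[1,\infty]))$ ($[-\infty,0]$ = nonpositive reals with $\infty$) and $\mathscr{T}_i$ the unique path component of $\gamma^{-1}(\overline{\mathbb{H}})$ ($\overline{\mathbb{H}}$ the closed upper half-plane in $\mathbb{P}^1(\mathbb{C})$) meeting $B_i$, the sheets are $B_i\cup\mathscr{T}_i$ minus the points over $\{0,1,\infty\}$; each contains exactly one edge. Construction: for a path $p$ in $P_*=\mathbb{P}^1(\mathbb{C})\setminus\{0,1,\infty\}$ and $j\in\{0,1\}$, let $\alpha_{p,j}$ be the path from $p(j)$ to $1/2$ which is the upper semicircular arc with diameter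 between $p(j)$ and $1/2$ if $p(j)\in(-\infty,0)\cup(1,\infty)$, and the straight segment otherwise; set $p^{\circlearrowleft}=\alpha_{p,0}^{-1}*p*\alpha_{p,1}\in\pi_1(P_*,1/2)$. Extending pattern: for $\lambda\in\pi_1(Z\setminus\{0,1,\infty\},1/2)$, $f_\lambda:E_\beta\to\pi_1(Y\setminus\{0,1,\infty\},1/2)$ is defined by $f_\lambda(e_\beta)=\lambda_Y^{\circlearrowleft}$, where $\lambda_Y$ is the lift of $\lambda$ by $\beta$ with $\lambda_Y(0)=e_\beta(1/2)$.
   Formalization: In the definition of a sheet, points over 0, 1, ∞ are removed before taking the path component 𝒯_i, not after (literally, for γ=z² a sheet contains two edges, so e_γ is not unique); an edge lies in a sheet when its open part e((0,1)) does. *)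

(* Defs.v *)
From HB Require Import structures.
From mathcomp Require Import all_boot all_order all_algebra.
From mathcomp Require Import all_classical all_reals all_analysis.
From mathcomp Require Import complex.
Set Implicit Arguments.
Unset Strict Implicit.
Unset Printing Implicit Defensive.
Import Order.TTheory GRing.Theory Num.Theory.
Import numFieldNormedType.Exports.
Local Open Scope classical_set_scope.
Local Open Scope ring_scope.
Local Open Scope complex_scope.

(* [R[i]] seen as a [numClosedFieldType]: this triggers the inference of its
   norm topology and of its structure of normed module over itself, so that
   [derivable f z 1] is complex differentiability for [f : Cx R -> Cx R]. *)
Definition Cx (R : realType) : numClosedFieldType := R[i].

Section Riemann_surfaces.
Context {R : realType}.
Local Notation C := (Cx R).

(* [param] is only meaningful on the open set [coord @` dom], where it is the
   inverse of [coord]. *)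
Record chart (X : topologicalType) := Chart {
  dom : set X;
  coord : X -> C;
  param : C -> X }.

Definition chart_axiom (X : topologicalType) (c : chart X) : Prop :=
  [/\ open (dom c), open (coord c @` dom c),
      forall x, dom c x -> {for x, continuous (coord c)},
      forall z, (coord c @` dom c) z -> {for z, continuous (param c)} &
      forall x, dom c x -> param c (coord c x) = x].

Definition transition_holomorphic (X : topologicalType) (c d : chart X) : Prop :=
  forall x, dom c x -> dom d x ->
    derivable (coord d \o param c) (coord c x) 1.

Record riemannSurface := RiemannSurface {
  surface_space :> topologicalType;
  atlas : set (chart surface_space);
  surface_hausdorff : hausdorff_space surface_space;
  surface_nonempty : [set: surface_space] !=set0;
  surface_connected : connected [set: surface_space];
  atlas_chart : forall c, atlas c -> chart_axiom c;
  atlas_cover : forall x, exists2 c, atlas c & dom c x;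
  atlas_transition : forall c d, atlas c -> atlas d -> transition_holomorphic c d }.

Definition local_expression (X Y : topologicalType) (f : X -> Y)
    (c : chart X) (d : chart Y) : C -> C :=
  coord d \o f \o param c.

Definition holomorphic_map (X Y : riemannSurface) (f : X -> Y) : Prop :=
  continuous f /\
  forall c d x, atlas c -> atlas d -> dom c x -> dom d (f x) ->
    derivable (local_expression f c d) (coord c x) 1.

Definition ramified_at (X Y : riemannSurface) (f : X -> Y) (x : X) : Prop :=
  exists c d, [/\ atlas c, atlas d, dom c x, dom d (f x) &
    'D_1 (local_expression f c d) (coord c x) = 0].

Definition branch_point (X Y : riemannSurface) (f : X -> Y) (y : Y) : Prop :=
  exists2 x, ramified_at f x & f x = y.

End Riemann_surfaces.
Arguments riemannSurface R : clear implicits.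

Section Riemann_sphere.
Variable R : realType.
Local Notation C := (Cx R).

(* The point at infinity is [None]. *)
Definition P1_space : topologicalType := one_point_compactification C.

Definition P1_affine_chart : chart (R := R) P1_space :=
  @Chart R P1_space [set p | p != None] (odflt 0) Some.

(* the coordinate 1/z, sending infinity to 0 *)
Definition P1_infinity_chart : chart (R := R) P1_space :=
  @Chart R P1_space [set p | p != Some 0]
    (fun p => if p is Some z then z^-1 else 0)
    (fun w => if w == 0 then None else Some w^-1).

Definition P1_atlas : set (chart (R := R) P1_space) :=
  [set P1_affine_chart; P1_infinity_chart].

Definition modulus (z : C) : R := complex.Re (`|z| : R[i]).

Lemma modulusE (z : C) : `|z| = (modulus z)%:C.
Proof. by rewrite /modulus normc_def. Qed.

Lemma Cx_norm_Re (z : C) : `|complex.Re z|%:C <= `|z|.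
Proof. exact: normc_ge_Re. Qed.

Lemma Cx_norm_Im (z : C) : `|complex.Im z|%:C <= `|z|.
Proof.
rewrite normc_def lecR -sqrtr_sqr ler_wsqrtr// lerDr; exact: sqr_ge0.
Qed.

Lemma Cx_norm_real (x : R) : `|x%:C : C| = `|x|%:C.
Proof. by rewrite normc_def /= expr0n /= addr0 sqrtr_sqr. Qed.

Lemma Cx_norm_imag (y : R) : `|(0 +i* y) : C| = `|y|%:C.
Proof. by rewrite normc_def /= expr0n /= add0r sqrtr_sqr. Qed.
























Lemma Cx_norm_le (z : C) : `|z| <= (`|complex.Re z| + `|complex.Im z|)%:C.
Proof.
have -> : `|z| = `|((complex.Re z)%:C : C) + ((0 +i* complex.Im z) : C)|.
  by congr `|_|; case: z => x y; apply/eqP; rewrite eq_complex /= addr0 add0r !eqxx.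
apply: le_trans (ler_normD _ _) _.
rewrite Cx_norm_real Cx_norm_imag.
by rewrite lecE /= addr0 eqxx lexx.
Qed.

Lemma Cx_gt0_real (e : C) : 0 < e -> exists2 d : R, 0 < d & e = d%:C.
Proof.
case: e => a b; rewrite ltcE /= => /andP[/eqP -> a0].
by exists a.
Qed.

Lemma Complex_continuous : continuous (fun u : (R * R)%type => (u.1 +i* u.2 : C)).
Proof.
move=> -[x y]; apply/(@cvgrPdist_lt C C) => /= e /Cx_gt0_real[d d0 ->].
have d2 : 0 < d / 2 by rewrite divr_gt0.
near=> u.
apply: le_lt_trans (Cx_norm_le _) _; rewrite ltcR /=.
rewrite [ltRHS](splitr d); apply: ltrD.
  near: u.
  have : fst @ nbhs (x, y) --> x by exact: cvg_fst.
  by move/cvgrPdist_lt; apply.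
near: u.
have : snd @ nbhs (x, y) --> y by exact: cvg_snd.
by move/cvgrPdist_lt; apply.
Unshelve. all: by end_near. Qed.

Lemma Cx_real_continuous (f : C -> R) :
  (forall z w, (`|f z - f w|)%:C <= `|z - w| :> C) -> continuous f.
Proof.
move=> fL z; apply/(@cvgrPdist_lt R R C (nbhs z) (nbhs_filter (z : C))) => e e0; near=> w.
rewrite -ltcR; apply: le_lt_trans (fL _ _) _.
near: w.
by apply: (@nbhsx_ballx C C z e%:C); rewrite ltcR.
Unshelve. all: by end_near. Qed.

Lemma modulus_continuous : continuous modulus.
Proof.
apply: Cx_real_continuous => z w.
have := ler_dist_dist z w; rewrite (modulusE z) (modulusE w).
suff -> : (modulus z)%:C - (modulus w)%:C = (modulus z - modulus w)%:C :> C.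
  by rewrite Cx_norm_real.
by apply/eqP; rewrite eq_complex /= subr0 !eqxx.
Qed.

Lemma Cx_hausdorff : hausdorff_space C.
Proof. exact: (@norm_hausdorff C C). Qed.

Definition disc (M : R) : set C := [set z | modulus z <= M].

Lemma disc_compact M : compact (disc M).
Proof.
apply: (@subclosed_compact _ _
    ((fun u : (R * R)%type => (u.1 +i* u.2 : C)) @` (`[-M, M] `*` `[-M, M]))).
- rewrite (_ : disc M = modulus @^-1` [set x | x <= M])//.
  by apply: preimage_closed; [move=> ? _; exact: modulus_continuous|exact: closed_le].
- apply: continuous_compact; last by apply: compact_setX; exact: segment_compact.
  by apply: continuous_subspaceT; exact: Complex_continuous.
- move=> [x y] /= zM; exists (x, y) => //=; split; rewrite /= in_itv /= -ler_norml.
    by apply: le_trans zM; rewrite -lecR -modulusE; exact: (Cx_norm_Re (x +i* y)).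
  by apply: le_trans zM; rewrite -lecR -modulusE; exact: (Cx_norm_Im (x +i* y)).
Qed.

Lemma compact_disc (K : set C) : compact K -> exists M, K `<=` disc M.
Proof.
move=> Kc; have : compact (modulus @` K).
  apply: continuous_compact => //.
  by apply: continuous_subspaceT; exact: modulus_continuous.
move=> /(@compact_bounded R R)[M [Mr]] /(_ (M + 1)); rewrite ltrDl ltr01 => /(_ isT) H.
by exists (M + 1) => z Kz; apply: le_trans (ler_norm _) _; apply: H; exists z.
Qed.

Lemma disc_closed M : closed (disc M).
Proof. by apply: compact_closed; [exact: Cx_hausdorff | exact: disc_compact]. Qed.

Lemma P1_nbhs_infty M : nbhs (None : P1_space) ((Some @` ~` disc M) `|` [set None]).
Proof.
by exists (disc M) => //; split; [exact: disc_compact | exact: disc_closed].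
Qed.

Lemma P1_hausdorff : hausdorff_space P1_space.
Proof.
apply: one_point_compactification_hausdorff; last exact: Cx_hausdorff.
move=> z _; rewrite withinET; exists (disc (modulus z + 1)).
  have H : nbhs (modulus z) [set x | x < modulus z + 1].
    by apply: lt_nbhsl; rewrite ltrDl.
  have zn : nbhs (z : C) (modulus @^-1` [set x | x < modulus z + 1]).
    exact: (modulus_continuous H).
  by apply: (@filterS C (nbhs (z : C)) _ _ _ _ zn) => w; exact: ltW.
by split; [exact: disc_compact | exact: disc_closed].
Qed.

Lemma P1_Some_continuous : continuous (Some : C -> P1_space).
Proof. exact: one_point_compactification_some_continuous. Qed.

Lemma Cx_connected : connected [set: C].
Proof.
pose ray (z : C) (t : R) : C := (t * complex.Re z) +i* (t * complex.Im z).
have rayc z : continuous (ray z).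
  move=> t; apply: (@continuous_comp _ _ _
    (fun t : R => (t * complex.Re z, t * complex.Im z))
    (fun u : (R * R)%type => (u.1 +i* u.2 : C))); last exact: Complex_continuous.
  by apply: (@cvg_pair _ _ _ (nbhs t) (nbhs _) (nbhs _));
    apply: cvgM; [exact: cvg_id | exact: cvg_cst | exact: cvg_id | exact: cvg_cst].
have -> : [set: C] = \bigcup_(z in [set: C]) (ray z @` `[0, 1]).
  apply/seteqP; split => // -[x y] _; exists (x +i* y) => //.
  by exists 1; rewrite ?/ray /= ?mul1r// in_itv /= ler01 lexx.
apply: bigcup_connected.
  by exists 0 => z _; exists 0; rewrite ?/ray /= ?mul0r// in_itv /= ler01 lexx.
move=> z _; apply: connected_continuous_connected; first exact: segment_connected.
exact: continuous_subspaceT.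
Qed.

Lemma modulusV (z : C) : modulus z^-1 = (modulus z)^-1.
Proof.
rewrite {1}/modulus normfV modulusE /= expr0n /= addr0 expr2.
have [->|z0] := eqVneq (modulus z) 0; first by rewrite invr0 mul0r.
by rewrite invfM mulrA divff// mul1r.
Qed.

Lemma modulus_gt0 (z : C) : z != 0 -> 0 < modulus z.
Proof. by move=> z0; rewrite -ltcR -modulusE normr_gt0. Qed.

Lemma modulusV_lt (e : R) (z : C) : 0 < e -> ~ disc e^-1 z -> modulus z^-1 < e.
Proof.
move=> e0 /negP; rewrite -ltNge => ez.
have z0 : 0 < modulus z by apply: lt_trans ez; rewrite invr_gt0.
by rewrite modulusV invf_plt// posrE.
Qed.

Lemma P1_connected : connected [set: P1_space].
Proof.
have -> : [set: P1_space] = closure (Some @` [set: C] : set P1_space).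
  apply/seteqP; split => // -[z|] _; first by apply: subset_closure; exists z.
  move=> U [K [/compact_disc[M KM] _] KU].
  have M1 : ~ disc M ((`|M| + 1)%:C : C).
    apply/negP; rewrite -ltNge -ltcR -modulusE Cx_norm_real ltcR.
    rewrite ger0_norm ?addr_ge0//.
    by rewrite (le_lt_trans (ler_norm M))// ltrDl.
  exists (Some ((`|M| + 1)%:C : C)); split; first by eexists.
  by apply: KU; left; eexists => // /KM.
apply: connected_closure.
apply: connected_continuous_connected; first exact: Cx_connected.
by apply: continuous_subspaceT; exact: P1_Some_continuous.
Qed.

Lemma Cx_inv_continuous (z : C) : z != 0 -> {for z, continuous (@GRing.inv C)}.
Proof. by move=> z0; exact: (@inv_continuous C z z0). Qed.

Lemma P1_affine_chart_axiom : chart_axiom P1_affine_chart.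
Proof.
have im : coord P1_affine_chart @` dom P1_affine_chart = setT.
  by apply/seteqP; split => // z _; exists (Some z).
split; rewrite ?im.
- rewrite openE => -[z|//] _; rewrite /interior /=.
  by apply: filterS (@filterT _ (nbhs z) _).
- exact: openT.
- by case=> [z|//] _ U.
- by move=> z _; exact: P1_Some_continuous.
- by case.
Qed.

Lemma P1_infinity_chart_axiom : chart_axiom P1_infinity_chart.
Proof.
have im : coord P1_infinity_chart @` dom P1_infinity_chart = setT.
  apply/seteqP; split => // w _.
  have [->|w0] := eqVneq w 0; first by exists None.
  exists (Some w^-1); rewrite /= ?invrK//; apply/eqP => -[] /eqP.
  by rewrite invr_eq0 (negbTE w0).
split; rewrite ?im.
- have -> : dom P1_infinity_chart = ~` [set Some 0].
    by apply/seteqP; split => p /= /eqP.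
  apply: closed_openC; apply: accessible_closed_set1.
  exact: (hausdorff_accessible P1_hausdorff).
- exact: openT.
- case=> [z|] /= z0 U.
    apply: Cx_inv_continuous; apply/eqP => zE; move/eqP: z0; apply.
    by rewrite zE.
  move=> /(@nbhs_ballP C C)[_ /Cx_gt0_real[e e0 ->]] eU.
  apply: filterS (P1_nbhs_infty e^-1) => -[z [|//]|_] /=.
    move=> [w wM [<-]]; apply: eU; rewrite /ball /= sub0r normrN modulusE ltcR.
    exact: modulusV_lt.
  by apply: eU; rewrite /ball /= subr0 normr0 ltcR.
- move=> w _; rewrite /=; have [->|w0] := eqVneq w 0.
    move=> U /=; rewrite /nbhs /= eqxx => -[K [/compact_disc[M KM] _] KU].
    pose e : R := (`|M| + 1)^-1.
    have e0 : 0 < e by rewrite invr_gt0 ltr_wpDl.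
    apply: filterS (@nbhsx_ballx C C 0 e%:C _); last by rewrite ltcR.
    move=> z; rewrite /ball /= sub0r normrN modulusE ltcR => ze.
    case: eqP => [_|/eqP z0]; first by apply: KU; right.
    apply: KU; left; exists z^-1 => // /KM.
    apply/negP; rewrite -ltNge modulusV.
    apply: le_lt_trans (ler_norm M) _; apply: (@lt_trans _ _ (`|M| + 1)).
      by rewrite ltrDl.
    by rewrite invf_pgt ?posrE ?modulus_gt0 ?ltr_wpDl.
  rewrite /continuous_at /= => U; case: ifP => [wE|_ Uw]; first by rewrite wE in w0.
  have : nbhs (w : C) (@GRing.inv C @^-1` [set z | U (Some z)]).
    by apply: Cx_inv_continuous.
  have : nbhs (w : C) (~` [set 0]).
    apply: (@open_nbhs_nbhs C); split; last exact/eqP.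
    apply: closed_openC; apply: accessible_closed_set1.
    exact: (hausdorff_accessible Cx_hausdorff).
  apply: (@filterS2 C (nbhs (w : C))) => z /= /eqP/negbTE z0 Uz.
  by rewrite z0.
- case=> [z|_] /=; last by rewrite eqxx.
  move=> z0; case: ifPn => [|_]; last by rewrite invrK.
  by rewrite invr_eq0 => /eqP zE; move: z0; rewrite zE eqxx.
Qed.

Lemma P1_transition c d : P1_atlas c -> P1_atlas d -> transition_holomorphic c d.
Proof.
have idE (f : C -> C) x : f =1 id -> derivable f x 1.
  by move=> /funext ->; exact: derivable_id.
have invE (f : C -> C) (x : C) : f =1 (@GRing.inv C) -> x != 0 -> derivable f x 1.
  by move=> /funext -> x0; exact: (@derivableV C C id).
move=> [->|->] [->|->] [x|] //= x1 x2.
- by apply: invE => //; apply/eqP => xE; move/eqP: x2; rewrite xE.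
- apply: invE => [w /=|]; first by case: eqP => [->|//]; rewrite invr0.
  by rewrite invr_eq0; apply/eqP => xE; move/eqP: x1; rewrite xE.
- by apply: idE => w /=; case: eqP => [->|]//; rewrite invrK.
- by apply: idE => w /=; case: eqP => [->|]//; rewrite invrK.
Qed.

Lemma P1_nonempty : [set: P1_space] !=set0.
Proof. by exists None. Qed.

Lemma P1_atlas_chart c : P1_atlas c -> chart_axiom c.
Proof.
by move=> [->|->]; [exact: P1_affine_chart_axiom | exact: P1_infinity_chart_axiom].
Qed.

Lemma P1_atlas_cover x : exists2 c, P1_atlas c & dom c x.
Proof.
case: x => [z|]; first by exists P1_affine_chart; [left|].
by exists P1_infinity_chart; [right|].
Qed.

Definition P1 : riemannSurface R :=
  RiemannSurface P1_hausdorff P1_nonempty P1_connected P1_atlas_chart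
    P1_atlas_cover P1_transition.

Definition infty : P1 := None.

Definition real_point (x : R) : P1 := Some (x%:C : C).

Definition cusps : set P1 := [set real_point 0; real_point 1; infty].

End Riemann_sphere.
Arguments cusps : clear implicits.

Section Belyi_maps.
Context {R : realType}.

Definition meromorphic (X : riemannSurface R) (f : X -> P1 R) : Prop :=
  holomorphic_map f /\ exists x, f x <> infty R.

Definition belyi (X : riemannSurface R) (f : X -> P1 R) : Prop :=
  [/\ compact [set: X], meromorphic f & branch_point f `<=` cusps R].

Definition dynamical_belyi (b : P1 R -> P1 R) : Prop :=
  belyi b /\ b @` cusps R `<=` cusps R.

End Belyi_maps.

Section Paths.
Context {R : realType}.

Definition I01 : topologicalType := set_type (`[0, 1]%classic : set R).

Lemma clampP (t : R) : Num.min (Num.max t 0) 1 \in (`[0, 1]%classic : set R).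
Proof.
by rewrite inE /= in_itv /= le_min le_max lexx orbT ler01 ge_min lexx orbT.
Qed.

(* the retraction of the real line onto [0, 1] *)
Definition clamp (t : R) : I01 := exist _ (Num.min (Num.max t 0) 1) (clampP t).

Definition I0 : I01 := clamp 0.
Definition I1 : I01 := clamp 1.
Definition Ihalf : I01 := clamp 2^-1.

Definition rev_path (T : Type) (p : I01 -> T) : I01 -> T :=
  fun t => p (clamp (1 - val t)).

Definition cat_path (T : Type) (p q : I01 -> T) : I01 -> T :=
  fun t => if val t <= 2^-1 then p (clamp (2 * val t))
           else q (clamp (2 * val t - 1)).

Definition path_in (T : topologicalType) (A : set T) (p : I01 -> T) : Prop :=
  continuous p /\ forall t, A (p t).

Definition path_component (T : topologicalType) (A : set T) (x : T) : set T :=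
  [set y | exists p, [/\ path_in A p, p I0 = x & p I1 = y]].

Definition path_components (T : topologicalType) (A : set T) : set (set T) :=
  path_component A @` A.

(* homotopy in [A] relative to the endpoints *)
Definition homotopic (T : topologicalType) (A : set T) (p q : I01 -> T) : Prop :=
  exists H : (I01 * I01)%type -> T,
    [/\ continuous H, forall u, A (H u),
        forall t, H (I0, t) = p t /\ H (I1, t) = q t &
        forall s, H (s, I0) = p I0 /\ H (s, I1) = p I1].

Definition is_lift (X Y : topologicalType) (f : X -> Y) (p : I01 -> Y)
    (q : I01 -> X) : Prop :=
  continuous q /\ f \o q = p.

Definition punctured_sphere : set (P1 R) := ~` cusps R.

Definition based_loop (p : I01 -> P1 R) : Prop :=
  [/\ path_in punctured_sphere p, p I0 = real_point 2^-1
    & p I1 = real_point 2^-1].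

Definition homotopy_class (p : I01 -> P1 R) : set (I01 -> P1 R) :=
  [set q | based_loop q /\ homotopic punctured_sphere p q].

(* the fundamental group of the punctured sphere, based at 1/2; its elements
   are homotopy classes of loops *)
Record pi1 := Pi1 {
  loops_of :> set (I01 -> P1 R);
  pi1P : exists2 p, based_loop p & loops_of = homotopy_class p }.

HB.instance Definition _ := gen_eqMixin pi1.
HB.instance Definition _ := gen_choiceMixin pi1.

(* For x > 1/2, as for x < 1/2, this runs from x to 1/2 in the upper half
   plane: the centre is (x + 1/2) / 2 and the radius |x - 1/2| / 2. *)
Definition upper_arc (x : R) : I01 -> P1 R :=
  let c := (x + 2^-1) / 2 in
  let r := (x - 2^-1) / 2 in
  fun t => Some ((c + r * cos (pi * val t)) +i* (`|r| * sin (pi * val t)) : Cx R).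

Definition segment_to_half (z : Cx R) : I01 -> P1 R :=
  fun t => Some ((1 - val t)%:C * z + (val t / 2)%:C : Cx R).

(* The value for z = infty is irrelevant: only points of the punctured sphere
   get joined to 1/2. *)
Definition path_to_half (z : P1 R) : I01 -> P1 R :=
  match z with
  | Some w =>
      if (complex.Im w == 0) && ((complex.Re w < 0) || (1 < complex.Re w))
      then upper_arc (complex.Re w) else segment_to_half w
  | None => fun=> infty R
  end.

Definition close_path (p : I01 -> P1 R) : I01 -> P1 R :=
  cat_path (cat_path (rev_path (path_to_half (p I0))) p) (path_to_half (p I1)).

End Paths.
Arguments I01 : clear implicits.
Arguments pi1 : clear implicits.
Arguments path_component R {T} A x.
Arguments path_components R {T} A.

Section Edges.
Context {R : realType}.
Local Notation I01 := (I01 R).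

Record edge (X : riemannSurface R) (f : X -> P1 R) := Edge {
  edge_fun :> I01 -> X;
  edge_continuous : continuous edge_fun;
  edge_section : forall t, f (edge_fun t) = real_point (val t) }.

HB.instance Definition _ (X : riemannSurface R) (f : X -> P1 R) :=
  gen_eqMixin (edge f).
HB.instance Definition _ (X : riemannSurface R) (f : X -> P1 R) :=
  gen_choiceMixin (edge f).

(* [xget] falls back on its first argument when no such edge exists. *)
Definition monodromy (X : riemannSurface R) (f : X -> P1 R) (e : edge f)
    (lambda : pi1 R) : edge f :=
  xget e [set e' | exists l q, [/\ loops_of lambda l, is_lift f l q,
                                   q I0 = e Ihalf & range e' (q I1)]].

Definition extending_pattern (b : P1 R -> P1 R) (lambda : pi1 R) (eb : edge b) :
    pi1 R :=
  xget lambda [set m : pi1 R | exists l q, [/\ loops_of lambda l, is_lift b l q,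
                                 q I0 = eb Ihalf & loops_of m (close_path q)]].

Definition slit_sphere : set (P1 R) :=
  ~` ([set p | p = infty R \/ exists2 x, p = real_point x & x <= 0] `|`
      [set p | p = infty R \/ exists2 x, p = real_point x & 1 <= x]).

Definition closed_upper_half_plane : set (P1 R) :=
  [set p : P1 R | if p is Some z then 0 <= complex.Im z else True].

(* The points over 0, 1 and infinity are removed before taking the path
   component [T]: several preimages of the upper half plane may meet at a
   ramification point over a cusp, and they belong to different sheets. *)
Definition sheet (X : riemannSurface R) (f : X -> P1 R) (S : set X) : Prop :=
  exists B T, [/\ path_components R (f @^-1` slit_sphere) B,
    path_components R (f @^-1` (closed_upper_half_plane `\` cusps R)) T,
    B `&` T !=set0 & S = (B `|` T) `\` f @^-1` cusps R].

Definition edge_in_sheet_of (X : riemannSurface R) (f : X -> P1 R) (x : X)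
    (e : edge f) : Prop :=
  exists S, [/\ sheet f S, S x & forall t : I01, 0 < val t < 1 -> S (e t)].

Definition splits_edges (X : riemannSurface R) (b : P1 R -> P1 R) (g : X -> P1 R)
    (Phi : edge (b \o g) -> edge g * edge b) : Prop :=
  forall e : edge (b \o g),
    unique (edge_in_sheet_of (e Ihalf)) (Phi e).1 /\
    forall t, (Phi e).2 t = g (e t).

End Edges.

(* Main.v *)
(** Away from the cusps a Belyi map [gamma] is a covering, so its lifts of paths
    are unique and invariant under homotopy. The edge of [gamma] in the sheet of
    [x] is reached from [x] by lifting the path from [gamma x] to 1/2 used to
    close up paths, because the slit sphere is star-shaped around 1/2 and the
    punctured closed upper half plane is star-shaped around [i]. Lifting
    [lambda] by [beta \o gamma] from [x] amounts to lifting by [gamma] the lift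
    [q] of [lambda] by [beta]. Going from [e_gamma] back to [x], along [q], and
    then to the edge in the new sheet is therefore lifting the closed-up path of
    [q], which represents the value of the extending pattern.

    The covering property rests on complex analysis for functions that are only
    assumed to be complex differentiable. Goursat's bisection on rectangles gives
    a crude bound of [f z0] by the values of [f] on the boundary; applied to the
    powers of [f] it becomes the maximum modulus principle, and multiplying by
    squares of linear factors extends it across finitely many points near which
    [f] is bounded. Applied to differences of difference quotients it makes [f]
    injective near a point with nonzero derivative, applied to [1 / (f - p)] it
    makes [f] open there, and applied to [f] divided by many of its zeros it shows
    that zeros accumulate only where [f] vanishes identically. The last point
    makes the fibres over the cusps discrete, so that lifts of the open interval
    extend to edges. *)
Require Import Defs.
From mathcomp Require Import all_boot all_order all_algebra.
From mathcomp Require Import all_classical all_reals all_analysis.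
From mathcomp Require Import complex ring lra.
(* once more, since [coord] of mathcomp's vector.v shadows the chart coordinate *)
Require Import Defs.
Set Implicit Arguments.
Unset Strict Implicit.
Unset Printing Implicit Defensive.
Import Order.TTheory GRing.Theory Num.Theory.
Import numFieldNormedType.Exports.
Local Open Scope classical_set_scope.
Local Open Scope ring_scope.
Local Open Scope complex_scope.

(** The only integral that occurs is the imaginary part of a contour integral over a rectangle,
    written with real primitives. It is taken of the difference quotient of [f] at [z0], scaled so
    that [f z0 = 1]. Continuity at [z0] makes it vanish, whereas very small values of [f] on the
    boundary would leave roughly [- 1 / (z - z0)], to which all four sides contribute with the same
    sign. This contradiction plays the part of Cauchy's formula; the constant it loses depends on
    the rectangle alone, which is why taking powers recovers the sharp bound. The covering part uses
    only the properties collected in [branched_cover]. They pass to compositions, so nothing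
    analytic has to be shown for [beta \o gamma]. Lifts starting over a cusp need not be unique;
    edges are therefore handled through their value at 1/2, and both the identification of edges and
    the monodromy become relations between points. A Belyi map may be constant with a cusp as its
    value. Its fibres are then not discrete, but it has no edges, so this case is set apart. *)

Section modulus_theory.
Context {R : realType}.
Local Notation C := (Cx R).
Implicit Types z w : C.

Lemma modulus_ge0 z : 0 <= modulus z.
Proof. by rewrite -lecR -modulusE normr_ge0. Qed.

Lemma modulusM z w : modulus (z * w) = modulus z * modulus w.
Proof. by apply: complexI; rewrite rmorphM /= -!modulusE normrM. Qed.

Lemma modulusD z w : modulus (z + w) <= modulus z + modulus w.
Proof. by rewrite -lecR rmorphD /= -!modulusE ler_normD. Qed.

Lemma modulusN z : modulus (- z) = modulus z.
Proof. by apply: complexI; rewrite -!modulusE normrN. Qed.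

Lemma modulusB z w : modulus (z - w) = modulus (w - z).
Proof. by rewrite -modulusN opprB. Qed.

Lemma modulus0 : modulus (0 : C) = 0.
Proof. by apply: complexI; rewrite -!modulusE normr0. Qed.

Lemma modulus1 : modulus (1 : C) = 1.
Proof. by apply: complexI; rewrite -!modulusE normr1. Qed.

Lemma modulusX z n : modulus (z ^+ n) = modulus z ^+ n.
Proof. by elim: n => [|n IH]; rewrite ?expr0 ?modulus1// !exprS modulusM IH. Qed.

Lemma modulus_eq0 z : (modulus z == 0) = (z == 0).
Proof.
apply/idP/idP => [/eqP z0|/eqP ->]; last by rewrite modulus0.
by rewrite -normr_eq0 modulusE z0.
Qed.

Lemma modulus_Re z : `|complex.Re z| <= modulus z.
Proof. by rewrite -lecR -modulusE Cx_norm_Re. Qed.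

Lemma modulus_Im z : `|complex.Im z| <= modulus z.
Proof. by rewrite -lecR -modulusE Cx_norm_Im. Qed.

Lemma modulus_le z : modulus z <= `|complex.Re z| + `|complex.Im z|.
Proof. by rewrite -lecR -modulusE Cx_norm_le. Qed.

Lemma modulus_real (x : R) : modulus (x%:C : C) = `|x|.
Proof. by apply: complexI; rewrite -modulusE Cx_norm_real. Qed.

(** The norm of [Cx R] takes its values in [Cx R], so the radii of its balls are complex numbers;
    from here on neighbourhoods are described by real radii. *)
Lemma nbhs_modulusP z (A : set C) :
  nbhs z A <-> exists2 e : R, 0 < e & forall w, modulus (w - z) < e -> A w.
Proof.
split.
  move=> /(@nbhs_ballP C C)[_ /Cx_gt0_real[e e0 ->]] eA; exists e => // w we.
  by apply: eA; rewrite /ball /= modulusE ltcR modulusB.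
move=> [e e0 eA]; apply/(@nbhs_ballP C C); exists e%:C; rewrite /= ?ltcR//.
by move=> w; rewrite /ball /= modulusE ltcR modulusB => /eA.
Qed.

Lemma continuous_modulusP (f : C -> C) z : {for z, continuous f} <->
  forall e : R, 0 < e -> exists2 d : R, 0 < d &
    forall w, modulus (w - z) < d -> modulus (f w - f z) < e.
Proof.
split=> [fz e e0|fz A].
  have : nbhs (f z) [set w | modulus (w - f z) < e].
    by apply/nbhs_modulusP; exists e.
  by move=> /fz/nbhs_modulusP.
move=> /nbhs_modulusP[e e0 eA]; have [d d0 dP] := fz _ e0.
by apply/nbhs_modulusP; exists d => // w /dP /eA.
Qed.

Lemma Re_continuous : continuous (@complex.Re R : C -> R).
Proof.
apply: Cx_real_continuous => z w.
by have := Cx_norm_Re (z - w); case: z => a b; case: w => c d.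
Qed.

Lemma Im_continuous : continuous (@complex.Im R : C -> R).
Proof.
apply: Cx_real_continuous => z w.
by have := Cx_norm_Im (z - w); case: z => a b; case: w => c d.
Qed.

Lemma Complex_comp_continuous (T : topologicalType) (f g : T -> R) t :
  {for t, continuous f} -> {for t, continuous g} ->
  {for t, continuous (fun s => (f s +i* g s : C))}.
Proof.
move=> ft gt; apply: (@continuous_comp _ _ _ (fun s => (f s, g s))
  (fun u : (R * R)%type => (u.1 +i* u.2 : C))); last exact: Complex_continuous.
exact: (@cvg_pair _ _ _ (nbhs t) (nbhs _) (nbhs _)).
Qed.

End modulus_theory.

(** * Primitives of continuous real functions *)

Section primitives.
Context {R : realType}.
Local Notation mu := (@lebesgue_measure R).
Variable N : R.

(** The lower limit [- N] is a mere anchor: only differences of values at points of []- N, N[] enter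
    the boundary integrals. *)
Definition primitive (phi : R -> R) (x : R) : R :=
  (\int[mu]_(t in `[(- N)%R, x]) phi t)%R.

Lemma is_derive_primitive (phi : R -> R) (x : R) : continuous phi ->
  - N < x < N -> is_derive x 1 (primitive phi) (phi x).
Proof.
move=> phic /andP[Nx xN].
have phii : mu.-integrable `[- N, N] (EFin \o phi).
  apply: continuous_compact_integrable; first exact: segment_compact.
  exact: continuous_subspaceT.
have [dphi <-] := continuous_FTC1_closed xN phii Nx (phic x).
rewrite derive1E; exact: DeriveDef.
Qed.

(** The subtracted term is the integral of [al + be * t]. An exact intermediate point, rather than
    an estimate, serves twice: for the error bound of [primitive_affine] and, with [al = be = 0],
    for reading off the signs of integrals. *)
Lemma primitive_MVT (phi : R -> R) (a b al be : R) : continuous phi ->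
  - N < a -> a <= b -> b < N ->
  exists2 t, a <= t <= b &
    primitive phi b - primitive phi a - (al * (b - a) + be * (b ^+ 2 - a ^+ 2) / 2)
    = (phi t - (al + be * t)) * (b - a).
Proof.
move=> phic Na ab bN.
pose G t := primitive phi t - (al * t + (be / 2) * t ^+ 2).
have dG t : - N < t < N -> is_derive t 1 G (phi t - (al + be * t)).
  move=> tN; have := is_derive_primitive phic tN => dp.
  rewrite /G; apply: is_derive_eq.
  by rewrite /GRing.scale /=; field.
have [] := @MVT_segment R G (fun t => phi t - (al + be * t)) a b ab.
- move=> t; rewrite in_itv /= => /andP[ta tb]; apply: dG.
  by rewrite (lt_trans Na ta) (lt_trans tb bN).
- apply: derivable_within_continuous => t; rewrite in_itv /= => /andP[ta tb].
  have tN : - N < t < N by rewrite (lt_le_trans Na ta) (le_lt_trans tb bN).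
  by have [] := dG t tN.
- move=> t; rewrite in_itv /= => tab GE; exists t => //.
  by rewrite -GE /G; field.
Qed.

Lemma primitive_affine (phi : R -> R) (a b al be e : R) : continuous phi ->
  - N < a -> a <= b -> b < N ->
  (forall t, a <= t <= b -> `|phi t - (al + be * t)| <= e) ->
  `|primitive phi b - primitive phi a
     - (al * (b - a) + be * (b ^+ 2 - a ^+ 2) / 2)| <= e * (b - a).
Proof.
move=> phic Na ab bN phie.
have [t tab ->] := primitive_MVT al be phic Na ab bN.
by rewrite normrM (ger0_norm (_ : 0 <= b - a)) ?subr_ge0// ler_wpM2r ?subr_ge0// phie.
Qed.

End primitives.

(** * Goursat's theorem on rectangles *)

Section bisection.
Context {R : realType}.

Lemma half_expn_lt (D e : R) : 0 <= D -> 0 < e -> exists n, D / 2 ^+ n < e.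
Proof.
move=> D0 e0; exists (Num.truncn (D / e)).+1.
have h : D / e < 2 ^+ (Num.truncn (D / e)).+1.
  apply: (@lt_le_trans _ _ ((Num.truncn (D / e)).+1%:R)).
    by have /andP[] := truncn_itv (divr_ge0 D0 (ltW e0)).
  by rewrite -natrX ler_nat ltnW// ltn_expl.
by rewrite ltr_pdivrMr ?exprn_gt0// mulrC -ltr_pdivrMr.
Qed.

Lemma nested_intervals (a b : nat -> R) :
  (forall n, a n <= a n.+1) -> (forall n, b n.+1 <= b n) ->
  (forall n, a n <= b n) -> exists x, forall n, a n <= x <= b n.
Proof.
move=> aS bS ab.
have am : {homo a : m n / (m <= n)%N >-> m <= n} by apply: homo_leq => //; exact: le_trans.
have bm : {homo b : m n / (m <= n)%N >-> n <= m}.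
  by apply: (@homo_leq _ _ (fun x y => y <= x)) => // x y z xy yz; exact: le_trans yz xy.
have amb m n : a m <= b n.
  apply: le_trans (am _ _ (leq_maxl m n)) _.
  by apply: le_trans (ab _) _; apply: bm; exact: leq_maxr.
exists (sup (range a)) => n; apply/andP; split.
  by apply: ub_le_sup; [exists (b 0) => _ [m _ <-]|exists n].
by apply: ge_sup; [exists (a 0), 0%N|move=> _ [m _ <-]].
Qed.

Lemma bisect_rectangle (P : R -> R -> R -> R -> Prop) (a b c d : R) :
  a <= b -> c <= d -> P a b c d ->
  (forall a b c d, a <= b -> c <= d -> P a b c d ->
    let m := (a + b) / 2 in let n := (c + d) / 2 in
    [\/ P a m c n, P m b c n, P a m n d | P m b n d]) ->
  exists x y, forall e, 0 < e -> exists a' b' c' d',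
    [/\ a <= a' <= x, x <= b' <= b, c <= c' <= y, y <= d' <= d &
        (b' - a' < e) /\ (d' - c' < e) /\ P a' b' c' d'].
Proof.
move=> ab cd P0 PS.
(* Rectangles with property [P] form a type, so that the choice of a quarter is a function on it
   that can be iterated. *)
pose T := {q : (R * R) * (R * R) |
  [/\ q.1.1 <= q.1.2, q.2.1 <= q.2.2 & P q.1.1 q.1.2 q.2.1 q.2.2]}.
have /choice[f fP] : forall q : T, exists q' : T,
    [/\ (sval q).1.1 <= (sval q').1.1, (sval q').1.2 <= (sval q).1.2,
        (sval q).2.1 <= (sval q').2.1, (sval q').2.2 <= (sval q).2.2 &
        ((sval q').1.2 - (sval q').1.1 = ((sval q).1.2 - (sval q).1.1) / 2) /\
        ((sval q').2.2 - (sval q').2.1 = ((sval q).2.2 - (sval q).2.1) / 2)].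
  move=> [[[a1 b1] [c1 d1]] /= [/= ab1 cd1 P1]].
  case: (PS _ _ _ _ ab1 cd1 P1) => P'.
  - unshelve eexists (exist _ ((a1, (a1 + b1) / 2), (c1, (c1 + d1) / 2)) _);
      [by split => //=; lra|by split => /=; lra].
  - unshelve eexists (exist _ (((a1 + b1) / 2, b1), (c1, (c1 + d1) / 2)) _);
      [by split => //=; lra|by split => /=; lra].
  - unshelve eexists (exist _ ((a1, (a1 + b1) / 2), ((c1 + d1) / 2, d1)) _);
      [by split => //=; lra|by split => /=; lra].
  - unshelve eexists (exist _ (((a1 + b1) / 2, b1), ((c1 + d1) / 2, d1)) _);
      [by split => //=; lra|by split => /=; lra].
pose q0 : T := exist _ ((a, b), (c, d)) (And3 ab cd P0).
pose q n := sval (iter n f q0).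
have qP n : [/\ (q n).1.1 <= (q n).1.2, (q n).2.1 <= (q n).2.2 &
    P (q n).1.1 (q n).1.2 (q n).2.1 (q n).2.2] by rewrite /q; case: (iter n f q0).
have [x xP] : exists x, forall n, (q n).1.1 <= x <= (q n).1.2.
  apply: (@nested_intervals (fun n => (q n).1.1) (fun n => (q n).1.2)) => n;
  by [case: (fP (iter n f q0))|case: (qP n)].
have [y yP] : exists y, forall n, (q n).2.1 <= y <= (q n).2.2.
  apply: (@nested_intervals (fun n => (q n).2.1) (fun n => (q n).2.2)) => n;
  by [case: (fP (iter n f q0))|case: (qP n)].
have wx n : (q n).1.2 - (q n).1.1 = (b - a) / 2 ^+ n.
  elim: n => [|n IH]; first by rewrite expr0 divr1.
  have [_ _ _ _ [-> _]] := fP (iter n f q0).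
  by rewrite -/(q n) IH exprS invfM; ring.
have wy n : (q n).2.2 - (q n).2.1 = (d - c) / 2 ^+ n.
  elim: n => [|n IH]; first by rewrite expr0 divr1.
  have [_ _ _ _ [_ ->]] := fP (iter n f q0).
  by rewrite -/(q n) IH exprS invfM; ring.
have mon n : [/\ a <= (q n).1.1, (q n).1.2 <= b, c <= (q n).2.1 & (q n).2.2 <= d].
  elim: n => [|n [h1 h2 h3 h4]]; first by split => /=.
  have [g1 g2 g3 g4 _] := fP (iter n f q0).
  by split; [exact: le_trans g1|exact: le_trans h2|exact: le_trans g3|exact: le_trans h4].
exists x, y => e e0.
have [n ne] : exists n, (b - a + (d - c)) / 2 ^+ n < e.
  by apply: half_expn_lt => //; rewrite addr_ge0// subr_ge0.
exists (q n).1.1, (q n).1.2, (q n).2.1, (q n).2.2.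
have [h1 h2 h3 h4] := mon n; have [k1 k2 Pn] := qP n.
have /andP[x1 x2] := xP n; have /andP[y1 y2] := yP n.
split; rewrite ?h1 ?h2 ?h3 ?h4 ?x1 ?x2 ?y1 ?y2//.
have := wx n; have := wy n; move: ne; rewrite mulrDl.
by split; [|split] => //; lra.
Qed.

End bisection.

Section goursat.
Context {R : realType}.
Local Notation C := (Cx R).
Variable N : R.
Local Notation prim := (primitive N).

(* The imaginary part of the integral of [h dz] over the boundary of the
   rectangle [a, b] x [c, d]. *)
Definition boundary_integral (h : C -> C) (a b c d : R) : R :=
  let I phi s t := prim phi t - prim phi s in
  I (fun t => complex.Im (h (t +i* c))) a b + I (fun t => complex.Re (h (b +i* t))) c d
  - I (fun t => complex.Im (h (t +i* d))) a b - I (fun t => complex.Re (h (a +i* t))) c d.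

Lemma boundary_integral_splitx h m a b c d :
  boundary_integral h a b c d =
  boundary_integral h a m c d + boundary_integral h m b c d.
Proof. by rewrite /boundary_integral; ring. Qed.

Lemma boundary_integral_splity h m a b c d :
  boundary_integral h a b c d =
  boundary_integral h a b c m + boundary_integral h a b m d.
Proof. by rewrite /boundary_integral; ring. Qed.

Definition in_rect (a b c d : R) (z : C) : Prop :=
  a <= complex.Re z <= b /\ c <= complex.Im z <= d.

Lemma continuous_horizontal (h : C -> C) c : continuous h ->
  continuous (fun t : R => complex.Im (h (t +i* c))).
Proof.
move=> hc t; apply: (@continuous_comp _ _ _ (fun t => h (t +i* c)) (@complex.Im R));
  last exact: Im_continuous.
apply: (@continuous_comp _ _ _ (fun t => (t +i* c : C)) h); last exact: hc.
by apply: Complex_comp_continuous; [exact: cvg_id|exact: cvg_cst].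
Qed.

Lemma continuous_vertical (h : C -> C) c : continuous h ->
  continuous (fun t : R => complex.Re (h (c +i* t))).
Proof.
move=> hc t; apply: (@continuous_comp _ _ _ (fun t => h (c +i* t)) (@complex.Re R));
  last exact: Re_continuous.
apply: (@continuous_comp _ _ _ (fun t => (c +i* t : C)) h); last exact: hc.
by apply: Complex_comp_continuous; [exact: cvg_cst|exact: cvg_id].
Qed.

(** The boundary integral of the affine function [K + B * z] is exactly zero, so only the errors on
    the four sides remain, each at most [e] times the length of its side. *)
Lemma boundary_integral_affine (h : C -> C) (K B : C) a b c d e : continuous h ->
  - N < a -> a <= b -> b < N -> - N < c -> c <= d -> d < N ->
  (forall z, in_rect a b c d z -> modulus (h z - (K + B * z)) <= e) ->
  `|boundary_integral h a b c d| <= 2 * e * ((b - a) + (d - c)).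
Proof.
move=> hc Na ab bN Nc cd dN he.
have hor y : c <= y <= d ->
  `|(prim (fun t => complex.Im (h (t +i* y))) b - prim (fun t => complex.Im (h (t +i* y))) a)
  - ((complex.Im K + complex.Re B * y) * (b - a) + complex.Im B * (b ^+ 2 - a ^+ 2) / 2)| <= e * (b - a).
  move=> yd; apply: primitive_affine => //; first exact: continuous_horizontal.
  move=> t tab; apply: le_trans (he (t +i* y) _); last by split.
  apply: le_trans (modulus_Im _); rewrite le_eqVlt; apply/orP; left; apply/eqP.
  by congr `|_|; case: (h _) (K) (B) => ? ? [? ?] [? ?] /=; ring.
have ver x : a <= x <= b ->
  `|(prim (fun t => complex.Re (h (x +i* t))) d - prim (fun t => complex.Re (h (x +i* t))) c)
  - ((complex.Re K + complex.Re B * x) * (d - c) + - complex.Im B * (d ^+ 2 - c ^+ 2) / 2)| <= e * (d - c).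
  move=> xb; apply: primitive_affine => //; first exact: continuous_vertical.
  move=> t tab; apply: le_trans (he (x +i* t) _); last by split.
  apply: le_trans (modulus_Re _); rewrite le_eqVlt; apply/orP; left; apply/eqP.
  by congr `|_|; case: (h _) (K) (B) => ? ? [? ?] [? ?] /=; ring.
have := hor c; have := hor d; have := ver a; have := ver b.
rewrite !lexx ab cd => /(_ isT) + /(_ isT) + /(_ isT) + /(_ isT).
rewrite /boundary_integral !ler_norml.
move: (prim _ b - prim _ a) => I1; move: (prim _ b - prim _ a) => I2.
move: (prim _ d - prim _ c) => J1; move: (prim _ d - prim _ c) => J2.
move=> /andP[h1 h2] /andP[h3 h4] /andP[h5 h6] /andP[h7 h8].
by apply/andP; split; nra.
Qed.

(** Four rectangles that avoid the exceptional point are cut off and contribute nothing. What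
    remains is a square of perimeter [8 * t]. *)
Lemma boundary_integral_shrink (h : C -> C) a b c d x0 y0 t M : continuous h ->
  - N < a -> b < N -> - N < c -> d < N ->
  (forall a' b' c' d', a <= a' -> a' <= b' -> b' <= b -> c <= c' -> c' <= d' -> d' <= d ->
     ~ in_rect a' b' c' d' (x0 +i* y0) -> boundary_integral h a' b' c' d' = 0) ->
  0 < t -> a <= x0 - t -> x0 + t <= b -> c <= y0 - t -> y0 + t <= d ->
  (forall z, in_rect (x0 - t) (x0 + t) (y0 - t) (y0 + t) z -> modulus (h z) <= M) ->
  `|boundary_integral h a b c d| <= 8 * M * t.
Proof.
move=> hc Na bN Nc dN h0 t0 at0 tb ct td hM.
have Z1 : boundary_integral h a (x0 - t) c d = 0.
  by apply: h0; try (by lra); move=> [/= /andP[_ ?] _]; lra.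
have Z2 : boundary_integral h (x0 + t) b c d = 0.
  by apply: h0; try (by lra); move=> [/= /andP[? _] _]; lra.
have Z3 : boundary_integral h (x0 - t) (x0 + t) c (y0 - t) = 0.
  by apply: h0; try (by lra); move=> [_ /= /andP[_ ?]]; lra.
have Z4 : boundary_integral h (x0 - t) (x0 + t) (y0 + t) d = 0.
  by apply: h0; try (by lra); move=> [_ /= /andP[? _]]; lra.
rewrite (boundary_integral_splitx h (x0 - t)) Z1 add0r.
rewrite (boundary_integral_splitx h (x0 + t)) Z2 addr0.
rewrite (boundary_integral_splity h (y0 - t)) Z3 add0r.
rewrite (boundary_integral_splity h (y0 + t)) Z4 addr0.
have -> : 8 * M * t = 2 * M * ((x0 + t) - (x0 - t) + ((y0 + t) - (y0 - t))) by ring.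
apply: (boundary_integral_affine (K := 0) (B := 0) hc); try (by lra).
by move=> z /hM; rewrite mul0r addr0 subr0.
Qed.

(** A quarter has half the semiperimeter, hence a fourth of its square, so the four bounds add up to
    the bound for the whole. *)
Let quarter (i1 i2 i3 i4 e a b c d : R) (m := (a + b) / 2) (n := (c + d) / 2) :
  i1 <= e * (m - a + (n - c)) ^+ 2 -> i2 <= e * (m - a + (d - n)) ^+ 2 ->
  i3 <= e * (b - m + (n - c)) ^+ 2 -> i4 <= e * (b - m + (d - n)) ^+ 2 ->
  i1 + i2 + (i3 + i4) <= e * (b - a + (d - c)) ^+ 2.
Proof.
have -> : e * (m - a + (n - c)) ^+ 2 = e * (b - a + (d - c)) ^+ 2 / 4 by rewrite /m /n; field.
have -> : e * (m - a + (d - n)) ^+ 2 = e * (b - a + (d - c)) ^+ 2 / 4 by rewrite /m /n; field.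
have -> : e * (b - m + (n - c)) ^+ 2 = e * (b - a + (d - c)) ^+ 2 / 4 by rewrite /m /n; field.
have -> : e * (b - m + (d - n)) ^+ 2 = e * (b - a + (d - c)) ^+ 2 / 4 by rewrite /m /n; field.
by lra.
Qed.

(** Affine approximation is asked for only inside the rectangle: the function it will be applied to
    is extended to the plane by a retraction and need not be differentiable across the boundary. *)
Lemma goursat (h : C -> C) a b c d : continuous h ->
  - N < a -> a <= b -> b < N -> - N < c -> c <= d -> d < N ->
  (forall p, in_rect a b c d p -> exists K B, forall e, 0 < e ->
     exists2 dl, 0 < dl & forall z, in_rect a b c d z -> modulus (z - p) < dl ->
       modulus (h z - (K + B * z)) <= e * modulus (z - p)) ->
  boundary_integral h a b c d = 0.
Proof.
move=> hc Na ab bN Nc cd dN hp.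
apply/eqP/negPn/negP => I0.
(* With [s] the semiperimeter, this puts [e * s ^+ 2] below the modulus of the integral; the summand
   1 keeps the denominator positive for a degenerate rectangle. *)
pose e := `|boundary_integral h a b c d| / (2 * (b - a + (d - c) + 1) ^+ 2).
have D0 : 0 < b - a + (d - c) + 1 by rewrite ltr_wpDl// addr_ge0// subr_ge0.
have e0 : 0 < e by rewrite divr_gt0 ?normr_gt0// mulr_gt0// exprn_gt0.
pose P a b c d := e * (b - a + (d - c)) ^+ 2 < `|boundary_integral h a b c d|.
have [||x [y xy]] := @bisect_rectangle R P a b c d ab cd.
- rewrite /P /e mulrAC ltr_pdivrMr ?mulr_gt0 ?exprn_gt0//.
  by rewrite ltr_pM2l ?normr_gt0//; nra.
- move=> a1 b1 c1 d1 ab1 cd1 /=; set m := (a1 + b1) / 2; set n := (c1 + d1) / 2.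
  rewrite /P => P1.
  have [h1|] := leP `|boundary_integral h a1 m c1 n| (e * (m - a1 + (n - c1)) ^+ 2);
    last by constructor 1.
  have [h2|] := leP `|boundary_integral h m b1 c1 n| (e * (b1 - m + (n - c1)) ^+ 2);
    last by constructor 2.
  have [h3|] := leP `|boundary_integral h a1 m n d1| (e * (m - a1 + (d1 - n)) ^+ 2);
    last by constructor 3.
  have [h4|] := leP `|boundary_integral h m b1 n d1| (e * (b1 - m + (d1 - n)) ^+ 2);
    last by constructor 4.
  exfalso; move: P1; apply/negP; rewrite -leNgt.
  rewrite (boundary_integral_splitx h m) (boundary_integral_splity h n) (boundary_integral_splity h n m).
  apply: (le_trans (ler_normD _ _)).
  apply: (le_trans (lerD (ler_normD _ _) (ler_normD _ _))).
  exact: (quarter h1 h3 h2 h4).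
(* On a small rectangle of semiperimeter [s] the approximation error is at most [e / 4 * s], so the
   integral is at most [2 * (e / 4 * s) * s], half of the [e * s ^+ 2] that the bisection keeps it
   above. *)
have e4 : 0 < e / 4 by rewrite divr_gt0.
have pR : in_rect a b c d (x +i* y).
  have [a' [b' [c' [d' [/andP[? ?] /andP[? ?] /andP[? ?] /andP[? ?] _]]]]] := xy 1 ltr01.
  by split => /=; apply/andP; split; lra.
have [K [B /(_ _ e4)[dl dl0 dP]]] := hp _ pR.
have dl2 : 0 < dl / 2 by rewrite divr_gt0.
have [a' [b' [c' [d' [/andP[? ?] /andP[? ?] /andP[? ?] /andP[? ?] [? [? +]]]]]]] := xy _ dl2.
rewrite /P; apply/negP; rewrite -leNgt.
clear xy P pR hp; clearbody e; clear I0.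
apply: (@le_trans _ _ (2 * (e / 4 * (b' - a' + (d' - c'))) * (b' - a' + (d' - c')))); last first.
  have -> : 2 * (e / 4 * (b' - a' + (d' - c'))) * (b' - a' + (d' - c'))
    = e * (b' - a' + (d' - c')) ^+ 2 / 2 by field.
  have halve (u : R) : 0 <= u -> u / 2 <= u by lra.
  by apply: halve; apply: mulr_ge0; [exact: ltW|exact: sqr_ge0].
apply: (boundary_integral_affine (K := K) (B := B)) => //; try by lra.
move=> z [/andP[z1 z2] /andP[z3 z4]].
have zxy : modulus (z - (x +i* y)) <= b' - a' + (d' - c').
  apply: le_trans (modulus_le _) _; case: z z1 z2 z3 z4 => z1 z2 /= ? ? ? ?.
  by rewrite lerD// ler_norml; apply/andP; split; lra.
apply: le_trans (dP z _ _) _.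
- by split; apply/andP; split; lra.
- by apply: le_lt_trans zxy _; lra.
- by rewrite ler_wpM2l// ltW.
Qed.

End goursat.

(** * Complex differentiability by real estimates *)

Section complex_derivatives.
Context {R : realType}.
Local Notation C := (Cx R).

(** In this multiplied form the condition at [w = z] reads [0 <= 0], so punctured neighbourhoods
    disappear from the later arguments. *)
Lemma derivable_modulusP (f : C -> C) (z D : C) :
  is_derive (z : C) (1 : C) f D <-> forall e : R, 0 < e -> exists2 d : R, 0 < d &
    forall w, modulus (w - z) < d ->
      modulus (f w - f z - D * (w - z)) <= e * modulus (w - z).
Proof.
have key w : w != 0 :> C -> modulus (D - w^-1 * (f (w + z) - f z)) * modulus w =
    modulus (f (w + z) - f z - D * w).
  move=> w0; rewrite -modulusM -modulusN; congr modulus; field; exact: w0.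
split.
  move=> [df DE] e e0; subst D.
  have := df; rewrite /derivable => /cvg_ex[l lP].
  have lE : 'D_1 f z = l by apply/cvg_lim => //; exact: Cx_hausdorff.
  move/(@cvgrPdist_le C C) : lP => /(_ e%:C); rewrite ltcR => /(_ e0).
  rewrite /prop_near1 /= => /nbhs_modulusP[d d0 dP]; exists d => // w wd.
  have [->|wz] := eqVneq w z; first by rewrite !subrr mulr0 subr0 modulus0 mulr0.
  have w0 : w - z != 0 by rewrite subr_eq0.
  have := dP (w - z); rewrite subr0 => /(_ wd w0).
  rewrite /GRing.scale /= mulr1 modulusE lecR => le; rewrite -{1}(subrK z w).
  have := key _ w0; rewrite lE => <-.
  by rewrite ler_wpM2r ?modulus_ge0//.
move=> H.
have lP : h^-1 *: (f (h *: 1 + z) - f z) @[h --> 0^'] --> D.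
  apply/(@cvgrPdist_le C C) => /= e /Cx_gt0_real[{}e e0 ->].
  rewrite /prop_near1 /=; apply/nbhs_modulusP; have [d d0 dP] := H _ e0.
  exists d => // w; rewrite subr0 => wd w0.
  rewrite /GRing.scale /= mulr1 modulusE lecR.
  have := dP (w + z); rewrite addrK => /(_ wd).
  rewrite -key// ler_pM2r// lt_neqAle modulus_ge0 eq_sym modulus_eq0.
  by rewrite w0.
by split; [apply/cvg_ex; exists D|apply/cvg_lim => //; exact: Cx_hausdorff].
Qed.

Lemma derivable_mul (f g : C -> C) (z : C) : derivable f z 1 -> derivable g z 1 ->
  derivable (fun w => f w * g w) z 1.
Proof. exact: (@derivableM C C f g z 1). Qed.

Lemma derivable_sub (f g : C -> C) (z : C) : derivable f z 1 -> derivable g z 1 ->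
  derivable (fun w => f w - g w) z 1.
Proof. exact: (@derivableB C C C f g z 1). Qed.

Lemma derivable_inv (f : C -> C) (z : C) : f z != 0 -> derivable f z 1 ->
  derivable (fun w => (f w)^-1) z 1.
Proof. exact: (@derivableV C C f z 1). Qed.

Lemma derivable_exp (f : C -> C) (z : C) n : derivable f z 1 ->
  derivable (fun w => f w ^+ n) z 1.
Proof.
move=> fz; elim: n => [|n IH]; first exact: derivable_cst.
by under eq_fun do rewrite exprS; exact: derivable_mul.
Qed.

Lemma derivable_subc (z0 z : C) : derivable (fun w : C => w - z0) z 1.
Proof.
by apply: (@derivable_sub id (fun=> z0)); [exact: derivable_id|exact: derivable_cst].
Qed.

Lemma derivable_ex (f : C -> C) (z : C) : derivable f z 1 -> exists D : C,
  forall e : R, 0 < e -> exists2 d : R, 0 < d &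
    forall w, modulus (w - z) < d ->
      modulus (f w - f z - D * (w - z)) <= e * modulus (w - z).
Proof.
by move=> /derivableP df; exists ('D_1 f z); apply/derivable_modulusP.
Qed.

Lemma affine_continuous (f : C -> C) (z D : C) (d : R) : 0 < d ->
  (forall w, modulus (w - z) < d ->
      modulus (f w - f z - D * (w - z)) <= modulus (w - z)) -> {for z, continuous f}.
Proof.
move=> d0 H; apply/continuous_modulusP => e e0.
have D0 : 0 < modulus D + 1 by rewrite ltr_wpDl// modulus_ge0.
exists (Num.min d (e / (modulus D + 1))); first by rewrite lt_min d0 divr_gt0.
move=> w; rewrite lt_min => /andP[/H wd we].
have -> : f w - f z = (f w - f z - D * (w - z)) + D * (w - z) by ring.
apply: le_lt_trans (modulusD _ _) _; rewrite modulusM.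
move: we; rewrite ltr_pdivlMr//; nra.
Qed.

Lemma continuous_nonexpansive (f : R -> R) :
  (forall x y, `|f x - f y| <= `|x - y|) -> continuous f.
Proof.
move=> H x; apply/(@cvgrPdist_lt R R) => e e0; near=> y.
apply: (le_lt_trans (H _ _)); near: y.
exact: (@nbhsx_ballx _ R x e e0).
Unshelve. all: by end_near. Qed.

Definition clamp_itv (a b x : R) : R := Num.max a (Num.min x b).

Lemma clamp_itv_continuous a b : continuous (clamp_itv a b).
Proof.
move=> t; apply: (@continuous_comp _ _ _ (fun x => Num.min x b) (Num.max a)).
  apply: continuous_nonexpansive => x y.
  have h1 := ler_norm (x - y); have h2 := ler_norm (y - x); rewrite distrC in h2.
  by rewrite ler_norml; case: (leP x b) => xb; case: (leP y b) => yb; apply/andP; split; lra.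
apply: continuous_nonexpansive => x y.
have h1 := ler_norm (x - y); have h2 := ler_norm (y - x); rewrite distrC in h2.
by rewrite ler_norml; case: (leP a x) => xb; case: (leP a y) => yb; apply/andP; split; lra.
Qed.

Lemma clamp_itvP a b x : a <= b -> a <= clamp_itv a b x <= b.
Proof. by move=> ab; rewrite /clamp_itv le_max lexx /= ge_max ab ge_min lexx orbT. Qed.

Lemma clamp_itv_id a b x : a <= x <= b -> clamp_itv a b x = x.
Proof. by move=> /andP[ax xb]; rewrite /clamp_itv min_l// max_r. Qed.

End complex_derivatives.

(** * A crude bound by boundary values on a rectangle *)

Section max_modulus.
Context {R : realType}.
Local Notation C := (Cx R).
Variables (a b c d : R).

Definition inner_rect (z : C) : Prop :=
  a < complex.Re z < b /\ c < complex.Im z < d.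

Definition frame (z : C) : Prop := in_rect a b c d z /\ ~ inner_rect z.

Lemma frameP (z : C) : in_rect a b c d z ->
  [\/ complex.Re z = a, complex.Re z = b, complex.Im z = c | complex.Im z = d] -> frame z.
Proof.
move=> zR zE; split => // -[/andP[z1 z2] /andP[z3 z4]].
by case: zE => zE; move: z1 z2 z3 z4; rewrite zE ltxx.
Qed.

Lemma difference_quotient_derivable (f h : C -> C) (z0 z : C) :
  derivable f z 1 -> z != z0 ->
  (forall w, w != z0 -> h w = (f w - f z0) / (w - z0)) ->
  exists D, is_derive (z : C) (1 : C) h D.
Proof.
move=> fz zz0 hE.
pose g w := (f w - f z0) * (w - z0)^-1.
have dg : derivable g z 1.
  apply: (@derivable_mul _ (fun w => f w - f z0) (fun w => (w - z0)^-1)).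
    by apply: (@derivable_sub _ f (fun=> f z0)); [exact: fz|exact: derivable_cst].
  by apply: (@derivable_inv _ (fun w => w - z0)); [rewrite subr_eq0|exact: derivable_subc].
exists ('D_1 g z); apply/derivable_modulusP => e e0.
have /derivableP/derivable_modulusP/(_ e e0)[dl dl0 dP] := dg.
have zz : 0 < modulus (z - z0).
  by rewrite lt_neqAle modulus_ge0 eq_sym modulus_eq0 subr_eq0 zz0.
exists (Num.min dl (modulus (z - z0))); first by rewrite lt_min dl0.
move=> w; rewrite lt_min => /andP[/dP]; rewrite /g => + wz.
rewrite !hE// ; apply/eqP => wE; move: wz.
by rewrite wE modulusB ltxx.
Qed.

(* With [h = p +i* q], [z - z0 = u +i* v] and [h * (z - z0) = f - 1]: on the side
   of a rectangle where [v <= - mu], a small [f] forces [Im h < 0]. The other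
   sides follow by quarter turns. *)
Lemma pole_sign (p q u v f1 f2 m D mu : R) :
  p * u - q * v = f1 - 1 -> p * v + q * u = f2 ->
  `|f1| <= m -> `|f2| <= m -> `|u| + `|v| <= D -> m * D < mu -> v <= - mu -> q < 0.
Proof.
move=> h1 h2 f1m f2m uv mD vmu.
have m0 : 0 <= m by exact: le_trans f1m.
(* With [w = u +i* v], this is the imaginary part of [h * |w|^2 = (f - 1) * conj w]. *)
have e1 : q * (u ^+ 2 + v ^+ 2) = (u * f2 - v * f1) + v 
  by have -> : f1 = p * u - q * v + 1; [lra|rewrite -h2; ring].
have e2 : u * f2 - v * f1 <= m * D.
  apply: (le_trans (ler_norm _)); apply: (le_trans (ler_normB _ _)).
  rewrite !normrM.
  apply: (le_trans (lerD (ler_wpM2l (normr_ge0 u) f2m) (ler_wpM2l (normr_ge0 v) f1m))).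
  by rewrite -mulrDl mulrC ler_wpM2l.
have s0 : 0 < u ^+ 2 + v ^+ 2.
  rewrite ltr_wpDl ?sqr_ge0// lt_neqAle sqr_ge0 andbT eq_sym sqrf_eq0.
  apply: ltr0_neq0; apply: (le_lt_trans vmu); rewrite oppr_lt0.
  by apply: le_lt_trans mD; rewrite mulr_ge0//; apply: le_trans uv; rewrite addr_ge0.
by rewrite -(pmulr_llt0 _ s0) e1; lra.
Qed.

End max_modulus.

Section max_modulus_rectangle.
Context {R : realType}.
Local Notation C := (Cx R).
Lemma in_rect_dist a b c d (z w : C) : in_rect a b c d z -> in_rect a b c d w ->
  `|complex.Re (z - w)| <= b - a /\ `|complex.Im (z - w)| <= d - c.
Proof.
case: z w => z1 z2 [w1 w2] [/= /andP[? ?] /andP[? ?]] [/= /andP[? ?] /andP[? ?]].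
by split; rewrite ler_norml; apply/andP; split; lra.
Qed.

Section crude_bound.
Variables (a b c d : R).
Variables (f : C -> C) (z0 : C) (m : R).
Hypothesis fd : forall z, in_rect a b c d z -> derivable f z 1.
Hypothesis z0P : inner_rect a b c d z0.
Hypothesis f1 : f z0 = 1.
Hypothesis fm : forall z, frame a b c d z -> modulus (f z) <= m.

Let D0 : C := 'D_1 f z0.
(** The quotient is 0 at [z0], division by 0 giving 0, and the second summand supplies the
    derivative there, which makes [h] continuous. *)
Let h (w : C) : C := (f w - f z0) / (w - z0) + (if w == z0 then D0 else 0).
(** The retraction onto the rectangle: composing with it makes [h] continuous on the whole plane, as
    the lemmas on boundary integrals ask. *)
Let proj (z : C) : C :=
  clamp_itv a b (complex.Re z) +i* clamp_itv c d (complex.Im z).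
Let H : C -> C := h \o proj.
Let N := `|a| + `|b| + `|c| + `|d| + 1.

Let z0R : in_rect a b c d z0.
Proof. by have [/andP[? ?] /andP[? ?]] := z0P; split; apply/andP; split; exact: ltW. Qed.

Let ab : a < b.
Proof. by have [/andP[h1 h2] _] := z0P; exact: lt_trans h2. Qed.

Let cd : c < d.
Proof. by have [_ /andP[h1 h2]] := z0P; exact: lt_trans h2. Qed.

Let hE w : w != z0 -> h w = (f w - f z0) / (w - z0).
Proof. by rewrite /h => /negbTE ->; rewrite addr0. Qed.

Let h_continuous z : in_rect a b c d z -> {for z, continuous h}.
Proof.
move=> zR; have [->|zz0] := eqVneq z z0.
  apply/continuous_modulusP => e e0.
  have /derivableP/derivable_modulusP := fd z0R.
  have e2 : 0 < e / 2 by rewrite divr_gt0.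
  move=> /(_ _ e2)[dl dl0 dP]; exists dl => // w wd.
  have [->|wz] := eqVneq w z0; first by rewrite subrr modulus0.
  have w0 : 0 < modulus (w - z0).
    by rewrite lt_neqAle modulus_ge0 eq_sym modulus_eq0 subr_eq0 wz.
  have h0 : h z0 = D0 by rewrite /h !subrr mul0r eqxx add0r.
  rewrite hE// h0 -(ltr_pM2r w0) -modulusM mulrBl divfK ?subr_eq0//.
  by apply: (le_lt_trans (dP _ wd)); rewrite ltr_pM2r//; lra.
have [D /derivable_modulusP/(_ 1 ltr01)[dl dl0 dP]] :=
  difference_quotient_derivable (fd zR) zz0 hE.
by apply: (affine_continuous dl0 (D := D)) => w /dP; rewrite mul1r.
Qed.

Let proj_continuous : continuous proj.
Proof.
move=> z; have cr : continuous (fun z : C => clamp_itv a b (complex.Re z)).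
  move=> w; apply: (@continuous_comp _ _ _ (@complex.Re R : C -> R) (clamp_itv a b)).
    exact: Re_continuous.
  exact: clamp_itv_continuous.
have ci : continuous (fun z : C => clamp_itv c d (complex.Im z)).
  move=> w; apply: (@continuous_comp _ _ _ (@complex.Im R : C -> R) (clamp_itv c d)).
    exact: Im_continuous.
  exact: clamp_itv_continuous.
exact: (Complex_comp_continuous (cr z) (ci z)).
Qed.

Let projP z : in_rect a b c d (proj z).
Proof. by split; apply: clamp_itvP; exact: ltW. Qed.

Let H_continuous : continuous H.
Proof.
move=> z; apply: continuous_comp; first exact: proj_continuous.
exact: h_continuous (projP z).
Qed.

Let HE z : in_rect a b c d z -> H z = h z.
Proof.
by case: z => x y [/= xP yP]; rewrite /H /proj /= !clamp_itv_id.
Qed.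

Let itvN x : a <= x <= b -> - N < x < N.
Proof.
move=> /andP[ax xb]; rewrite /N.
have := ler_norm (- a); have := ler_norm b; rewrite normrN.
have := normr_ge0 a; have := normr_ge0 b; have := normr_ge0 c; have := normr_ge0 d.
by move=> *; apply/andP; split; lra.
Qed.

Let itvN' x : c <= x <= d -> - N < x < N.
Proof.
move=> /andP[ax xb]; rewrite /N.
have := ler_norm (- c); have := ler_norm d; rewrite normrN.
have := normr_ge0 a; have := normr_ge0 b; have := normr_ge0 c; have := normr_ge0 d.
by move=> *; apply/andP; split; lra.
Qed.

Local Notation I := (boundary_integral N H).

Let I_regular a' b' c' d' : a <= a' -> a' <= b' -> b' <= b ->
  c <= c' -> c' <= d' -> d' <= d -> ~ in_rect a' b' c' d' z0 -> I a' b' c' d' = 0.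
Proof.
move=> aa ab' bb cc cd' dd z0n.
have sub z : in_rect a' b' c' d' z -> in_rect a b c d z.
  move=> [/andP[? ?] /andP[? ?]]; split; apply/andP; split; lra.
have [/andP[? ?] /andP[? ?]] : (- N < a' < N) /\ (- N < b' < N).
  by split; apply: itvN; apply/andP; split; lra.
have [/andP[? ?] /andP[? ?]] : (- N < c' < N) /\ (- N < d' < N).
  by split; apply: itvN'; apply/andP; split; lra.
apply: goursat => //.
move=> p pR; have pz0 : p != z0 by apply/eqP => pE; apply: z0n; rewrite -pE.
have [D /derivable_modulusP dP] := difference_quotient_derivable (fd (sub _ pR)) pz0 hE.
exists (h p - D * p), D => e e0; have [dl dl0 dlP] := dP _ e0.
exists dl => // z zR /dlP; rewrite HE; last exact: sub.
by congr (modulus _ <= _); ring.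
Qed.

(** Goursat applies away from [z0], and at [z0] continuity of [H] suffices: the integral equals the
    one over a square of half-side [t] around [z0], which is of order [t]. *)
Let I_zero : I a b c d = 0.
Proof.
have [e1 e10 He1] : exists2 e : R, 0 < e & forall w, modulus (w - z0) < e ->
    modulus (H w - H z0) < 1.
  by have /continuous_modulusP/(_ 1 ltr01)[e e0 eP] := @H_continuous z0; exists e.
have [x1 y1] := z0P; move/andP: x1 => [x1 x2]; move/andP: y1 => [y1 y2].
set x0 := complex.Re z0 in x1 x2; set y0 := complex.Im z0 in y1 y2.
pose M := modulus (H z0) + 1.
have M0 : 0 < M by rewrite ltr_wpDl ?modulus_ge0.
have [/andP[Na _] /andP[_ bN]] : (- N < a < N) /\ (- N < b < N).
  by split; apply: itvN; rewrite lexx ltW.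
have [/andP[Nc _] /andP[_ dN]] : (- N < c < N) /\ (- N < d < N).
  by split; apply: itvN'; rewrite lexx ltW.
have z0E : x0 +i* y0 = z0 by rewrite /x0 /y0; case: (z0).
have small t : 0 < t -> a <= x0 - t -> x0 + t <= b -> c <= y0 - t -> y0 + t <= d ->
    4 * t < e1 -> `|I a b c d| <= 8 * M * t.
  move=> t0 at0 tb ct td te.
  apply: (boundary_integral_shrink H_continuous Na bN Nc dN _ t0 at0 tb ct td).
    by move=> *; apply: I_regular => //; rewrite -z0E.
  move=> z zt; rewrite -(subrK (H z0) (H z)); apply: (le_trans (modulusD _ _)).
  rewrite /M addrC lerD2l; apply/ltW/He1.
  apply: (le_lt_trans (modulus_le _)); apply: (le_lt_trans _ te).
  have z0t : in_rect (x0 - t) (x0 + t) (y0 - t) (y0 + t) z0.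
    by rewrite -z0E; split; rewrite /= gerBl lerDl ltW.
  have [r1 r2] := in_rect_dist zt z0t; apply: (le_trans (lerD r1 r2)).
  by rewrite le_eqVlt; apply/orP; left; apply/eqP; ring.
apply/eqP/negPn/negP => I0.
have I0' : 0 < `|I a b c d| by rewrite normr_gt0.
(* The first four bounds keep the square inside the rectangle, [e1 / 8] keeps [H] within 1 of [H z0]
   on it, and the last one makes [8 * M * t] at most half of the modulus of the integral. *)
pose t := Num.min (Num.min (Num.min (x0 - a) (b - x0)) (Num.min (y0 - c) (d - y0)))
  (Num.min (e1 / 8) (`|I a b c d| / (16 * M))).
have t0 : 0 < t by rewrite /t !lt_min !subr_gt0 x1 x2 y1 y2 !divr_gt0 ?mulr_gt0.
have : t <= t by []. rewrite {2}/t !le_min => /andP[/andP[/andP[? ?] /andP[? ?]] /andP[te tI]].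
have := @small t t0. rewrite ler_pdivlMr ?mulr_gt0// in tI.
have te' : 4 * t < e1 by lra.
move=> /(_ _ _ _ _ te') H5.
have : `|I a b c d| <= 8 * M * t by apply: H5; lra.
by lra.
Qed.

Let mu := Num.min (Num.min (complex.Re z0 - a) (b - complex.Re z0))
  (Num.min (complex.Im z0 - c) (d - complex.Im z0)).

(** If [f] is small on the frame, [H] is close there to [- 1 / (z - z0)], whose boundary integral
    has imaginary part [- 2 * pi]. That value is never computed: each of the four signed sides is
    negative, against [I_zero]. *)
Lemma frame_bound : mu <= m * ((b - a) + (d - c)).
Proof.
rewrite leNgt; apply/negP => mmu.
have [h1 h2 h3 h4] : [/\ mu <= complex.Re z0 - a, mu <= b - complex.Re z0,
    mu <= complex.Im z0 - c & mu <= d - complex.Im z0].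
  by have : mu <= mu by []; rewrite {2}/mu !le_min => /andP[/andP[? ?] /andP[? ?]].
have mu0 : 0 < mu.
  by have [/andP[? ?] /andP[? ?]] := z0P; rewrite /mu !lt_min !subr_gt0; do !(apply/andP; split).
have eq z : frame a b c d z -> z != z0 -> let w := z - z0 in
    complex.Re (H z) * complex.Re w - complex.Im (H z) * complex.Im w = complex.Re (f z) - 1 /\
    complex.Re (H z) * complex.Im w + complex.Im (H z) * complex.Re w = complex.Im (f z).
  move=> [zR _] zz0 /=.
  have : H z * (z - z0) = f z - 1 by rewrite HE// hE// f1 divfK// subr_eq0.
  by case: (H z) (z - z0) (f z) => ? ? [? ?] [? ?] /= [-> ->]; rewrite subr0.
have fr z : frame a b c d z -> z != z0 ->
    [/\ `|complex.Re (f z)| <= m, `|complex.Im (f z)| <= m &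
      `|complex.Re (z - z0)| + `|complex.Im (z - z0)| <= b - a + (d - c)].
  move=> zF zz0; split; [exact: le_trans (modulus_Re _) (fm zF)|exact: le_trans (modulus_Im _) (fm zF)|].
  by have [r1 r2] := in_rect_dist (proj1 zF) z0R; exact: lerD.
have bottom t : a <= t <= b -> complex.Im (H (t +i* c)) < 0.
  move=> tab; set z := t +i* c.
  have zF : frame a b c d z by apply: frameP; [split => //=; rewrite lexx ltW|constructor 3].
  have zz0 : z != z0 by apply: contraTneq mu0 => zE; rewrite -leNgt (le_trans h3)// -zE subrr.
  have [e1 e2] := eq z zF zz0; have [g1 g2 g3] := fr z zF zz0.
  apply: (pole_sign e1 e2 g1 g2 g3 mmu).
  by move: h3; rewrite /z; case: (z0) => ? ? /= ?; lra.
have right t : c <= t <= d -> complex.Re (H (b +i* t)) < 0.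
  move=> tab; set z := b +i* t.
  have zF : frame a b c d z by apply: frameP; [split => //=; rewrite lexx ltW|constructor 2].
  have zz0 : z != z0 by apply: contraTneq mu0 => zE; rewrite -leNgt (le_trans h2)// -zE subrr.
  have [e1 e2] := eq z zF zz0; have [g1 g2 g3] := fr z zF zz0.
  (* A quarter turn: [i * H z] and [- i * (z - z0)] have the same product as [H z] and [z - z0], and
     the right side takes the place of the bottom. The other two sides use the remaining turns. *)
  apply: (@pole_sign _ (- complex.Im (H z)) _ (complex.Im (z - z0)) (- complex.Re (z - z0))
    _ _ _ _ _ _ _ g1 g2 _ mmu).
  - by rewrite -e1; ring.
  - by rewrite -e2; ring.
  - by rewrite normrN addrC.
  - by rewrite lerN2; move: h2; rewrite /z; case: (z0) => ? ? /= ?; lra.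
have top t : a <= t <= b -> 0 < complex.Im (H (t +i* d)).
  move=> tab; set z := t +i* d.
  have zF : frame a b c d z by apply: frameP; [split => //=; rewrite lexx ltW|constructor 4].
  have zz0 : z != z0 by apply: contraTneq mu0 => zE; rewrite -leNgt (le_trans h4)// -zE subrr.
  have [e1 e2] := eq z zF zz0; have [g1 g2 g3] := fr z zF zz0.
  rewrite -oppr_lt0; apply: (@pole_sign _ (- complex.Re (H z)) _ (- complex.Re (z - z0))
    (- complex.Im (z - z0)) _ _ _ _ _ _ _ g1 g2 _ mmu).
  - by rewrite -e1; ring.
  - by rewrite -e2; ring.
  - by rewrite !normrN.
  - by rewrite lerN2; move: h4; rewrite /z; case: (z0) => ? ? /= ?; lra.
have left t : c <= t <= d -> 0 < complex.Re (H (a +i* t)).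
  move=> tab; set z := a +i* t.
  have zF : frame a b c d z by apply: frameP; [split => //=; rewrite lexx ltW|constructor 1].
  have zz0 : z != z0 by apply: contraTneq mu0 => zE; rewrite -leNgt (le_trans h1)// -zE subrr.
  have [e1 e2] := eq z zF zz0; have [g1 g2 g3] := fr z zF zz0.
  rewrite -oppr_lt0; apply: (@pole_sign _ (complex.Im (H z)) _ (- complex.Im (z - z0))
    (complex.Re (z - z0)) _ _ _ _ _ _ _ g1 g2 _ mmu).
  - by rewrite -e1; ring.
  - by rewrite -e2; ring.
  - by rewrite normrN addrC.
  - by move: h1; rewrite /z; case: (z0) => ? ? /= ?; lra.
have [/andP[Na _] /andP[_ bN]] : (- N < a < N) /\ (- N < b < N).
  by split; apply: itvN; rewrite lexx ltW.
have [/andP[Nc _] /andP[_ dN]] : (- N < c < N) /\ (- N < d < N).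
  by split; apply: itvN'; rewrite lexx ltW.
(* Each side integral is its length times one value of the integrand on that side, so pointwise
   signs decide. *)
have mvt_h y := primitive_MVT 0 0 (@continuous_horizontal R H y H_continuous) Na (ltW ab) bN.
have mvt_v x := primitive_MVT 0 0 (@continuous_vertical R H x H_continuous) Nc (ltW cd) dN.
have [t1 /bottom t1P B1] := mvt_h c; have [t2 /top t2P B2] := mvt_h d.
have [t3 /right t3P B3] := mvt_v b; have [t4 /left t4P B4] := mvt_v a.
move: B1 B2 B3 B4; rewrite !mul0r !addr0 !subr0 => B1 B2 B3 B4.
have := I_zero; rewrite /boundary_integral B1 B2 B3 B4 => E.
have ba : 0 < b - a by rewrite subr_gt0.
have dc : 0 < d - c by rewrite subr_gt0.
have := nmulr_rlt0 (b - a) t1P; have := nmulr_rlt0 (d - c) t3P.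
have := pmulr_rgt0 (b - a) t2P; have := pmulr_rgt0 (d - c) t4P.
rewrite ba dc; move: E; lra.
Qed.
End crude_bound.

End max_modulus_rectangle.

(** * The maximum modulus principle *)

Section max_modulus_principle.
Context {R : realType}.
Local Notation C := (Cx R).

(** Otherwise [(M / A) ^+ n] tends to 0 and falls below [c / (|D| + 1)]. A constant independent of
    [n] thus gets lost, which turns crude bounds for all powers into a sharp one. *)
Lemma power_trick (A M c D : R) : 0 < c -> 0 <= A -> 0 <= M ->
  (forall n, c * A ^+ n <= D * M ^+ n) -> A <= M.
Proof.
move=> c0 A0 M0 H; rewrite leNgt; apply/negP => MA.
have Ap : 0 < A by exact: le_lt_trans MA.
have r1 : `|M / A| < 1.
  by rewrite ger0_norm ?divr_ge0// ltr_pdivrMr// mul1r.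
have /(@cvgrPdist_lt R R)/(_ (c / (`|D| + 1))) := cvg_expr r1.
case; first by rewrite divr_gt0// ltr_wpDl.
move=> n _ /(_ n (leqnn n)) /=; rewrite sub0r normrN ger0_norm; last first.
  by rewrite exprn_ge0// divr_ge0.
rewrite ltr_pdivlMr ?ltr_wpDl// expr_div_n mulrAC ltr_pdivrMr ?exprn_gt0//.
move=> h; have := H n; apply/negP; rewrite -ltNge; apply: le_lt_trans h.
rewrite mulrC ler_wpM2l ?exprn_ge0//.
by apply: (le_trans (ler_norm D)); rewrite lerDl.
Qed.

Lemma max_modulus (f : C -> C) (a b c d M : R) (z0 : C) :
  (forall z, in_rect a b c d z -> derivable f z 1) -> inner_rect a b c d z0 ->
  (forall z, frame a b c d z -> modulus (f z) <= M) -> modulus (f z0) <= M.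
Proof.
move=> fd z0P fM.
have [/andP[az zb] /andP[cz zd]] := z0P.
have M0 : 0 <= M.
  apply: le_trans (fM (a +i* c) _); first exact: modulus_ge0.
  by apply: frameP; [split; rewrite /= lexx ltW// (lt_trans az, lt_trans cz)|constructor 1].
have [f0|f0] := eqVneq (f z0) 0; first by rewrite f0 modulus0.
have A0 : 0 < modulus (f z0) by exact: modulus_gt0.
pose mu := Num.min (Num.min (complex.Re z0 - a) (b - complex.Re z0))
  (Num.min (complex.Im z0 - c) (d - complex.Im z0)).
apply: (@power_trick _ _ mu ((b - a) + (d - c))) => //.
- by rewrite /mu !lt_min !subr_gt0 az zb cz zd.
- exact: modulus_ge0.
move=> n; rewrite -ler_pdivlMr ?exprn_gt0// mulrAC mulrC.
have crude := @frame_bound _ a b c d (fun w => (f w * (f z0)^-1) ^+ n) z0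
  (M ^+ n / modulus (f z0) ^+ n).
rewrite [leRHS](_ : _ = M ^+ n / modulus (f z0) ^+ n * (b - a + (d - c))); last by ring.
apply: crude; [|exact: z0P| |].
- move=> z zR; apply: (@derivable_exp _ (fun w => f w * (f z0)^-1)).
  apply: (@derivable_mul _ f (fun=> (f z0)^-1)); first exact: fd.
  exact: derivable_cst.
- by rewrite divff// expr1n.
- move=> z zF; rewrite modulusX modulusM modulusV expr_div_n.
  rewrite ler_wpM2r ?invr_ge0 ?exprn_ge0 ?modulus_ge0// lerXn2r ?nnegrE ?modulus_ge0//.
  exact: fM.
Qed.

Definition locally_bounded (f : C -> C) (s : C) := exists K d : R,
  [/\ 0 <= K, 0 < d & forall w, modulus (w - s) < d -> modulus (f w) <= K].

Lemma locally_bounded_mul f g s : locally_bounded f s -> locally_bounded g s ->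
  locally_bounded (fun w => f w * g w) s.
Proof.
move=> [K [d [K0 d0 fK]]] [L [e [L0 e0 gL]]]; exists (K * L), (Num.min d e).
split; rewrite ?mulr_ge0 ?lt_min ?d0//.
move=> w; rewrite lt_min => /andP[/fK wK /gL wL].
by rewrite modulusM ler_pM ?modulus_ge0.
Qed.

Lemma locally_bounded_sub f g s : locally_bounded f s -> locally_bounded g s ->
  locally_bounded (fun w => f w - g w) s.
Proof.
move=> [K [d [K0 d0 fK]]] [L [e [L0 e0 gL]]]; exists (K + L), (Num.min d e).
split; rewrite ?addr_ge0 ?lt_min ?d0//.
move=> w; rewrite lt_min => /andP[/fK wK /gL wL].
by apply: (le_trans (modulusD _ _)); rewrite modulusN lerD.
Qed.

Lemma locally_bounded_exp f s n : locally_bounded f s ->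
  locally_bounded (fun w => f w ^+ n) s.
Proof.
move=> fs; elim: n => [|n IH].
  by exists 1, 1; split => // w _; rewrite modulus1.
by under eq_fun do rewrite exprS; exact: locally_bounded_mul.
Qed.

Lemma derivable_locally_bounded (f : C -> C) (s : C) :
  derivable f s 1 -> locally_bounded f s.
Proof.
move=> /derivable_ex[D /(_ 1 ltr01)[d d0 dP]].
exists (modulus (f s) + (modulus D + 1)), (Num.min d 1).
split; rewrite ?addr_ge0 ?modulus_ge0 ?lt_min ?d0 ?ltr01//.
move=> w; rewrite lt_min => /andP[/dP wd w1].
have -> : f w = f s + (D * (w - s) + (f w - f s - D * (w - s))) by ring.
apply: (le_trans (modulusD _ _)); rewrite lerD2l.
apply: (le_trans (modulusD _ _)); rewrite modulusM mul1r in wd *.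
apply: lerD; last by apply: (le_trans wd); exact: ltW.
by rewrite ler_piMr ?modulus_ge0// ltW.
Qed.

Lemma difference_quotient_locally_bounded (f : C -> C) (s : C) :
  derivable f s 1 -> locally_bounded (fun w => (f w - f s) / (w - s)) s.
Proof.
move=> /derivable_ex[D /(_ 1 ltr01)[d d0 dP]].
exists (modulus D + 1), d; split; rewrite ?addr_ge0 ?modulus_ge0//.
move=> w /dP; have [->|ws] := eqVneq w s.
  by move=> _; rewrite !subrr mul0r modulus0 addr_ge0 ?modulus_ge0.
have w0 : 0 < modulus (w - s) by rewrite modulus_gt0// subr_eq0.
move=> wd; rewrite -(ler_pM2r w0) -modulusM divfK ?subr_eq0//.
have -> : f w - f s = D * (w - s) + (f w - f s - D * (w - s)) by ring.
by apply: (le_trans (modulusD _ _)); rewrite modulusM mulrDl lerD2l.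
Qed.

(** The product is of order [|w - s|^2], so its derivative at [s] is 0; a single factor [w - s]
    would give continuity only. *)
Lemma derivable_square_mul (g : C -> C) (s : C) : locally_bounded g s ->
  derivable (fun w => (w - s) ^+ 2 * g w) s 1.
Proof.
move=> [K [d [K0 d0 gK]]].
suff : is_derive (s : C) (1 : C) (fun w => (w - s) ^+ 2 * g w) 0 by case.
apply/derivable_modulusP => e e0.
exists (Num.min d (e / (K + 1))); first by rewrite lt_min d0 divr_gt0// ltr_wpDl.
move=> w; rewrite lt_min => /andP[/gK wK we].
rewrite subrr expr0n /= !mul0r !subr0 expr2 -mulrA modulusM mulrC ler_wpM2r ?modulus_ge0//.
rewrite ltr_pdivlMr ?ltr_wpDl// in we.
rewrite modulusM; apply: le_trans (ltW we).
by rewrite ler_wpM2l ?modulus_ge0//; apply: (le_trans wK); rewrite lerDl.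
Qed.

(* Multiplying [F ^+ n] by the square of [w - s] removes the singularity at
   [s], and the factor is negligible for large [n]. *)
Lemma max_modulus_removable (S : seq C) (F : C -> C) (a b c d M : R) (z0 : C) :
  (forall z, in_rect a b c d z -> z \notin S -> derivable F z 1) ->
  (forall s, s \in S -> locally_bounded F s) ->
  inner_rect a b c d z0 -> z0 \notin S ->
  (forall z, frame a b c d z -> modulus (F z) <= M) -> modulus (F z0) <= M.
Proof.
move=> + + z0P; have [/andP[az zb] /andP[cz zd]] := z0P.
have z0R : in_rect a b c d z0 by split; apply/andP; split; exact: ltW.
elim: S F M => [|s S IH] F M Fd Fb z0S FM.
  by apply: (max_modulus _ z0P FM) => z /Fd; apply.
have M0 : 0 <= M.
  apply: le_trans (FM (a +i* c) _); first exact: modulus_ge0.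
  by apply: frameP; [split; rewrite /= lexx ltW// (lt_trans az, lt_trans cz)|constructor 1].
move: z0S; rewrite in_cons negb_or => /andP[z0s z0S].
have c0 : 0 < modulus (z0 - s) ^+ 2 by rewrite exprn_gt0// modulus_gt0// subr_eq0.
(* An upper bound for [modulus (z - s)] on the frame, by way of [z0]. *)
pose D := b - a + (d - c) + modulus (z0 - s).
have D0 : 0 <= D.
  have := lt_trans az zb; have := lt_trans cz zd; have := modulus_ge0 (z0 - s).
  by rewrite /D => *; lra.
apply: (@power_trick _ _ (modulus (z0 - s) ^+ 2) (D ^+ 2)) => //.
  exact: modulus_ge0.
move=> n; rewrite -!modulusX -modulusM.
apply: (IH (fun w => (w - s) ^+ 2 * F w ^+ n)); [| |exact: z0S|].
- move=> z zR zS; have [->|zs] := eqVneq z s.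
    apply: (@derivable_square_mul (fun w => F w ^+ n)).
    by apply: locally_bounded_exp; apply: Fb; rewrite mem_head.
  apply: (@derivable_mul _ (fun w => (w - s) ^+ 2) (fun w => F w ^+ n)).
    by apply: (@derivable_exp _ (fun w => w - s)); exact: derivable_subc.
  by apply: (@derivable_exp _ F); apply: (Fd _ zR); rewrite in_cons negb_or zs.
- move=> t tS; apply: (@locally_bounded_mul (fun w => (w - s) ^+ 2)).
    apply: (@locally_bounded_exp (fun w => w - s)).
    exact/derivable_locally_bounded/derivable_subc.
  by apply: locally_bounded_exp; apply: Fb; rewrite in_cons tS orbT.
- move=> z zF; rewrite modulusM !modulusX ler_pM ?exprn_ge0 ?modulus_ge0//.
    rewrite lerXn2r ?nnegrE ?modulus_ge0//.
    have -> : z - s = (z - z0) + (z0 - s) by ring.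
    apply: (le_trans (modulusD _ _)); rewrite lerD2r.
    apply: (le_trans (modulus_le _)).
    by have [h1 h2] := in_rect_dist (proj1 zF) z0R; exact: lerD.
  by rewrite lerXn2r ?nnegrE ?modulus_ge0//; exact: FM.
Qed.

End max_modulus_principle.

(** * Local injectivity and openness at a nonzero derivative *)

Section local_theory.
Context {R : realType}.
Local Notation C := (Cx R).

Definition square (z0 : C) (r : R) : set C :=
  in_rect (complex.Re z0 - r) (complex.Re z0 + r)
          (complex.Im z0 - r) (complex.Im z0 + r).

Definition square_frame (z0 : C) (r : R) : set C :=
  frame (complex.Re z0 - r) (complex.Re z0 + r)
        (complex.Im z0 - r) (complex.Im z0 + r).

Lemma square_modulus z0 r z : square z0 r z -> modulus (z - z0) <= 2 * r.
Proof.
move=> [/andP[? ?] /andP[? ?]]; apply: (le_trans (modulus_le _)).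
have -> : 2 * r = r + r by ring.
by apply: lerD; rewrite raddfB ler_norml; apply/andP; split; lra.
Qed.

Lemma modulus_inner_square (z0 : C) (r : R) (z : C) : modulus (z - z0) < r ->
  inner_rect (complex.Re z0 - r) (complex.Re z0 + r)
        (complex.Im z0 - r) (complex.Im z0 + r) z.
Proof.
move=> zr; have := le_lt_trans (modulus_Re _) zr; have := le_lt_trans (modulus_Im _) zr.
rewrite !raddfB !ltr_norml => /andP[? ?] /andP[? ?].
by split; apply/andP; split; lra.
Qed.

Lemma square_frame_modulus z0 r z : square_frame z0 r z -> r <= modulus (z - z0).
Proof. by move=> [_ zF]; rewrite leNgt; apply/negP => /modulus_inner_square. Qed.

Section square_max_modulus.
Variables (S : seq C) (F : C -> C) (z0 : C) (r M : R).
Hypothesis Fd : forall z, square z0 r z -> z \notin S -> derivable F z 1.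
Hypothesis Fb : forall s, s \in S -> locally_bounded F s.
Hypothesis FM : forall z, square_frame z0 r z -> modulus (F z) <= M.

Lemma square_max_modulus z : modulus (z - z0) < r -> z \notin S -> modulus (F z) <= M.
Proof. by move=> /modulus_inner_square zr zS; exact: (max_modulus_removable Fd Fb zr zS FM). Qed.

End square_max_modulus.

Section nonzero_derivative.
Variables (f : C -> C) (z0 : C) (e : R).
Hypothesis e0 : 0 < e.
Hypothesis fd : forall z, modulus (z - z0) < e -> derivable f z 1.
Hypothesis f'0 : 'D_1 f z0 != 0.

Let D : C := 'D_1 f z0.
Let D0 : 0 < modulus D.
Proof. exact: modulus_gt0. Qed.

Let near_linear : exists2 d : R, 0 < d & forall w, modulus (w - z0) < d ->
  modulus (f w - f z0 - D * (w - z0)) <= modulus D / 4 * modulus (w - z0).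
Proof.
have fz0 : derivable f z0 1 by apply: fd; rewrite subrr modulus0.
have /derivableP/derivable_modulusP/(_ (modulus D / 4)) := fz0.
by case; [rewrite divr_gt0|move=> d d0 dP; exists d].
Qed.

Let near_bounds : exists2 d : R, 0 < d <= e & forall w, modulus (w - z0) < d ->
  3 / 4 * modulus D * modulus (w - z0) <= modulus (f w - f z0) <= 2 * modulus D * modulus (w - z0).
Proof.
have [d d0 dP] := near_linear.
exists (Num.min d e); first by rewrite lt_min d0 e0 ge_min lexx orbT.
move=> w; rewrite lt_min => /andP[/dP wd _].
have h1 := modulusD (f w - f z0 - D * (w - z0)) (D * (w - z0)).
have h2 := modulusD (f w - f z0) (- (f w - f z0 - D * (w - z0))).
rewrite subrK in h1; rewrite modulusN in h2.
have E : f w - f z0 - (f w - f z0 - D * (w - z0)) = D * (w - z0) by ring.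
rewrite E modulusM in h2; rewrite modulusM in h1.
have p := mulr_ge0 (ltW D0) (modulus_ge0 (w - z0)).
by apply/andP; split; nra.
Qed.

(** Suppose [f z = f w] with [z], [w], [z0] distinct, and let [F] be the difference of the
    difference quotients of [f] based at [w] and at [z0]. The first one vanishes at [z], so [F z]
    has modulus at least [3 / 4 * modulus D]; on a frame that is large compared to
    [modulus (w - z0)] the two nearly cancel and [F] is at most [modulus D / 4]. At [w] and [z0] the
    function [F] is bounded, so the maximum principle still applies. *)
Lemma locally_injective : exists2 d : R, 0 < d & forall z w,
  modulus (z - z0) < d -> modulus (w - z0) < d -> f z = f w -> z = w.
Proof.
have [d /andP[d0 de] dP] := near_bounds.
have iso w : modulus (w - z0) < d -> f w = f z0 -> w = z0.
  move=> /dP/andP[+ _] fw; rewrite fw subrr modulus0 => h.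
  apply/eqP; rewrite -subr_eq0 -modulus_eq0 eq_le modulus_ge0 andbT.
  by rewrite -(pmulr_rle0 _ (_ : 0 < 3 / 4 * modulus D))// mulr_gt0// divr_gt0.
pose r := d / 4.
have r0 : 0 < r by rewrite divr_gt0.
have sq z : square z0 r z -> modulus (z - z0) < d.
  by move=> /square_modulus h; apply: (le_lt_trans h); rewrite /r; lra.
(* On the frame the numerator of [F] is at most [4 * modulus D * (r / 64) * (2 * r)] and the
   denominator at least [r / 2 * r]; the 64 makes the quotient [modulus D / 4]. *)
exists (r / 64); first by rewrite divr_gt0.
have r64d x : x < r / 64 -> x < d by rewrite /r; lra.
move=> z w zr wr fzw.
have [zE|zz0] := eqVneq z z0.
  by rewrite (iso w) ?zE//; [exact: r64d|rewrite -fzw zE].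
have [wE|wz0] := eqVneq w z0.
  by rewrite wE; apply: iso; [exact: r64d|rewrite fzw wE].
have [//|zw] := eqVneq z w.
pose F x := (f x - f w) / (x - w) - (f x - f z0) / (x - z0).
have fw : derivable f w 1 by apply: fd; apply: (lt_le_trans (r64d _ wr)).
have fz0 : derivable f z0 1 by apply: fd; rewrite subrr modulus0.
have dq x s : derivable f x 1 -> x != s -> derivable (fun y => (f y - f s) / (y - s)) x 1.
  move=> fx xs; apply: (@derivable_mul _ (fun y => f y - f s) (fun y => (y - s)^-1)).
    by apply: (@derivable_sub _ f (fun=> f s)); [exact: fx|exact: derivable_cst].
  by apply: (@derivable_inv _ (fun y => y - s)); [rewrite subr_eq0|exact: derivable_subc].
have FS : modulus (F z) <= modulus D / 4.
  apply: (@square_max_modulus [:: w; z0] F z0 r).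
  - move=> x xs; rewrite !inE negb_or => /andP[xw xz0].
    have fx : derivable f x 1 by apply: fd; apply: (lt_le_trans (sq _ xs)).
    exact: (@derivable_sub _ (fun y => (f y - f w) / (y - w))
      (fun y => (f y - f z0) / (y - z0)) x (dq _ _ fx xw) (dq _ _ fx xz0)).
  - move=> s; rewrite !inE => /orP[] /eqP ->; apply: locally_bounded_sub.
    + exact: difference_quotient_locally_bounded.
    + exact/derivable_locally_bounded/dq.
    + by apply/derivable_locally_bounded/dq => //; rewrite eq_sym.
    + exact: difference_quotient_locally_bounded.
  - move=> x xF; have xr := square_frame_modulus xF.
    have xd := sq _ (proj1 xF); have x2r := square_modulus (proj1 xF).
    have /andP[_ fx] := dP _ xd; have /andP[_ fw2] := dP _ (r64d _ wr).
    have xz0 : x - z0 != 0 by rewrite -modulus_eq0; apply: lt0r_neq0; exact: lt_le_trans xr.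
    have xwr : r / 2 <= modulus (x - w).
      have := modulusD (x - w) (w - z0); rewrite addrA subrK => h.
      by move: wr; lra.
    have xw0 : x - w != 0.
      by rewrite -modulus_eq0; apply: lt0r_neq0; apply: lt_le_trans xwr; rewrite divr_gt0.
    have -> : F x = ((f x - f z0) * (w - z0) - (f w - f z0) * (x - z0)) / ((x - w) * (x - z0)).
      by rewrite /F; field; rewrite xz0 xw0.
    rewrite modulusM modulusV ler_pdivrMr; last first.
      by rewrite modulusM mulr_gt0 ?modulus_gt0.
    rewrite (modulusM (x - w)); apply: (le_trans (modulusD _ _)).
    rewrite modulusN !modulusM.
    have p1 := ler_pM (modulus_ge0 _) (modulus_ge0 (w - z0)) fx (lexx _).
    have p2 := ler_pM (modulus_ge0 _) (modulus_ge0 (x - z0)) fw2 (lexx _).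
    apply: (le_trans (lerD p1 p2)).
    have p3 : r / 2 * r <= modulus (x - w) * modulus (x - z0).
      by apply: ler_pM => //; [rewrite divr_ge0// ltW|exact: ltW].
    have p4 : modulus (w - z0) * modulus (x - z0) <= r / 64 * (2 * r).
      by apply: ler_pM; rewrite ?modulus_ge0// ltW.
    have := ler_wpM2l (ltW D0) p3; have := ler_wpM2l (ltW D0) p4; lra.
  - by apply: (lt_trans zr); lra.
  - by rewrite !inE negb_or zw zz0.
exfalso; have /andP[+ _] := dP _ (r64d _ zr).
have zz0' : 0 < modulus (z - z0) by rewrite modulus_gt0// subr_eq0.
have : modulus (f z - f z0) <= modulus D / 4 * modulus (z - z0).
  move: FS; rewrite /F fzw subrr mul0r sub0r modulusN modulusM modulusV.
  by rewrite ler_pdivrMr// -fzw.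
have := mulr_gt0 D0 zz0'; lra.
Qed.

Lemma locally_open (N : set C) : nbhs z0 N -> nbhs (f z0) (f @` N).
Proof.
move=> /nbhs_modulusP[n n0 nP]; have [d /andP[d0 de] dP] := near_bounds.
pose r := Num.min n d / 4.
have m0 : 0 < Num.min n d by rewrite lt_min n0.
have r0 : 0 < r by rewrite divr_gt0.
have sq z : square z0 r z -> modulus (z - z0) < Num.min n d.
  by move=> /square_modulus h; apply: (le_lt_trans h); rewrite /r; lra.
(* On the frame [f] stays [3 * eta] away from [f z0], hence [2 * eta] away from [p], whereas [f z0]
   is within [eta] of [p]. If [p] were omitted, the inverse of [f - p] would exceed its boundary
   bound at [z0]. *)
pose eta := modulus D * r / 4.
have eta0 : 0 < eta by rewrite divr_gt0// mulr_gt0.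
apply/nbhs_modulusP; exists eta => // p pe.
apply: contrapT => pN.
have fp z : square z0 r z -> f z - p != 0.
  move=> /sq; rewrite lt_min => /andP[zn _]; rewrite subr_eq0; apply/eqP => fzp.
  by apply: pN; exists z => //; exact: nP.
have := @square_max_modulus [::] (fun z => (f z - p)^-1) z0 r (2 * eta)^-1 _ _ _ z0.
rewrite subrr modulus0 => /(_ _ _ _ r0 isT) H.
have : modulus (f z0 - p)^-1 <= (2 * eta)^-1.
  apply: H => //.
  - move=> z zs _; apply: (@derivable_inv _ (fun z => f z - p)); first exact: fp.
    apply: (@derivable_sub _ f (fun=> p)); last exact: derivable_cst.
    by apply: fd; move: (sq _ zs); rewrite lt_min => /andP[_]/lt_le_trans; apply.
  - move=> z zF; rewrite modulusV lef_pV2 ?posrE ?mulr_gt0 ?modulus_gt0//; last first.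
      by apply: fp; exact: proj1 zF.
    have zr := square_frame_modulus zF.
    move: (sq _ (proj1 zF)); rewrite lt_min => /andP[_ /dP/andP[+ _]].
    have := modulusD (f z - p) (p - f z0); rewrite addrA subrK.
    have := ler_wpM2l (ltW D0) zr; rewrite /eta; move: pe; rewrite /eta; lra.
rewrite modulusV modulusB lef_pV2 ?posrE ?mulr_gt0//; first by lra.
rewrite modulusB modulus_gt0//; apply: fp.
by split; apply/andP; split; lra.
Qed.

End nonzero_derivative.

End local_theory.

(** * Accumulating zeros *)

Section isolated_zeros.
Context {R : realType}.
Local Notation C := (Cx R).

Definition root_prod (S : seq C) (z : C) : C := \prod_(s <- S) (z - s).

Lemma root_prod_cons s S z : root_prod (s :: S) z = (z - s) * root_prod S z.
Proof. by rewrite /root_prod big_cons. Qed.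

Lemma root_prod_neq0 S z : z \notin S -> root_prod S z != 0.
Proof.
elim: S => [|s S IH]; first by rewrite /root_prod big_nil oner_neq0.
by rewrite in_cons negb_or root_prod_cons mulf_eq0 subr_eq0 negb_or => /andP[-> /IH].
Qed.

Lemma derivable_root_prod S (z : C) : derivable (root_prod S) z 1.
Proof.
elim: S => [|s S IH].
  rewrite (_ : root_prod [::] = fun=> 1); first exact: derivable_cst.
  by apply/funext => w; rewrite /root_prod big_nil.
rewrite (_ : root_prod (s :: S) = fun w => (w - s) * root_prod S w); last first.
  by apply/funext => w; rewrite root_prod_cons.
apply: (@derivable_mul _ (fun w => w - s) (root_prod S)); last exact: IH.
exact: derivable_subc.
Qed.

Lemma root_prod_le S z (B : R) : 0 <= B -> (forall s, s \in S -> modulus (z - s) <= B) ->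
  modulus (root_prod S z) <= B ^+ size S.
Proof.
move=> B0; elim: S => [|s S IH] H; first by rewrite /root_prod big_nil modulus1.
rewrite root_prod_cons modulusM exprS ler_pM ?modulus_ge0//; first by rewrite H ?mem_head.
by apply: IH => t tS; apply: H; rewrite in_cons tS orbT.
Qed.

Lemma root_prod_ge S z (B : R) : 0 <= B -> (forall s, s \in S -> B <= modulus (z - s)) ->
  B ^+ size S <= modulus (root_prod S z).
Proof.
move=> B0; elim: S => [|s S IH] H; first by rewrite /root_prod big_nil modulus1.
rewrite root_prod_cons modulusM exprS ler_pM ?exprn_ge0//; first by rewrite H ?mem_head.
by apply: IH => t tS; apply: H; rewrite in_cons tS orbT.
Qed.

Lemma seq_away (S : seq C) (z0 : C) : z0 \notin S ->
  exists2 d : R, 0 < d & forall w, modulus (w - z0) < d -> w \notin S.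
Proof.
elim: S => [|s S IH]; first by move=> _; exists 1.
rewrite in_cons negb_or => /andP[z0s /IH[d d0 dP]].
have s0 : 0 < modulus (s - z0) by rewrite modulus_gt0// subr_eq0 eq_sym.
exists (Num.min d (modulus (s - z0))); first by rewrite lt_min d0.
move=> w; rewrite lt_min => /andP[/dP wS ws]; rewrite in_cons negb_or wS andbT.
by apply: contraTneq ws => ->; rewrite ltxx.
Qed.

(* If the zeros accumulate at [z0], divide by the linear factors of [n] of them
   and apply the maximum principle: near [z0], [f] is of size [O((2/7)^n)]. *)
Lemma zeros_cluster (f : C -> C) (z0 : C) (e : R) : 0 < e ->
  (forall z, modulus (z - z0) < e -> derivable f z 1) ->
  (forall d, 0 < d -> exists w, [/\ modulus (w - z0) < d, f w = 0 & w != z0]) ->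
  exists2 d : R, 0 < d & forall w, modulus (w - z0) < d -> f w = 0.
Proof.
move=> e0 fd acc.
have fz0 : derivable f z0 1 by apply: fd; rewrite subrr modulus0.
have [K [d [K0 d0 fK]]] := derivable_locally_bounded fz0.
pose r := Num.min e d / 4.
have m0 : 0 < Num.min e d by rewrite lt_min e0.
have r0 : 0 < r by rewrite divr_gt0.
have sq z : square z0 r z -> modulus (z - z0) < e /\ modulus (z - z0) < d.
  by move=> /square_modulus h; apply/andP; rewrite -lt_min; apply: (le_lt_trans h); rewrite /r; lra.
have r8 : 0 < r / 8 by rewrite divr_gt0.
(* Each new zero is taken so close to [z0] that it differs from all earlier ones. *)
have zeros n : exists S : seq C, [/\ size S = n, uniq S, z0 \notin S &
    forall s, s \in S -> f s = 0 /\ modulus (s - z0) < r / 8].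
  elim: n => [|n [S [Sn Su z0S SP]]]; first by exists [::].
  have [dl dl0 dlP] := seq_away z0S.
  have [|w [wd fw wz0]] := acc (Num.min dl (r / 8)); first by rewrite lt_min dl0.
  move: wd; rewrite lt_min => /andP[/dlP wS wr].
  exists (w :: S); split; rewrite /= ?Sn ?wS// ?in_cons ?negb_or 1?eq_sym ?wz0//.
  by move=> s; rewrite in_cons => /orP[/eqP ->|/SP].
exists (r / 8) => // z zr.
apply/eqP; rewrite -modulus_eq0 eq_le modulus_ge0 andbT.
rewrite leNgt; apply/negP => fz.
(* The chosen zeros lie within [r / 8] of [z0], so a point of the frame is at least [7 / 8 * r] away
   from each of them, and [z] at most [2 / 8 * r]. *)
have main n : modulus (f z) * 7 ^+ n <= K * 2 ^+ n.
  have [S [Sn Su z0S SP]] := zeros n.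
  have zS : z \notin S by apply/negP => /SP[fz0' _]; move: fz; rewrite fz0' modulus0 ltxx.
  have Pz := root_prod_neq0 zS.
  have : modulus (f z * (root_prod S z)^-1) <= K / (7 / 8 * r) ^+ n.
    apply: (@square_max_modulus _ S (fun w => f w * (root_prod S w)^-1) z0 r _ _ _ _ z _ zS).
    - move=> w /sq[we _] wS; apply: (@derivable_mul _ f (fun w => (root_prod S w)^-1)).
        exact: fd.
      apply: (@derivable_inv _ (root_prod S)); first exact: root_prod_neq0.
      exact: derivable_root_prod.
    - move=> s sS; have [fs sr] := SP _ sS.
      have fds : derivable f s 1.
        apply: fd; apply: (lt_trans sr); apply: (@lt_le_trans _ _ (Num.min e d)).
          by rewrite /r; lra.
        by rewrite ge_min lexx.
      (* At a zero [s] the factor [w - s] is absorbed into the difference quotient of [f]; since the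
         zeros are distinct, the other factors do not vanish at [s]. *)
      rewrite (_ : (fun w => _) = fun w => (f w - f s) / (w - s) * (root_prod (rem s S) w)^-1).
        apply: locally_bounded_mul; first exact: difference_quotient_locally_bounded.
        apply: derivable_locally_bounded; apply: (@derivable_inv _ (root_prod _)).
          by apply: root_prod_neq0; rewrite mem_rem_uniqF.
        exact: derivable_root_prod.
      apply/funext => w; rewrite fs subr0 -mulrA -invfM; congr (_ * _^-1).
      rewrite -root_prod_cons /root_prod; apply: perm_big.
      exact: perm_to_rem.
    - move=> w wF; have [_ wd] := sq _ (proj1 wF).
      rewrite modulusM modulusV; apply: ler_pM; rewrite ?modulus_ge0 ?invr_ge0 ?modulus_ge0//.
        exact: fK.
      have r78 : 0 < 7 / 8 * r by rewrite mulr_gt0.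
      have bnd : (7 / 8 * r) ^+ n <= modulus (root_prod S w).
        rewrite -Sn; apply: root_prod_ge; first exact: ltW.
        move=> s /SP[_ sr]; have := square_frame_modulus wF.
        by have := modulusD (w - s) (s - z0); rewrite addrA subrK; lra.
      rewrite lef_pV2 ?posrE ?exprn_gt0//.
      by apply: lt_le_trans bnd; rewrite exprn_gt0.
    - by apply: (lt_trans zr); lra.
  rewrite modulusM modulusV ler_pdivrMr ?modulus_gt0// => h.
  have P2 : modulus (root_prod S z) <= (2 / 8 * r) ^+ n.
    rewrite -Sn; apply: root_prod_le; first by rewrite mulr_ge0// ltW.
    move=> s /SP[_ sr]; have := modulusD (z - z0) (z0 - s); rewrite addrA subrK.
    by rewrite (modulusB z0 s); lra.
  have : modulus (f z) <= K / (7 / 8 * r) ^+ n * (2 / 8 * r) ^+ n.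
    apply: (le_trans h); rewrite ler_wpM2l// divr_ge0// exprn_ge0// mulr_ge0// ltW//.
  rewrite (_ : K / _ * _ = K * 2 ^+ n / 7 ^+ n) ?ler_pdivlMr ?exprn_gt0//.
  have -> : 7 / 8 * r = 7 * (r / 8) by ring.
  have -> : 2 / 8 * r = 2 * (r / 8) by ring.
  rewrite !exprMn; field.
  by rewrite !expf_neq0// gt_eqF.
have : 7 <= 2 :> R by apply: (power_trick fz _ _ main).
lra.
Qed.

End isolated_zeros.

(** * Belyi maps as branched covers *)

Section branched_covers.
Context {R : realType}.
Local Notation C := (Cx R).

(** What path lifting uses of a Belyi map. [branched_isolated] includes the points over cusps, where
    the lifts of the open interval have to converge. *)
Record branched_cover (X : topologicalType) (f : X -> P1 R) : Prop := BranchedCover {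
  branched_compact : compact [set: X];
  branched_hausdorff : hausdorff_space X;
  branched_continuous : continuous f;
  branched_isolated : forall x, \forall x' \near x, f x' = f x -> x' = x;
  branched_injective : forall x, punctured_sphere (f x) -> exists2 U, nbhs x U &
    forall x1 x2, U x1 -> U x2 -> f x1 = f x2 -> x1 = x2;
  branched_open : forall x, punctured_sphere (f x) ->
    forall N, nbhs x N -> nbhs (f x) (f @` N) }.

Section chart.
Variables (X : topologicalType) (c : chart (R := R) X).
Hypothesis cP : chart_axiom c.

Lemma chart_dom_nbhs x : dom c x -> nbhs x (dom c).
Proof. by case: cP => cO _ _ _ _ cx; exact: open_nbhs_nbhs. Qed.

Lemma chart_image_nbhs x : dom c x -> nbhs (coord c x) (coord c @` dom c).
Proof.
case: cP => _ cO _ _ _ cx.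
by apply: (@open_nbhs_nbhs C); split => //; exists x.
Qed.

Lemma chart_param x : dom c x -> param c (coord c x) = x.
Proof. by case: cP => _ _ _ _; exact. Qed.

Lemma chart_inj x y : dom c x -> dom c y -> coord c x = coord c y -> x = y.
Proof. by move=> cx cy xy; rewrite -(chart_param cx) xy chart_param. Qed.

Lemma chart_coord_nbhs x (N : set C) : dom c x -> nbhs (coord c x) N ->
  nbhs x (coord c @^-1` N).
Proof. by case: cP => _ _ cc _ _ cx; exact: cc. Qed.

(** [param] inverts [coord] only on the image of the chart, so every point of the neighbourhood is
    presented as some [coord c y]. *)
Lemma chart_param_nbhs x (N : set X) : dom c x -> nbhs x N ->
  nbhs (coord c x) [set w | exists y, [/\ w = coord c y, param c w = y, dom c y & N y]].
Proof.
move=> cx Nx; have := chart_image_nbhs cx.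
have pc : nbhs (coord c x) (param c @^-1` N).
  by case: cP => _ _ _ + _; apply; [exists x|rewrite chart_param].
apply: (@filterS2 C (nbhs (coord c x))) pc => w Nw [y cy yw]; exists y.
by move: Nw; rewrite -yw /= chart_param.
Qed.

End chart.

Lemma nbhs_Cx_neq (z : C) (N : set C) : nbhs z N -> exists2 w, N w & w != z.
Proof.
move=> /nbhs_modulusP[e e0 eN]; exists (z + (e / 2)%:C); last first.
  by rewrite -subr_eq0 addrAC subrr add0r -modulus_eq0 modulus_real normr_eq0 gt_eqF// divr_gt0.
apply: eN; rewrite addrAC subrr add0r modulus_real ger0_norm ?divr_ge0// ?ltW//.
by rewrite ltr_pdivrMr// ltr_pMr// ltr1n.
Qed.

Section holomorphic_maps.
Variables (X Y : riemannSurface R) (f : X -> Y).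
Hypothesis f_hol : holomorphic_map f.

Section at_point.
Variables (x : X) (c : chart (R := R) X) (d : chart (R := R) Y).
Hypotheses (Ac : atlas c) (Ad : atlas d) (cx : dom c x) (dfx : dom d (f x)).

Let cP : chart_axiom c. Proof. exact: (atlas_chart Ac). Qed.
Let dP : chart_axiom d. Proof. exact: (atlas_chart Ad). Qed.

Let local_dom_nbhs : nbhs x (dom c `&` f @^-1` dom d).
Proof.
apply: filterI; first exact: (chart_dom_nbhs cP).
by case: f_hol => fc _; apply: fc; exact: (chart_dom_nbhs dP).
Qed.

Let exprE y : dom c y -> local_expression f c d (coord c y) = coord d (f y).
Proof. by move=> cy; rewrite /local_expression /= (chart_param cP). Qed.

Lemma local_expression_derivable : exists2 e : R, 0 < e &
  forall w, modulus (w - coord c x) < e -> derivable (local_expression f c d) w 1.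
Proof.
apply/nbhs_modulusP.
have := chart_param_nbhs cP cx local_dom_nbhs.
apply: (@filterS C (nbhs (coord c x))) => w [y [-> _ _ [cy dfy]]].
by case: f_hol => _; apply.
Qed.

Lemma holomorphic_dichotomy :
  (\forall x' \near x, f x' = f x) \/ (\forall x' \near x, f x' = f x -> x' = x).
Proof.
have [e e0 ed] := local_expression_derivable.
pose g w := local_expression f c d w - coord d (f x).
have gd w : modulus (w - coord c x) < e -> derivable g w 1.
  move=> /ed dw; apply: (@derivable_sub _ (local_expression f c d) (fun=> coord d (f x))).
    exact: dw.
  exact: derivable_cst.
have [acc|] := pselect (forall d, 0 < d ->
    exists w, [/\ modulus (w - coord c x) < d, g w = 0 & w != coord c x]).
  left; have [dl dl0 dlP] := zeros_cluster e0 gd acc.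
  have : nbhs (coord c x) [set w | g w = 0] by apply/nbhs_modulusP; exists dl.
  move=> /(chart_coord_nbhs cP cx).
  apply: filterS2 local_dom_nbhs => y [cy dfy]; rewrite /= /g exprE//.
  by move/eqP; rewrite subr_eq0 => /eqP /(chart_inj dP dfy dfx).
move=> /existsNP[dl /not_implyP[dl0 acc]]; right.
have : nbhs (coord c x) [set w | modulus (w - coord c x) < dl].
  by apply/nbhs_modulusP; exists dl.
move=> /(chart_coord_nbhs cP cx).
apply: filterS2 local_dom_nbhs => y [cy dfy] /= yd fyx.
apply: contrapT => yx; apply: acc; exists (coord c y); split => //.
  by rewrite /g exprE// fyx subrr.
by apply/eqP => /(chart_inj cP cy cx).
Qed.

Hypothesis unram : ~ ramified_at f x.

Let deriv_neq0 : 'D_1 (local_expression f c d) (coord c x) != 0.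
Proof. by apply/eqP => D0; apply: unram; exists c, d. Qed.

Lemma unramified_injective : exists2 U, nbhs x U &
  forall x1 x2, U x1 -> U x2 -> f x1 = f x2 -> x1 = x2.
Proof.
have [e e0 ed] := local_expression_derivable.
have [dl dl0 inj] := locally_injective e0 ed deriv_neq0.
have : nbhs (coord c x) [set w | modulus (w - coord c x) < dl].
  by apply/nbhs_modulusP; exists dl.
move=> /(chart_coord_nbhs cP cx) Nx.
exists ((dom c `&` f @^-1` dom d) `&` (coord c @^-1` [set w | modulus (w - coord c x) < dl])).
  exact: filterI.
move=> x1 x2 [[c1 d1] n1] [[c2 d2] n2] f12; apply: (chart_inj cP c1 c2).
by apply: inj => //; rewrite !exprE// f12.
Qed.

Lemma unramified_open N : nbhs x N -> nbhs (f x) (f @` N).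
Proof.
move=> Nx; have [e e0 ed] := local_expression_derivable.
have NIx : nbhs x ((dom c `&` f @^-1` dom d) `&` N) by exact: filterI.
have Mx := chart_param_nbhs cP cx NIx.
have := locally_open e0 ed deriv_neq0 Mx.
rewrite exprE// => /(chart_coord_nbhs dP dfx).
apply: filterS2 (chart_dom_nbhs dP dfx) => y dy [w [y' [wE py' _ [[cy' dfy'] Ny']]]].
rewrite wE exprE// => /(chart_inj dP dfy' dy) <-.
by exists y'.
Qed.

End at_point.

Lemma no_isolated_point (x : X) N : nbhs x N -> exists2 y, N y & y <> x.
Proof.
have [c Ac cx] := atlas_cover x; have cP := atlas_chart Ac.
move=> Nx; have [w [y [-> _ cy Ny] yx]] := nbhs_Cx_neq (chart_param_nbhs cP cx Nx).
by exists y => // yE; move: yx; rewrite yE eqxx.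
Qed.

(** The identity theorem. If [f] were constant near [x], the open set [W] of points near which it is
    constantly [f x] would also be closed, hence contain [x0], near which [f] is injective; but no
    point is isolated. *)
Lemma holomorphic_isolated_fibers (x0 : X) : ~ ramified_at f x0 ->
  forall x, \forall x' \near x, f x' = f x -> x' = x.
Proof.
move=> x0u x.
have [c Ac cx] := atlas_cover x; have [d Ad dfx] := atlas_cover (f x).
have [xconst|//] := holomorphic_dichotomy Ac Ad cx dfx; exfalso.
pose W : set X := [set y | \forall y' \near y, f y' = f x].
have Wf y : W y -> f y = f x by move=> /nbhs_singleton.
have WT : W = setT.
  apply: (@surface_connected R X W).
  - by exists x.
  - exists W; last by rewrite setTI.
    by rewrite openE => y /near_join.
  - exists W; last by rewrite setTI.
    move=> y Wy.
    have fy : f y = f x.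
      have : closed [set y | f y = f x].
        have [fc _] := f_hol; apply: (@preimage_closed _ _ f [set f x]); first by move=> t _; exact: fc.
        apply: accessible_closed_set1; apply: hausdorff_accessible.
        exact: surface_hausdorff.
      apply; apply: closure_subset Wy; exact: Wf.
    have [c' Ac' cy] := atlas_cover y; have [d' Ad' dfy] := atlas_cover (f y).
    have [yc|yi] := holomorphic_dichotomy Ac' Ad' cy dfy; first by rewrite /W /= -fy.
    (* If [y] is alone in its fibre nearby, a point of [W] near [y] can only be [y] itself. *)
    have [w [Ww /=]] := Wy _ yi; rewrite fy => /(_ (Wf _ Ww)) wy.
    by rewrite -wy.
have x0W : W x0 by rewrite WT.
have [c' Ac' cx0] := atlas_cover x0; have [d' Ad' dfx0] := atlas_cover (f x0).
have [U Ux0 Uinj] := unramified_injective Ac' Ad' cx0 dfx0 x0u.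
have WUx : nbhs x0 ([set y | f y = f x] `&` U) by exact: filterI.
have [y [/= fy Uy] yx0] := no_isolated_point WUx.
by apply: yx0; apply: Uinj => //; [exact: nbhs_singleton|rewrite fy Wf].
Qed.

End holomorphic_maps.

(** The point [x0] is unramified, which excludes constant maps and so gives isolated fibres. *)
Lemma belyi_branched_cover (X : riemannSurface R) (f : X -> P1 R) (x0 : X) :
  belyi f -> punctured_sphere (f x0) -> branched_cover f.
Proof.
move=> [Xc [fh _] fb] fx0.
have unram x : punctured_sphere (f x) -> ~ ramified_at f x.
  by move=> fx xr; apply: fx; apply: fb; exists x.
split => //.
- exact: surface_hausdorff.
- by case: fh.
- exact: (holomorphic_isolated_fibers fh (unram _ fx0)).
- move=> x /unram xu; have [c Ac cx] := atlas_cover x.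
  have [d Ad dfx] := atlas_cover (f x).
  exact: (unramified_injective fh Ac Ad cx dfx xu).
- move=> x /unram xu; have [c Ac cx] := atlas_cover x.
  have [d Ad dfx] := atlas_cover (f x).
  exact: (unramified_open fh Ac Ad cx dfx xu).
Qed.

(** As [b] maps cusps to cusps, a point that [b \o g] does not send to a cusp is not sent to one by
    [g] either, so local injectivity and openness are available for both maps. *)
Lemma branched_cover_comp (X : topologicalType) (g : X -> P1 R) (b : P1 R -> P1 R) :
  b @` cusps R `<=` cusps R -> branched_cover g -> branched_cover b ->
  branched_cover (b \o g).
Proof.
move=> bcusps gB bB.
have lift y : punctured_sphere (b y) -> punctured_sphere y.
  by move=> by' yc; apply: by'; apply: bcusps; exists y.
split.
- exact: branched_compact gB.
- exact: branched_hausdorff gB.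
- move=> x; apply: continuous_comp; first exact: (branched_continuous gB).
  exact: (branched_continuous bB).
- move=> x; have := branched_isolated gB x.
  have := branched_continuous gB (branched_isolated bB (g x)).
  by apply: (@filterS2 _ (nbhs x)) => x' /= h1 h2 /h1 /h2.
- move=> x /= xb.
  have [U Ux Ui] := branched_injective bB xb.
  have [V Vx Vi] := branched_injective gB (lift _ xb).
  exists (V `&` g @^-1` U); first by apply: filterI => //; exact: (branched_continuous gB).
  by move=> x1 x2 [V1 U1] [V2 U2] /(Ui _ _ U1 U2) /(Vi _ _ V1 V2).
- move=> x /= xb N Nx; rewrite -[(_ \o _) @` N](image_comp g b N).
  by apply: (branched_open bB) => //; exact: (branched_open gB (lift _ xb)).
Qed.

End branched_covers.

(** * Lifting of paths and homotopies *)

Section topology_lemmas.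
Context {R : realType}.

Lemma hausdorff_separate (T : topologicalType) (x y : T) : hausdorff_space T -> x <> y ->
  exists U V, [/\ nbhs x U, nbhs y V & forall z, U z -> V z -> False].
Proof.
move=> hT xy; apply: contrapT => H; apply: xy; apply: hT => U V Ux Vy.
apply: contrapT => UV; apply: H; exists U, V; split => // z Uz Vz.
by apply: UV; exists z.
Qed.

Lemma continuous_at_near_eq (S T : topologicalType) (g h : S -> T) (s : S) :
  {for s, continuous h} -> (\forall s' \near s, g s' = h s') -> {for s, continuous g}.
Proof.
move=> hc gh N; rewrite (nbhs_singleton gh) => /hc; apply: filterS2 gh => s' E.
by rewrite /= E.
Qed.

Lemma continuous_at_comp (S T U : topologicalType) (g : S -> T) (h : T -> U) (s : S) :
  {for s, continuous g} -> {for g s, continuous h} -> {for s, continuous (h \o g)}.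
Proof. exact: continuous_comp. Qed.

(** Connectedness as a transfer principle: as the implication is asked between any two points of
    [W], both [E] and its complement are open in [J]. *)
Lemma connected_locally_constant (T : topologicalType) (J E : set T) (t0 : T) :
  connected J ->
  (forall t, J t -> exists2 W, nbhs t W & forall t1 t2, W t1 -> W t2 ->
     J t1 -> J t2 -> E t1 -> E t2) ->
  J t0 -> E t0 -> forall t, J t -> E t.
Proof.
move=> Jc JE J0 E0 t Jt.
suff JEE : J `&` E = J by move: Jt; rewrite -JEE => -[].
apply: Jc; first by exists t0.
- exists [set t | \forall t' \near t, J t' -> E t'].
    by rewrite openE => s /near_join.
  apply/seteqP; split => s [Js].
    move=> Es; split => //; have [W Ws WE] := JE _ Js.
    by apply: filterS (Ws) => s' Ws' Js'; apply: (WE s s') => //; exact: nbhs_singleton.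
  by move=> /nbhs_singleton; split => //; auto.
- exists (~` [set t | \forall t' \near t, J t' -> ~ E t']).
    by apply: open_closedC; rewrite openE => s /near_join.
  apply/seteqP; split => s [Js].
    by move=> Es; split => // /nbhs_singleton; apply.
  move=> nE; split => //; apply: contrapT => Es; apply: nE.
  have [W Ws WE] := JE _ Js; apply: filterS (Ws) => s' Ws' Js' Es'.
  by apply: Es; apply: (WE s' s) => //; exact: nbhs_singleton.
Qed.

Lemma interval_ball (t : R) (W : set R) : nbhs t W ->
  exists B : set R, [/\ open B, is_interval B, B t & B `<=` W].
Proof.
move=> /(@nbhs_ballP R R)[e /= e0 eW]; exists (ball t e); split => //.
- exact: ball_open.
- rewrite ball_itv; exact: interval_is_interval.
- exact: ballxx.
Qed.

Lemma is_intervalI (A B : set R) : is_interval A -> is_interval B -> is_interval (A `&` B).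
Proof. by move=> iA iB x y [Ax Bx] [Ay By] z xyz; split; [exact: iA xyz|exact: iB xyz]. Qed.

Lemma is_intervalU (A B : set R) t : A t -> B t -> is_interval A -> is_interval B ->
  is_interval (A `|` B).
Proof.
move=> At Bt iA iB x y Hx Hy z /andP[xz zy].
have H (D : set R) : is_interval D -> D t -> (D x /\ z <= t) \/ (D y /\ t <= z) -> D z.
  move=> iD Dt [[Dx zt]|[Dy tz]]; first by apply: (iD _ _ Dx Dt); rewrite xz.
  by apply: (iD _ _ Dt Dy); rewrite tz.
have [zt|/ltW tz] := leP z t.
  by case: Hx => Hx; [left|right]; apply: H => //; left.
by case: Hy => Hy; [left|right]; apply: H => //; right.
Qed.

Lemma punctured_sphere_open : open (punctured_sphere : set (P1 R)).
Proof.
apply: closed_openC.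
have cl (x : P1 R) : closed [set x].
  apply: accessible_closed_set1; apply: hausdorff_accessible; exact: P1_hausdorff.
by apply: closedU; [apply: closedU|]; exact: cl.
Qed.

Lemma punctured_sphere_nbhs (y : P1 R) : punctured_sphere y -> nbhs y punctured_sphere.
Proof. by move=> yA; apply: open_nbhs_nbhs; split => //; exact: punctured_sphere_open. Qed.

End topology_lemmas.

Section covering_theory.
Context {R : realType}.
Variables (X : topologicalType) (f : X -> P1 R).
Hypothesis bc : branched_cover f.

(** Near a point over [y] the map is injective and open, near any other point its values stay away
    from [y]; compactness of [X] gives one [V] that suits all points. A continuous section through
    each point over [V] is all that lifting uses, so no decomposition into disjoint sheets is
    made. *)
Lemma even_cover (y : P1 R) : punctured_sphere y -> exists V : set (P1 R),
  [/\ open V, V y, V `<=` punctured_sphere & forall x', V (f x') ->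
    exists s : P1 R -> X, [/\ forall v, V v -> {for v, continuous s},
      forall v, V v -> f (s v) = v & s (f x') = x']].
Proof.
move=> Ay.
pose P (V : set (P1 R)) x' := V (f x') -> exists U, [/\ open U, U x',
  forall x1 x2, U x1 -> U x2 -> f x1 = f x2 -> x1 = x2 & V `<=` f @` U].
have PS (V W : set (P1 R)) x' : V `<=` W -> P W x' -> P V x'.
  move=> VW PW Vx; have [U [oU Ux Ui WU]] := PW (VW _ Vx).
  by exists U; split => //; exact: subset_trans WU.
have /compact_near_coveringP := branched_compact bc.
move=> /(_ _ (powerset_filter_from (nbhs y)) P _)[].
  move=> x _; have [fxy|fxy] := pselect (f x = y).
    have Afx : punctured_sphere (f x) by rewrite fxy.
    have [U Ux Ui] := branched_injective bc Afx.
    have fU : nbhs y (f @` interior U).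
      by rewrite -fxy; apply: (branched_open bc) => //; exact: nbhs_interior.
    exists (interior U, [set V | V `<=` f @` interior U]).
      by split => /=; [exact: nbhs_interior|exact: small_set_sub].
    move=> [x' V] /= [x'U VU] _; exists (interior U); split => //.
      exact: open_interior.
    by move=> x1 x2 /interior_subset U1 /interior_subset U2; exact: Ui.
  have [U [V [Ux Vy UV]]] := hausdorff_separate (@P1_hausdorff R) fxy.
  exists (f @^-1` U, [set W | W `<=` V]).
    by split => /=; [exact: (branched_continuous bc)|exact: small_set_sub].
  by move=> [x' W] /= [x'U WV] Wx; exfalso; apply: (UV (f x')) => //; exact: WV.
move=> M [MF Ms [V MV]] MP.
have Vy : nbhs y V by exact: MF.
have {MP}VP x' : P V x' by exact: MP.
have VAy : nbhs y (V `&` punctured_sphere).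
  by apply: filterI => //; exact: punctured_sphere_nbhs.
exists (interior (V `&` punctured_sphere)); split.
- exact: open_interior.
- exact: nbhs_singleton (nbhs_interior VAy).
- by move=> v /interior_subset[].
move=> x' Vx'.
have [U [oU Ux Ui VU]] := VP x' (proj1 (interior_subset Vx')).
pose s v := xget x' [set u | U u /\ f u = v].
have sP v : V v -> U (s v) /\ f (s v) = v.
  move=> /VU[u Uu fu]; rewrite /s; case: xgetP => [? -> []//|/(_ u)]; last first.
    by case; split.
have sV v : interior (V `&` punctured_sphere) v -> U (s v) /\ f (s v) = v.
  by move=> /interior_subset[/sP].
exists s; split.
- move=> v vV N Ns; have [Us fs] := sV _ vV.
  have As : punctured_sphere (f (s v)) by rewrite fs; have [] := interior_subset vV.
  have : nbhs v (f @` (U `&` N)).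
    rewrite -{1}fs; apply: (branched_open bc) => //; apply: filterI => //.
    exact: open_nbhs_nbhs.
  apply: filterS2 (open_nbhs_nbhs (conj (open_interior _) vV)) => v' v'V [u [Uu Nu] fu].
  have [Us' fs'] := sV _ v'V.
  by rewrite /= (Ui (s v') u) // fs'.
- by move=> v /sV[].
- by have [Us fs] := sV _ Vx'; apply: Ui.
Qed.

(** Agreement persists nearby by local injectivity of [f], disagreement because [X] is Hausdorff. *)
Lemma lift_unique (J : set R) (p : R -> P1 R) (q1 q2 : R -> X) (t0 : R) :
  is_interval J -> (forall t, J t -> punctured_sphere (p t)) ->
  (forall t, J t -> {for t, continuous q1} /\ f (q1 t) = p t) ->
  (forall t, J t -> {for t, continuous q2} /\ f (q2 t) = p t) ->
  J t0 -> q1 t0 = q2 t0 -> forall t, J t -> q1 t = q2 t.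
Proof.
move=> Ji pA q1P q2P Jt0 q12 t Jt.
apply: (@connected_locally_constant _ J [set t | q1 t = q2 t] t0) => //.
  exact/connected_intervalP.
move=> s Js; have [c1 f1] := q1P _ Js; have [c2 f2] := q2P _ Js.
have [E|E] := pselect (q1 s = q2 s).
  have As : punctured_sphere (f (q1 s)) by rewrite f1; exact: pA.
  have [U Us Ui] := branched_injective bc As.
  exists (q1 @^-1` U `&` q2 @^-1` U).
    by apply: filterI; [exact: c1|apply: c2; rewrite -E].
  move=> t1 t2 _ [U1 U2] _ Jt2 _ /=; apply: Ui => //.
  by rewrite (q1P _ Jt2).2 (q2P _ Jt2).2.
have [U [V [Us Vs UV]]] := hausdorff_separate (branched_hausdorff bc) E.
exists (q1 @^-1` U `&` q2 @^-1` V).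
  by apply: filterI; [exact: c1|exact: c2].
move=> t1 t2 [U1 V1] _ _ _ /= E1; exfalso; apply: (UV (q1 t1)) => //.
by rewrite E1.
Qed.

Section path_lifting.
Variables (J : set R) (p : R -> P1 R) (t0 : R) (x : X).
Hypotheses (Jo : open J) (Ji : is_interval J).
Hypothesis pP : forall t, J t -> {for t, continuous p} /\ punctured_sphere (p t).
Hypotheses (Jt0 : J t0) (fx : f x = p t0).

Let partial_lift (O : set R) (q : R -> X) :=
  [/\ open O, is_interval O, O `<=` J, O t0 &
    q t0 = x /\ forall t, O t -> {for t, continuous q} /\ f (q t) = p t].

Let partial_lift_at t : J t -> exists O q, partial_lift O q /\ O t.
Proof.
move: t; apply: (@connected_locally_constant _ J
  [set t | exists O q, partial_lift O q /\ O t] t0) => //; first exact/connected_intervalP.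
  move=> t Jt; have [pc pA] := pP Jt.
  have [V [oV Vt VA VS]] := even_cover pA.
  have : nbhs t (J `&` p @^-1` V).
    by apply: filterI; [exact: open_nbhs_nbhs|apply: pc; exact: open_nbhs_nbhs].
  move=> /interval_ball[W [oW iW Wt WJV]].
  exists W; first exact: open_nbhs_nbhs.
  move=> t1 t2 Wt1 Wt2 Jt1 Jt2 [ O [q [[oO iO OJ Ot0 [q0 qP]] Ot1]]].
  have [_ fq1] := qP _ Ot1; have [_ Vt1] := WJV _ Wt1.
  have [|s [sc fs sq]] := VS (q t1); first by rewrite fq1.
  have spP u : W u -> {for u, continuous (s \o p)} /\ f (s (p u)) = p u.
    move=> /WJV[Ju Vu]; split; last exact: fs.
    by apply: continuous_at_comp; [exact: (pP Ju).1|exact: sc].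
  have agree u : O u -> W u -> q u = s (p u).
    move=> Ou Wu; apply: (@lift_unique (O `&` W) p q (s \o p) t1) => //.
    - exact: is_intervalI.
    - by move=> v [/OJ/pP[]].
    - by move=> v [/qP].
    - by move=> v [_ /spP].
    - by rewrite /= -fq1.
  (* On [W] the lift is continued by the section along [p]; on the overlap, an interval, the two
     agree by uniqueness. *)
  pose q' u := if `[< W u >] then s (p u) else q u.
  have q'W u : W u -> q' u = s (p u) by move=> Wu; rewrite /q' asboolT.
  have q'O u : O u -> q' u = q u.
    by move=> Ou; rewrite /q'; case: asboolP => // /(agree _ Ou) ->.
  exists (O `|` W), q'; split; last by right.
  split.
  - exact: openU.
  - exact: is_intervalU Ot1 Wt1 _ _.
  - by move=> u [/OJ//|/WJV[]].
  - by left.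
  split; first by rewrite q'O.
  move=> u [Ou|Wu].
    have [qc fq] := qP _ Ou; rewrite q'O//; split => //.
    apply: (continuous_at_near_eq qc).
    by apply: filterS (open_nbhs_nbhs (conj oO Ou)) => v /q'O.
  have [qc fq] := spP _ Wu; rewrite q'W//; split => //.
  apply: (continuous_at_near_eq qc).
  by apply: filterS (open_nbhs_nbhs (conj oW Wu)) => v /q'W.
have [pc pA] := pP Jt0; have [V [oV Vt VA VS]] := even_cover pA.
have : nbhs t0 (J `&` p @^-1` V).
  by apply: filterI; [exact: open_nbhs_nbhs|apply: pc; exact: open_nbhs_nbhs].
move=> /interval_ball[W [oW iW Wt WJV]].
have [|s [sc fs sq]] := VS x; first by rewrite fx.
exists W, (s \o p); split => //; split => //; first by move=> u /WJV[].
split; first by rewrite /= -fx.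
move=> u /WJV[Ju Vu]; split; last exact: fs.
by apply: continuous_at_comp; [exact: (pP Ju).1|exact: sc].
Qed.

(** Each [t] uses its own partial lift, picked by choice. Any two of them take the value [x] at [t0]
    and agree on the intersection of their intervals, so near [t] the result is the partial lift of
    [t]. *)
Lemma path_lifting : exists q : R -> X, q t0 = x /\
  forall t, J t -> {for t, continuous q} /\ f (q t) = p t.
Proof.
have /choice[g gP] : forall t, exists Oq : set R * (R -> X),
    J t -> partial_lift Oq.1 Oq.2 /\ Oq.1 t.
  move=> t; have [/partial_lift_at[ O [q H]]|nJ] := pselect (J t).
    by exists (O, q).
  by exists (setT, fun=> x) => /nJ.
have gE t u : J t -> J u -> (g t).1 u -> (g u).2 u = (g t).2 u.
  move=> Jt Ju tu.
  have [[op1 i1 J1 O1 [q1 H1]] Ot] := gP _ Jt; have [[op2 i2 J2 O2 [q2 H2]] Ou] := gP _ Ju.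
  apply: (@lift_unique ((g u).1 `&` (g t).1) p (g u).2 (g t).2 t0) => //.
  - exact: is_intervalI.
  - by move=> v [/J2/pP[]].
  - by move=> v [/H2].
  - by move=> v [_ /H1].
  - by rewrite q1 q2.
exists (fun t => (g t).2 t); split.
  by have [[_ _ _ _ []]] := gP _ Jt0.
move=> t Jt; have [[op1 i1 J1 O1 [q1 H1]] Ot] := gP _ Jt.
have [c1 f1] := H1 _ Ot; split => //.
apply: (continuous_at_near_eq c1).
by apply: filterS (open_nbhs_nbhs (conj op1 Ot)) => u Ou; apply: gE => //; exact: J1.
Qed.

End path_lifting.

(** Continuity in [s] is carried along [t]. Near [(s0, t)] the homotopy stays in an evenly covered
    set; once the lifts for [s] near [s0] agree at [t1] with a section composed with [K], uniqueness
    of lifts makes them agree at [t2]. *)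
Lemma homotopy_lifting (T : topologicalType) (K : T -> R -> P1 R) (q : T -> R -> X) (s0 : T) :
  (forall s t, {for (s, t), continuous (fun u : T * R => K u.1 u.2)}) ->
  (forall s t, punctured_sphere (K s t)) ->
  (forall s t, {for t, continuous (q s)} /\ f (q s t) = K s t) ->
  {for s0, continuous (q^~ 0)} -> forall t, {for s0, continuous (q^~ t)}.
Proof.
move=> Kc KA qP q0 t.
apply: (@connected_locally_constant _ [set: R] [set t | {for s0, continuous (q^~ t)}] 0) => //.
  by apply/connected_intervalP.
move=> {}t _; have [V [oV Vt VA VS]] := even_cover (KA s0 t).
have : nbhs (s0, t) ((fun u : T * R => K u.1 u.2) @^-1` V).
  by apply: Kc; exact: open_nbhs_nbhs.
move=> [[S W0] /= [Ss0 W0t] SW].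
have [W [oW iW Wt WW0]] := interval_ball W0t.
exists W; first exact: open_nbhs_nbhs.
have SWV s u : S s -> W u -> V (K s u) by move=> Ss /WW0 Wu; apply: (SW (s, u)).
have Kcs u s : {for s, continuous (K^~ u)}.
  apply: (@continuous_comp _ _ _ (fun s => (s, u)) (fun u : T * R => K u.1 u.2)); last exact: Kc.
  by apply: (@cvg_pair _ _ _ (nbhs s) (nbhs _) (nbhs _)); [exact: cvg_id|exact: cvg_cst].
have Kct s u : {for u, continuous (K s)}.
  apply: (@continuous_comp _ _ _ (fun u => (s, u)) (fun u : T * R => K u.1 u.2)); last exact: Kc.
  by apply: (@cvg_pair _ _ _ (nbhs u) (nbhs _) (nbhs _)); [exact: cvg_cst|exact: cvg_id].
have s0S := nbhs_singleton Ss0.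
move=> t1 t2 Wt1 Wt2 _ _ /= qc.
have f1 : f (q s0 t1) = K s0 t1 by exact: (qP _ _).2.
have [|s [sc fs sq]] := VS (q s0 t1); first by rewrite f1; exact: SWV.
have Aq : punctured_sphere (f (q s0 t1)) by rewrite f1.
have [U Uq Ui] := branched_injective bc Aq.
have sKc : {for s0, continuous (fun r => s (K r t1))}.
  apply: (@continuous_at_comp _ _ _ (K^~ t1) s); first exact: Kcs.
  by apply: sc; exact: SWV.
have eq1 : \forall r \near s0, q r t1 = s (K r t1).
  have Us : nbhs (s (K s0 t1)) U by rewrite -f1 sq.
  have := sKc _ Us; have := qc _ Uq; apply: filterS3 Ss0 => r Sr U1 U2.
  by apply: Ui => //; rewrite (qP _ _).2 fs//; exact: SWV.
have eq2 : \forall r \near s0, q r t2 = s (K r t2).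
  apply: filterS2 Ss0 eq1 => r Sr E1.
  apply: (@lift_unique W (K r) (q r) (s \o K r) t1) => //.
  move=> u Wu; split; last by apply: fs; exact: SWV.
  by apply: continuous_at_comp; [exact: Kct|apply: sc; exact: SWV].
apply: (continuous_at_near_eq _ eq2).
apply: (@continuous_at_comp _ _ _ (K^~ t2) s); first exact: Kcs.
by apply: sc; exact: SWV.
Qed.

(** The endpoints move continuously inside one fibre, and fibres are discrete. *)
Lemma homotopy_endpoint (T : topologicalType) (K : T -> R -> P1 R) (q : T -> R -> X) (t : R) :
  connected [set: T] ->
  (forall s t, {for (s, t), continuous (fun u : T * R => K u.1 u.2)}) ->
  (forall s t, punctured_sphere (K s t)) ->
  (forall s t, {for t, continuous (q s)} /\ f (q s t) = K s t) ->
  continuous (q^~ 0) -> (forall s s', K s t = K s' t) ->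
  forall s s', q s t = q s' t.
Proof.
move=> cT Kc KA qP q0 Kt s s'.
apply: (@connected_locally_constant T setT [set r | q r t = q s' t] s') => //.
move=> r _; exists [set r' | q r' t = q r t].
  have := @homotopy_lifting T K q r Kc KA qP (q0 r) t _ (branched_isolated bc (q r t)).
  by apply: (@filterS _ (nbhs r)) => r' /=; apply; rewrite !(qP _ _).2.
by move=> r1 r2 /= -> ->.
Qed.

(** The limit [y] may be a cusp. Compactness gives a cluster point [x] of [q], which lies over [y]
    and has small neighbourhoods whose closure contains no other point over [y]. The image of the
    boundary of such a neighbourhood is closed and misses [y], so [p] eventually avoids it, and a
    connected piece of [q] that meets the neighbourhood stays inside. *)
Lemma lift_limit (J : set R) (F : set_system R) (p : R -> P1 R) (q : R -> X) (y : P1 R) :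
  ProperFilter F -> (forall S, F S -> exists S', [/\ F S', connected S' & S' `<=` S `&` J]) ->
  (forall t, J t -> {for t, continuous q} /\ f (q t) = p t) -> p @ F --> y ->
  exists x : X, q @ F --> x.
Proof.
move=> FF FJ qP py.
have JF : F J.
  by have [S [FS _ SJ]] := FJ _ filterT; apply: filterS FS => t /SJ[].
have [x [_ xF]] := branched_compact bc (fmap_proper_filter q FF) filterT.
have fxy : f x = y.
  apply: contrapT => /(hausdorff_separate (@P1_hausdorff R))[U [V [Ux Vy UV]]].
  have pV : F (p @^-1` V) by exact: py.
  have FV : F (q @^-1` (f @^-1` V)).
    by apply: filterS2 pV JF => t Vt Jt; rewrite /= (qP _ Jt).2.
  have [z [Vz Uz]] := xF _ _ FV (branched_continuous bc Ux).
  exact: UV Uz Vz.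
exists x => N Nx.
have [M Mx MN] : exists2 M, nbhs x M & closure M `<=` N `&` [set x' | f x' = f x -> x' = x].
  have := compact_regular (branched_hausdorff bc) (branched_compact bc) (@filterT _ (nbhs x) _).
  by apply; apply: filterI => //; exact: (branched_isolated bc).
pose O := interior M.
pose K := closure O `\` O.
have Ox : O x by exact: nbhs_singleton (nbhs_interior Mx).
have Kcl : closed K by apply: closedI; [exact: closed_closure|exact: open_closedC (open_interior _)].
have fK : closed (f @` K).
  apply: compact_closed; first exact: P1_hausdorff.
  apply: continuous_compact; last exact: subclosed_compact Kcl (branched_compact bc) _.
  by apply: continuous_subspaceT; exact: (branched_continuous bc).
have fKy : ~ (f @` K) y.
  move=> [k [ck nOk] fk]; apply: nOk.
  have [_ /(_ _)] := MN k (closure_subset (@interior_subset _ M) ck).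
  by rewrite fk fxy => ->.
have FK : F (p @^-1` (~` (f @` K))).
  by apply: py; apply: open_nbhs_nbhs; split => //; exact: closed_openC.
have [S [FS Sc SP]] := FJ _ FK.
have : F (q @^-1` O).
  have [z [[t St <-] Oz]] : (q @` S) `&` O !=set0.
    apply: xF; last exact: nbhs_interior.
    apply: (@filterS _ F _ S (q @^-1` (q @` S))); last exact: FS.
    exact: preimage_image.
  apply: filterS FS => u Su; move: u Su.
  apply: (@connected_locally_constant _ S (q @^-1` O) t) => // u Su.
  have [pu Ju] := SP _ Su; have [qc fq] := qP _ Ju.
  have [Oq|nOq] := pselect (O (q u)).
    exists (q @^-1` O) => //.
    by apply: qc; apply: open_nbhs_nbhs; split => //; exact: open_interior.
  have ncl : ~ closure O (q u).
    by move=> cOq; apply: pu; exists (q u).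
  exists (q @^-1` (~` closure O)).
    apply: qc; apply: open_nbhs_nbhs; split => //.
    by apply: closed_openC; exact: closed_closure.
  by move=> t1 t2 /= n1 _ _ _ O1; exfalso; apply: n1; exact: subset_closure.
apply: (@filterS _ F) => u Ou; have [] := MN (q u) => //.
by apply: subset_closure; exact: interior_subset.
Qed.

End covering_theory.

(** * Lifts of paths on the unit interval *)

Section unit_interval.
Context {R : realType}.
Local Notation I01 := (I01 R).

Lemma I01_itv (t : I01) : 0 <= val t <= 1.
Proof. by case: t => u /= /set_mem; rewrite /= in_itv. Qed.

Lemma val_clamp (u : R) : 0 <= u <= 1 -> val (clamp u) = u.
Proof. by move=> /andP[u0 u1] /=; rewrite max_l// min_l. Qed.

Lemma clamp_val (t : I01) : clamp (val t) = t.
Proof. by apply: val_inj; rewrite val_clamp// I01_itv. Qed.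

Lemma val_I0 : val (I0 : I01) = 0.
Proof. by rewrite val_clamp// lexx ler01. Qed.

Lemma val_I1 : val (I1 : I01) = 1.
Proof. by rewrite val_clamp// lexx ler01. Qed.

Lemma val_Ihalf : val (Ihalf : I01) = 2^-1.
Proof. by rewrite val_clamp// invr_ge0 ler0n invf_le1// ler1n. Qed.

Lemma val_continuous : continuous (val : I01 -> R).
Proof. exact: initial_continuous. Qed.

Lemma clamp_continuous : continuous (clamp : R -> I01).
Proof.
apply: continuous_comp_initial => u /=.
have E : (fun u : R => val (clamp u : I01)) = clamp_itv 0 1.
  apply/funext => v; rewrite /clamp_itv /=.
  have [v0|v0] := leP v 0.
    by rewrite !min_l ?(le_trans v0)//; apply/esym/max_idPl.
  have [v1|v1] := leP v 1; first by apply/esym/max_idPr; exact: ltW.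
  by apply/esym/max_idPr.
have : continuous (fun u : R => val (clamp u : I01)) by rewrite E; exact: clamp_itv_continuous.
exact.
Qed.

Lemma path_clamp_continuous (T : topologicalType) (p : I01 -> T) : continuous p ->
  continuous (p \o clamp).
Proof. by move=> pc u; apply: continuous_comp; [exact: clamp_continuous|exact: pc]. Qed.

End unit_interval.

Section lifts.
Context {R : realType}.
Variables (X : topologicalType) (f : X -> P1 R).
Hypothesis bc : branched_cover f.
Local Notation I01 := (I01 R).
Local Notation A := (@punctured_sphere R).

Lemma is_lift_unique (p : I01 -> P1 R) (q1 q2 : I01 -> X) t0 : (forall t, A (p t)) ->
  is_lift f p q1 -> is_lift f p q2 -> q1 t0 = q2 t0 -> q1 = q2.
Proof.
move=> pA [c1 f1] [c2 f2] E; apply/funext => t.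
rewrite -(clamp_val t).
apply: (@lift_unique _ _ _ bc setT (p \o clamp) (q1 \o clamp) (q2 \o clamp) (val t0)) => //.
- by move=> u _; exact: pA.
- by move=> u _; split; [exact: path_clamp_continuous|rewrite -f1].
- by move=> u _; split; [exact: path_clamp_continuous|rewrite -f2].
- by rewrite /= clamp_val.
Qed.

Lemma lift_exists (p : I01 -> P1 R) x : path_in A p -> f x = p I0 ->
  exists q, is_lift f p q /\ q I0 = x.
Proof.
move=> [pc pA] fx.
have pP t : [set: R] t -> {for t, continuous (p \o clamp)} /\ A ((p \o clamp) t).
  by split; [exact: path_clamp_continuous|exact: pA].
have Ti : is_interval [set: R] by [].
have [q [q0 qP]] := path_lifting bc openT Ti pP I fx.
exists (q \o val); split; last exact: etrans (congr1 q val_I0) q0.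
split.
  move=> t; apply: continuous_comp; first exact: val_continuous.
  exact: (qP _ _).1.
by apply/funext => t /=; rewrite (qP _ _).2//= clamp_val.
Qed.

Lemma homotopic_lift (p p' : I01 -> P1 R) (q q' : I01 -> X) : homotopic A p p' ->
  is_lift f p q -> is_lift f p' q' -> q I0 = q' I0 -> q I1 = q' I1.
Proof.
move=> [H [Hc HA H01 Hends]] ql ql' q0.
have Hp s : path_in A (fun t => H (s, t)).
  split; last by move=> t; exact: HA.
  move=> t; apply: (@continuous_comp _ _ _ (fun t => (s, t)) H); last exact: Hc.
  by apply: (@cvg_pair _ _ _ (nbhs t) (nbhs _) (nbhs _)); [exact: cvg_cst|exact: cvg_id].
have fq0 : f (q I0) = p I0 by case: ql => _ <-.
have /choice[Q QP] : forall s, exists r, is_lift f (fun t => H (s, t)) r /\ r I0 = q I0.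
  by move=> s; apply: lift_exists => //; rewrite fq0 (Hends s).1.
have := @homotopy_endpoint _ _ _ bc R (fun s t => H (clamp s, clamp t))
  (fun s t => Q (clamp s) (clamp t)) 1.
move=> /(_ _ _ _ _ _ _ 0 1) QE.
have E0 : q = Q I0.
  apply: (@is_lift_unique p _ _ I0) => //; last by rewrite (QP I0).2.
    by move=> t; rewrite -(H01 t).1.
  by have [+ _] := QP I0; under eq_fun do rewrite (H01 _).1.
have E1 : q' = Q I1.
  apply: (@is_lift_unique p' _ _ I0) => //; last by rewrite (QP I1).2.
    by move=> t; rewrite -(H01 t).2.
  by have [+ _] := QP I1; under eq_fun do rewrite (H01 _).2.
rewrite E0 E1; apply: QE.
- by apply/connected_intervalP.
- move=> s t; apply: (@continuous_comp _ _ _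
    (fun u : R * R => (clamp u.1 : I01, clamp u.2 : I01)) H); last exact: Hc.
  apply: (@cvg_pair _ _ _ (nbhs (s, t)) (nbhs _) (nbhs _)).
    apply: (@continuous_comp _ _ _ fst (clamp : R -> I01)); last exact: clamp_continuous.
    exact: cvg_fst.
  apply: (@continuous_comp _ _ _ snd (clamp : R -> I01)); last exact: clamp_continuous.
  exact: cvg_snd.
- by move=> s t; exact: HA.
- move=> s t; have [[Qc Qf] _] := QP (clamp s).
  split; first exact: path_clamp_continuous.
  by have /(congr1 (fun g => g (clamp t))) := Qf.
- have -> : (fun s => Q (clamp s) (clamp 0)) = fun=> q I0.
    by apply/funext => s; have [_] := QP (clamp s).
  by move=> s; exact: cvg_cst.
- by move=> s s'; rewrite -/I1 !(Hends _).2.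
Qed.

(** Stands in for simple connectedness of [D]: pulling [f \o u] straight to [c] is a homotopy whose
    lifts all end at one point. The segments from the two ends of [f \o u] coincide, and their
    lifts, agreeing at the end, agree at the start. *)
Lemma star_injective (D : set (P1 R)) (c : Cx R) (u : I01 -> X) : D `<=` A ->
  (forall z t, 0 <= t <= 1 -> D (Some z) ->
     D (Some ((1 - t)%:C * z + t%:C * c))) ->
  path_in (f @^-1` D) u -> f (u I0) = f (u I1) -> u I0 = u I1.
Proof.
move=> DA Dstar [uc uD] f01.
pose w (s : R) : Cx R := odflt 0 (f (u (clamp s))).
have wE s : f (u (clamp s)) = Some (w s).
  rewrite /w; have := DA _ (uD (clamp s)); case: (f _) => // nA.
  by exfalso; apply: nA; right.
have wc : continuous w.
  move=> s; apply: (@continuous_comp _ _ _ (fun s => f (u (clamp s))) (odflt 0 : P1 R -> Cx R)).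
    apply: (@continuous_comp _ _ _ (fun s => u (clamp s)) f).
      exact: path_clamp_continuous.
    exact: (branched_continuous bc).
  have [_ _ cc _ _] := @P1_affine_chart_axiom R.
  by apply: (cc (f (u (clamp s)))); rewrite /= wE.
pose tau (t : R) : R := val (clamp t : I01).
have tau01 t : 0 <= tau t <= 1 by exact: I01_itv.
have tauc : continuous tau.
  by move=> t; apply: (@continuous_comp _ _ _ (clamp : R -> I01) val);
     [exact: clamp_continuous|exact: val_continuous].
pose K (s t : R) : P1 R := Some ((1 - tau t)%:C * w s + (tau t)%:C * c).
have KD s t : D (K s t) by apply: Dstar => //; rewrite -wE; exact: uD.
have Kc s t : {for (s, t), continuous (fun v : R * R => K v.1 v.2)}.
  suff lin : {for (s, t), continuous (fun v : R * R =>
      (1 - tau v.2)%:C * w v.1 + (tau v.2)%:C * c : Cx R)}.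
    exact: (@continuous_at_comp _ _ (P1_space R) _ (Some : Cx R -> P1_space R) _ lin
      (@P1_Some_continuous R _)).
  have c2 (g : R -> R) : continuous g ->
      {for (s, t), continuous (fun v : R * R => (g v.2)%:C : Cx R)}.
    move=> gc; apply: (@Complex_comp_continuous _ _ (fun v : R * R => g v.2) (fun=> 0)).
      apply: (@continuous_comp _ _ _ snd g); last exact: gc.
      exact: cvg_snd.
    exact: cvg_cst.
  have c1 : {for (s, t), continuous (fun v : R * R => w v.1)}.
    apply: (@continuous_comp _ _ _ fst w); last exact: wc.
    exact: cvg_fst.
  have t1 : continuous (fun t => 1 - tau t).
    by move=> r; apply: (@continuousB R R); [exact: cst_continuous|exact: tauc].
  have m1 := @continuousM (Cx R) _ _ _ _ (c2 _ t1) c1.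
  have m2 := @continuousM (Cx R) _ _ _ _ (c2 _ tauc) (@cst_continuous _ _ c (s, t)).
  exact: (@continuousD (Cx R) (Cx R) _ _ _ _ m1 m2).
have K0 s : K s 0 = f (u (clamp s)).
  by rewrite wE /K /tau val_I0 subr0 mul1r mul0r addr0.
have K1 s : K s 1 = Some c.
  by rewrite /K /tau val_I1 subrr mul1r mul0r add0r.
have Kct s t : {for t, continuous (K s)}.
  apply: (@continuous_comp _ _ _ (fun t => (s, t)) (fun v : R * R => K v.1 v.2)); last exact: Kc.
  by apply: (@cvg_pair _ _ _ (nbhs t) (nbhs _) (nbhs _)); [exact: cvg_cst|exact: cvg_id].
have Ti : is_interval [set: R] by [].
have /choice[Q QP] : forall s, exists q : R -> X, q 0 = u (clamp s) /\
    forall t, [set: R] t -> {for t, continuous q} /\ f (q t) = K s t.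
  move=> s; have pP t : [set: R] t -> {for t, continuous (K s)} /\ A (K s t).
    by split; [exact: Kct|exact/DA/KD].
  exact: (path_lifting bc openT Ti pP I (esym (K0 s))).
have QE : Q 0 1 = Q 1 1.
  apply: (@homotopy_endpoint _ _ _ bc R K Q 1) => //.
  - by apply/connected_intervalP.
  - by move=> s t; exact/DA/KD.
  - by move=> s t; exact: (QP s).2.
  - rewrite (_ : Q^~ 0 = u \o clamp); first exact: path_clamp_continuous.
    by apply/funext => s; exact: (QP s).1.
  - by move=> s s'; rewrite !K1.
have K01 t : K 0 t = K 1 t.
  by congr (Some (_ * _ + _)); apply: Some_inj; rewrite -!wE.
rewrite -[u I0](QP 0).1 -[u I1](QP 1).1.
apply: (@lift_unique _ _ _ bc setT (K 0) (Q 0) (Q 1) 1) => //.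
- by move=> t _; exact/DA/KD.
- by move=> t _; exact: (QP 0).2.
- by move=> t _; rewrite K01; exact: (QP 1).2.
Qed.

End lifts.

(** * Edges *)

Section path_operations.
Context {R : realType}.
Local Notation I01 := (I01 R).

Lemma rev_path_I0 (T : Type) (p : I01 -> T) : rev_path p I0 = p I1.
Proof. by rewrite /rev_path val_I0 subr0. Qed.

Lemma rev_path_I1 (T : Type) (p : I01 -> T) : rev_path p I1 = p I0.
Proof. by rewrite /rev_path val_I1 subrr. Qed.

Lemma cat_path_I0 (T : Type) (p q : I01 -> T) : cat_path p q I0 = p I0.
Proof. by rewrite /cat_path val_I0 invr_ge0 ler0n mulr0. Qed.

Lemma cat_path_I1 (T : Type) (p q : I01 -> T) : cat_path p q I1 = q I1.
Proof.
rewrite /cat_path val_I1 ifF; last by apply/negbTE; rewrite -ltNge invf_lt1// ltr1n.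
by congr q; congr clamp; ring.
Qed.

Lemma affine_clamp_continuous (T : topologicalType) (p : I01 -> T) (a b : R) : continuous p ->
  continuous (fun u : R => p (clamp (a * u + b))).
Proof.
move=> pc u; apply: (@continuous_comp _ _ _ (fun u : R => a * u + b) (p \o clamp)).
  apply: (@continuousD R R); last exact: cst_continuous.
  by apply: (@continuousM R); [exact: cst_continuous|exact: cvg_id].
exact: path_clamp_continuous.
Qed.

Lemma rev_path_continuous (T : topologicalType) (p : I01 -> T) : continuous p ->
  continuous (rev_path p).
Proof.
move=> pc; have c : continuous (fun u : R => p (clamp (1 - u))).
  have := @affine_clamp_continuous T p (-1) 1 pc.
  by under eq_fun do rewrite mulN1r addrC; exact.
exact: (fun t => continuous_at_comp (@val_continuous R t) (c _)).
Qed.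

Lemma continuous_glue (T : topologicalType) (g h : R -> T) (c : R) :
  (forall u, u <= c -> {for u, continuous g}) -> (forall u, c <= u -> {for u, continuous h}) ->
  g c = h c -> continuous (fun u => if u <= c then g u else h u).
Proof.
move=> gc hc E u.
have [uc|cu|->] := ltrgtP u c.
- apply: (continuous_at_near_eq (gc u (ltW uc))).
  by apply: filterS (lt_nbhsl uc) => v /ltW ->.
- apply: (continuous_at_near_eq (hc u (ltW cu))).
  by apply: filterS (lt_nbhsr cu) => v /lt_geF ->.
move=> N; rewrite lexx => Nc.
have := gc c (lexx c) _ Nc; rewrite E in Nc; have := hc c (lexx c) _ Nc.
by apply: (@filterS2 _ (nbhs c)) => v Nh Ng /=; case: ifP.
Qed.

Lemma cat_path_continuous (T : topologicalType) (p q : I01 -> T) :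
  continuous p -> continuous q -> p I1 = q I0 -> continuous (cat_path p q).
Proof.
move=> pc qc pq.
have c : continuous (fun u : R =>
    if u <= 2^-1 then p (clamp (2 * u)) else q (clamp (2 * u - 1))).
  apply: continuous_glue.
  - by move=> u _; have := @affine_clamp_continuous T p 2 0 pc; under eq_fun do rewrite addr0; exact.
  - by move=> u _; exact: affine_clamp_continuous.
  - by rewrite divff// subrr.
exact: (fun t => continuous_at_comp (@val_continuous R t) (c _)).
Qed.

Lemma path_in_rev (T : topologicalType) (D : set T) (p : I01 -> T) :
  path_in D p -> path_in D (rev_path p).
Proof. by move=> [pc pD]; split; [exact: rev_path_continuous|move=> t; exact: pD]. Qed.

Lemma path_in_cat (T : topologicalType) (D : set T) (p q : I01 -> T) : path_in D p -> path_in D q ->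
  p I1 = q I0 -> path_in D (cat_path p q).
Proof.
move=> [pc pD] [qc qD] pq; split; first exact: cat_path_continuous.
by move=> t; rewrite /cat_path; case: ifP.
Qed.

Lemma is_lift_rev (X Y : topologicalType) (f : X -> Y) (p : I01 -> Y) q : is_lift f p q ->
  is_lift f (rev_path p) (rev_path q).
Proof.
move=> [qc <-]; split; first exact: rev_path_continuous.
by [].
Qed.

Lemma is_lift_cat (X Y : topologicalType) (f : X -> Y) (p p' : I01 -> Y) q q' :
  is_lift f p q -> is_lift f p' q' -> q I1 = q' I0 ->
  is_lift f (cat_path p p') (cat_path q q').
Proof.
move=> [qc <-] [qc' <-] E; split; first exact: cat_path_continuous.
by apply/funext => t; rewrite /cat_path /=; case: ifP.
Qed.

Lemma is_lift_path_in (X Y : topologicalType) (f : X -> Y) (D : set Y) (p : I01 -> Y) q :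
  is_lift f p q -> path_in D p -> path_in (f @^-1` D) q.
Proof. by move=> [qc <-] [_ pD]; split. Qed.

Lemma path_component_ext (T : topologicalType) (D : set T) x (u : I01 -> T) :
  path_component R D x (u I0) -> path_in D u -> path_component R D x (u I1).
Proof.
move=> [p [pD p0 p1]] uD; exists (cat_path p u); split.
- exact: path_in_cat.
- by rewrite cat_path_I0.
- by rewrite cat_path_I1.
Qed.

Lemma path_component_joined (T : topologicalType) (D : set T) x y z :
  path_component R D x y -> path_component R D x z ->
  exists u : I01 -> T, [/\ path_in D u, u I0 = y & u I1 = z].
Proof.
move=> [p [pD p0 p1]] [q [qD q0 q1]]; exists (cat_path (rev_path p) q); split.
- by apply: path_in_cat => //; [exact: path_in_rev|rewrite rev_path_I1 p0].
- by rewrite cat_path_I0 rev_path_I0.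
- by rewrite cat_path_I1.
Qed.

Lemma path_component_sub (T : topologicalType) (D : set T) x : path_component R D x `<=` D.
Proof. by move=> _ [p [[_ pD] _ <-]]. Qed.

Lemma path_component_refl (T : topologicalType) (D : set T) x : D x -> path_component R D x x.
Proof. by move=> Dx; exists (fun=> x); split => //; split => //; exact: cst_continuous. Qed.

End path_operations.

Section edges.
Context {R : realType}.
Variables (X : riemannSurface R) (f : X -> P1 R).
Hypothesis bc : branched_cover f.
Local Notation I01 := (I01 R).
Local Notation A := (@punctured_sphere R).

Lemma closed_unit_interval (W : set R) (u : R) : closed W -> `]0, 1[%classic `<=` W ->
  0 <= u <= 1 -> W u.
Proof.
move=> cW oW /andP[u0 u1]; apply: cW => N /(@nbhs_ballP R R)[e /= e0 eN].
pose d := Num.min e 1 / 2.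
have [d0 de d1] : [/\ 0 < d, d < e & d < 1].
  have m0 : 0 < Num.min e 1 by rewrite lt_min e0 ltr01.
  have [m1 m2] : Num.min e 1 <= e /\ Num.min e 1 <= 1 by rewrite !ge_min !lexx orbT.
  by rewrite /d; split; lra.
have H v : `|u - v| < e -> 0 < v < 1 -> W `&` N !=set0.
  by move=> uv v01; exists v; split; [apply: oW; rewrite /= in_itv|exact: eN].
have [uz|uz] := leP u 0.
  have u00 : u = 0 by apply/eqP; rewrite eq_le u0 uz.
  by apply: (H d); rewrite ?d0// u00 sub0r normrN gtr0_norm.
have [uo|uo] := leP 1 u.
  have u11 : u = 1 by apply/eqP; rewrite eq_le u1 uo.
  apply: (H (1 - d)); first by rewrite u11 opprB addrC subrK gtr0_norm.
  by apply/andP; split; lra.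
by apply: (H u); rewrite ?subrr ?normr0// uz.
Qed.

Lemma real_point_inj : injective (@real_point R).
Proof. by move=> x y []. Qed.

Lemma real_point_continuous : continuous (@real_point R).
Proof.
move=> x; apply: (@continuous_at_comp _ _ (P1_space R) (fun x : R => x%:C : Cx R)
  (Some : Cx R -> P1_space R)); last exact: P1_Some_continuous.
by apply: Complex_comp_continuous; [exact: cvg_id|exact: cvg_cst].
Qed.

Lemma real_point_punctured (x : R) : 0 < x < 1 -> A (real_point x).
Proof.
by move=> /andP[x0 x1] [[/real_point_inj|/real_point_inj]|//] xE;
  move: x0 x1; rewrite xE ltxx.
Qed.

Lemma half_itv : 0 < (2^-1 : R) < 1.
Proof. by rewrite invr_gt0 ltr0n invf_lt1// ltr1n. Qed.

Lemma edge_value_half (e : edge f) t : f (e t) = real_point 2^-1 -> t = Ihalf.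
Proof.
rewrite edge_section => /real_point_inj tE.
by apply: val_inj; rewrite val_Ihalf.
Qed.

Lemma edge_half (e : edge f) : f (e Ihalf) = real_point 2^-1.
Proof. by rewrite edge_section val_Ihalf. Qed.

(** Uniqueness of lifts holds over the open interval; the two endpoints lie over cusps and are
    recovered by continuity. *)
Lemma edge_inj (e e' : edge f) : e Ihalf = e' Ihalf -> e = e'.
Proof.
move=> E; suff : edge_fun e = edge_fun e'.
  case: e e' {E} => [g gc gs] [g' gc' gs'] /= E; subst g'.
  by congr Edge; exact: Prop_irrelevance.
apply/funext => t; rewrite -(clamp_val t).
have c1 := path_clamp_continuous (edge_continuous (e := e)).
have c2 := path_clamp_continuous (edge_continuous (e := e')).
pose W : set R := [set u | e (clamp u) = e' (clamp u)].
have oW : `]0, 1[%classic `<=` W.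
  move=> u u01; have /andP[h0 h1] := half_itv.
  apply: (@lift_unique _ _ _ bc `]0, 1[%classic (fun u => real_point u)
    (e \o clamp) (e' \o clamp) 2^-1) => //.
  - exact: interval_is_interval.
  - by move=> v; rewrite /= in_itv; exact: real_point_punctured.
  - move=> v; rewrite /= in_itv => /andP[/ltW v0 /ltW v1]; split; first exact: c1.
    by rewrite edge_section val_clamp// v0.
  - move=> v; rewrite /= in_itv => /andP[/ltW v0 /ltW v1]; split; first exact: c2.
    by rewrite edge_section val_clamp// v0.
  - by rewrite /= in_itv /= h0.
have cW : closed W.
  rewrite -[W]setCK; apply: open_closedC; rewrite openE => u /= ne.
  have [U [V [Uu Vu UV]]] := hausdorff_separate (branched_hausdorff bc) ne.
  have := c1 u _ Uu; have := c2 u _ Vu.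
  by apply: (@filterS2 _ (nbhs u)) => v Vv Uv Ev; apply: (UV _ Uv); rewrite /= Ev.
exact: (closed_unit_interval cW oW (I01_itv t)).
Qed.

Let J : set R := `]0, 1[%classic.

Lemma edge_through x : f x = real_point 2^-1 -> exists e : edge f, e Ihalf = x.
Proof.
move=> fx.
have Jo : open J by exact: interval_open.
have Ji : is_interval J by exact: interval_is_interval.
have Jh : J 2^-1 by rewrite /J /= in_itv /= half_itv.
have pP t : J t -> {for t, continuous (@real_point R)} /\ A (real_point t).
  by rewrite /J /= in_itv /= => t01; split; [exact: real_point_continuous|exact: real_point_punctured].
have [q [q0 qP]] := path_lifting bc Jo Ji pP Jh fx.
have sub (F : set_system R) (a : R) : ProperFilter F -> F --> a ->
    (forall S, F S -> exists S', [/\ F S', connected S' & S' `<=` S `&` J]) ->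
    exists y : X, q @ F --> y.
  move=> FF Fa FJ; apply: (lift_limit bc FF FJ qP (y := real_point a)).
  by move=> N Na; apply: Fa; exact: (@real_point_continuous a _ Na).
have [x0 qx0] : exists y : X, q @ (0 : R)^'+ --> y.
  apply: (sub _ 0); first exact: cvg_within.
  move=> S; rewrite /at_right /within /= => /(@nbhs_ballP R R)[e /= e0 eS].
  exists `]0, Num.min e 1[%classic; split.
  - have m0 : 0 < Num.min e 1 by rewrite lt_min e0 ltr01.
    by apply: filterS2 (nbhs_right_gt 0) (nbhs_right_lt m0) => v v0 v1; rewrite /= in_itv /= v0.
  - by apply/connected_intervalP; exact: interval_is_interval.
  - move=> t /=; rewrite in_itv /= lt_min => /andP[t0 /andP[te t1]]; split.
      by apply: eS => //; rewrite /ball /= sub0r normrN gtr0_norm.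
    by rewrite /J /= in_itv /= t0.
have [x1 qx1] : exists y : X, q @ (1 : R)^'- --> y.
  apply: (sub _ 1); first exact: cvg_within.
  move=> S; rewrite /at_left /within /= => /(@nbhs_ballP R R)[e /= e0 eS].
  exists `]Num.max (1 - e) 0, 1[%classic; split.
  - have m1 : Num.max (1 - e) 0 < 1 by rewrite gt_max ltr01 ltrBlDr ltrDl e0.
    by apply: filterS2 (nbhs_left_gt m1) (nbhs_left_lt 1) => v v0 v1; rewrite /= in_itv /= v0.
  - by apply/connected_intervalP; exact: interval_is_interval.
  - move=> t /=; rewrite in_itv /= gt_max => /andP[/andP[te t0] t1]; split.
      by apply: eS => //; rewrite /ball /= gtr0_norm ?subr_gt0// ltrBlDr -ltrBlDl.
    by rewrite /J /= in_itv /= t0.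
(* The lift is extended by its two limits, constantly beyond 0 and 1, so that continuity can be
   checked on the whole real line. *)
pose g u := if u <= 0 then x0 else if u < 1 then q u else x1.
have gJ u : J u -> g u = q u.
  by rewrite /J /= in_itv /= => /andP[u0 u1]; rewrite /g leNgt u0 /= u1.
have gc : continuous g.
  move=> u; have [u0|u0|->] := ltgtP u 0.
  - apply: (continuous_at_near_eq (@cst_continuous _ _ x0 u)).
    by apply: filterS (lt_nbhsl u0) => v /ltW v0; rewrite /g v0.
  - have [u1|u1|->] := ltgtP u 1.
    + have Ju : J u by rewrite /J /= in_itv /= u0.
      apply: (continuous_at_near_eq (qP u Ju).1).
      by apply: filterS (open_nbhs_nbhs (conj Jo Ju)) => v; exact: gJ.
    + apply: (continuous_at_near_eq (@cst_continuous _ _ x1 u)).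
      apply: filterS (lt_nbhsr u1) => v v1.
      by rewrite /g leNgt (lt_trans ltr01 v1) /= ltNge (ltW v1).
    + move=> N; rewrite {1}/g leNgt ltr01 ltxx /= => Nx1.
      have := qx1 _ Nx1; rewrite /= /at_left /within /= => qN.
      apply: filterS2 (lt_nbhsr (@ltr01 R)) qN => v v0 qN /=.
      by rewrite /g leNgt v0 /=; case: ifPn => [/qN//|_]; exact: nbhs_singleton.
  - move=> N; rewrite {1}/g lexx => Nx0.
    have := qx0 _ Nx0; rewrite /= /at_right /within /= => qN.
    apply: filterS2 (lt_nbhsl (@ltr01 R)) qN => v v1 qN /=.
    by rewrite /g v1; case: leP => [_|/qN//]; exact: nbhs_singleton.
have fg u : 0 <= u <= 1 -> f (g u) = real_point u.
  have fgc : continuous (f \o g).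
    by move=> v; apply: continuous_comp; [exact: gc|exact: (branched_continuous bc)].
  pose W : set R := [set u | f (g u) = real_point u].
  have JW : J `<=` W by move=> v Jv; rewrite /W /= gJ// (qP v Jv).2.
  have cW : closed W.
    rewrite -[W]setCK; apply: open_closedC; rewrite openE => v /= ne.
    have [U [V [Uu Vu UV]]] := hausdorff_separate (@P1_hausdorff R) ne.
    have := fgc v _ Uu; have := @real_point_continuous v _ Vu.
    by apply: (@filterS2 _ (nbhs v)) => w Vw Uw Ew; apply: (UV _ Uw); rewrite /= Ew.
  exact: (closed_unit_interval cW JW).
unshelve eexists (@Edge _ _ f (g \o val) _ _).
- by move=> t; apply: continuous_comp; [exact: val_continuous|exact: gc].
- by move=> t; apply: fg; exact: I01_itv.
exact: etrans (congr1 g val_Ihalf) (etrans (gJ _ Jh) q0).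
Qed.

End edges.

(** * Sheets *)

Section paths_to_half.
Context {R : realType}.
Local Notation C := (Cx R).
Local Notation I01 := (I01 R).
Local Notation A := (@punctured_sphere R).

Definition punctured_upper_half_plane : set (P1 R) :=
  closed_upper_half_plane `\` cusps R.
Local Notation H := punctured_upper_half_plane.

Lemma punctured_sphereP (a b : R) : A (Some (a +i* b)) <-> b <> 0 \/ (a <> 0 /\ a <> 1).
Proof.
split.
  move=> nc; apply: contrapT => /not_orP[/contrapT b0] /not_andP[/contrapT a0|/contrapT a1].
    by apply: nc; left; left; rewrite a0 b0.
  by apply: nc; left; right; rewrite a1 b0.
by move=> H [[[a0 b0]|[a1 b0]]|//]; case: H => // -[].
Qed.

Lemma slit_sphereP (a b : R) : slit_sphere (Some (a +i* b)) <-> b <> 0 \/ 0 < a < 1.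
Proof.
split.
  move=> nc; apply: contrapT => /not_orP[/contrapT b0 /negP]; rewrite negb_and -!leNgt b0 in nc *.
  by move=> /orP[a0|a1]; apply: nc; [left; right; exists a|right; right; exists a].
move=> H [[//|[x [aE b0] x0]]|[//|[x [aE b0] x0]]]; case: H => // /andP[x1 x2]; subst a.
  by have := lt_le_trans x1 x0; rewrite ltxx.
by have := le_lt_trans x0 x2; rewrite ltxx.
Qed.

Lemma slit_sphere_punctured : slit_sphere `<=` A.
Proof.
move=> [[a b]|]; last by move=> h _; apply: h; left; left.
move=> /slit_sphereP h; apply/punctured_sphereP; case: h => [|/andP[a0 a1]]; first by left.
by right; split => aE; [move: a0|move: a1]; rewrite aE ltxx.
Qed.

Lemma upper_punctured : H `<=` A. Proof. by move=> p []. Qed.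

Lemma upperP (a b : R) : H (Some (a +i* b)) <-> 0 <= b /\ A (Some (a +i* b)).
Proof. by []. Qed.

Lemma slit_sphere_star (z : C) (t : R) : 0 <= t <= 1 -> slit_sphere (Some z) ->
  slit_sphere (Some ((1 - t)%:C * z + t%:C * (2^-1)%:C : C)).
Proof.
case: z => a b /andP[t0 t1] /slit_sphereP zP.
have -> : (1 - t)%:C * (a +i* b) + t%:C * (2^-1)%:C
    = ((1 - t) * a + t * 2^-1) +i* ((1 - t) * b) :> C.
  by apply/eqP; rewrite eq_complex /=; apply/andP; split; apply/eqP; ring.
apply/slit_sphereP; case: zP => [b0|/andP[a0 a1]].
  have [->|t1'] := eqVneq t 1; first by right; apply/andP; split; lra.
  left; apply/eqP; rewrite mulf_neq0//; last exact/eqP.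
  by rewrite subr_eq0 eq_sym.
by right; apply/andP; split; nra.
Qed.

Lemma upper_star_half (z : C) (t : R) : 0 <= t <= 1 -> slit_sphere (Some z) -> H (Some z) ->
  H (Some ((1 - t)%:C * z + t%:C * (2^-1)%:C : C)).
Proof.
move=> t01 zS zH; split; last by apply: slit_sphere_punctured; exact: slit_sphere_star.
case: zH zS => + _ _; case: z => a b /= b0; move: t01 => /andP[t0 t1].
by rewrite !mul0r !mulr0 !addr0 mulr_ge0// subr_ge0.
Qed.

(** The centre is [i] because a real segment towards 1/2 may run through a cusp, whereas a segment
    towards [i] leaves the real line at once. *)
Lemma upper_star_i (z : C) (t : R) : 0 <= t <= 1 -> H (Some z) ->
  H (Some ((1 - t)%:C * z + t%:C * (0 +i* 1) : C)).
Proof.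
case: z => a b /andP[t0 t1] zH; have [b0 zA] := (upperP a b).1 zH.
have -> : (1 - t)%:C * (a +i* b) + t%:C * (0 +i* 1) = ((1 - t) * a) +i* ((1 - t) * b + t) :> C.
  by apply/eqP; rewrite eq_complex /=; apply/andP; split; apply/eqP; ring.
have [->|tz] := eqVneq t 0; first by rewrite !subr0 !mul1r addr0.
have bt : 0 < (1 - t) * b + t.
  by rewrite ltr_wpDl// ?mulr_ge0 ?subr_ge0// lt_neqAle eq_sym tz.
by split; [exact: ltW|apply/punctured_sphereP; left => bE; rewrite bE ltxx in bt].
Qed.

Lemma segment_to_half_continuous (z : C) : continuous (segment_to_half z).
Proof.
move=> t; suff lin : {for t, continuous (fun t : I01 => (1 - val t)%:C * z + (val t / 2)%:C : C)}.
  exact: (@continuous_at_comp _ _ (P1_space R) _ (Some : C -> P1_space R) _ lin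
    (@P1_Some_continuous R _)).
have rc (g : R -> R) : continuous g -> {for t, continuous (fun t : I01 => (g (val t))%:C : C)}.
  move=> gc; apply: (@Complex_comp_continuous _ _ (fun t : I01 => g (val t)) (fun=> 0)).
    exact: (continuous_at_comp (@val_continuous R t) (gc _)).
  exact: cst_continuous.
have t1 : continuous (fun t : R => 1 - t).
  by move=> r; apply: (@continuousB R R); [exact: cst_continuous|exact: cvg_id].
have t2 : continuous (fun t : R => t / 2).
  have idc : continuous (fun t : R => t) by move=> ?; exact: cvg_id.
  by move=> r; exact: (@continuousM R R _ _ r (idc r) (@cst_continuous _ _ (2^-1 : R) r)).
have m1 := @continuousM C _ _ _ _ (rc _ t1) (@cst_continuous _ _ z t).
exact: (@continuousD C C _ _ _ _ m1 (rc _ t2)).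
Qed.

Lemma segment_to_halfE (z : C) (t : I01) :
  segment_to_half z t = Some ((1 - val t)%:C * z + (val t)%:C * (2^-1)%:C : C).
Proof. by rewrite /segment_to_half rmorphM. Qed.

Lemma segment_in_slit (z : C) : slit_sphere (Some z) -> path_in slit_sphere (segment_to_half z).
Proof.
move=> zS; split; first exact: segment_to_half_continuous.
by move=> t; rewrite segment_to_halfE; apply: slit_sphere_star => //; exact: I01_itv.
Qed.

Lemma segment_in_upper (z : C) : slit_sphere (Some z) -> H (Some z) ->
  path_in H (segment_to_half z).
Proof.
move=> zS zH; split; first exact: segment_to_half_continuous.
by move=> t; rewrite segment_to_halfE; apply: upper_star_half => //; exact: I01_itv.
Qed.

Lemma segment_to_half_I0 (z : C) : segment_to_half z I0 = Some z.
Proof. by rewrite /segment_to_half val_I0 subr0 mul1r mul0r addr0. Qed.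

Lemma segment_to_half_I1 (z : C) : segment_to_half z I1 = real_point 2^-1.
Proof. by rewrite /segment_to_half val_I1 subrr mul0r add0r mul1r. Qed.

Lemma upper_arc_in_upper (x : R) : x < 0 \/ 1 < x -> path_in H (upper_arc x).
Proof.
move=> xP; split.
  move=> t; rewrite /upper_arc.
  set c := (x + 2^-1) / 2; set r := (x - 2^-1) / 2.
  suff lin : {for t, continuous (fun t : I01 =>
      (c + r * cos (pi * val t)) +i* (`|r| * sin (pi * val t)) : C)}.
    exact: (@continuous_at_comp _ _ (P1_space R) _ (Some : C -> P1_space R) _ lin
      (@P1_Some_continuous R _)).
  have mc k (g : R -> R) : continuous g -> continuous (fun u => k * g u).
    by move=> gc u; exact: (@continuousM R R _ _ u (@cst_continuous _ _ k u) (gc u)).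
  have pc : continuous (fun u : R => pi * u) by apply: mc => u; exact: cvg_id.
  have cc : continuous (fun u : R => c + r * cos (pi * u)).
    have rc : continuous (fun u : R => r * cos (pi * u)).
      by apply: mc => u; exact: (continuous_at_comp (pc u) (@continuous_cos R _)).
    by move=> u; exact: (@continuousD R R R _ _ u (@cst_continuous _ _ c u) (rc u)).
  have sc : continuous (fun u : R => `|r| * sin (pi * u)).
    by apply: mc => u; exact: (continuous_at_comp (pc u) (@continuous_sin R _)).
  apply: Complex_comp_continuous.
    exact: (continuous_at_comp (@val_continuous R t) (cc _)).
  exact: (continuous_at_comp (@val_continuous R t) (sc _)).
have h01 := @half_itv R.
move=> t; have /andP[t0 t1] := I01_itv t; rewrite /upper_arc.
have [tz|tz] := eqVneq (val t) 0.
  rewrite tz !mulr0 cos0 sin0 mulr1 mulr0; split; first exact: lexx.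
  by apply/punctured_sphereP; right; move: h01 => /andP[? ?]; split; lra.
have [to|to] := eqVneq (val t) 1.
  rewrite to !mulr1 cospi sinpi mulrN1 mulr0; split; first exact: lexx.
  by apply/punctured_sphereP; right; move: h01 => /andP[? ?]; split; lra.
have s0 : 0 < sin (pi * val t).
  have v0 : 0 < val t by rewrite lt_neqAle eq_sym tz t0.
  have v1 : val t < 1 by rewrite lt_neqAle to t1.
  by apply: sin_gt0_pi; rewrite mulr_gt0 ?pi_gt0//= gtr_pMr ?pi_gt0.
have r0 : 0 < `|(x - 2^-1) / 2|.
  by rewrite normr_gt0; apply/eqP; move: h01 => /andP[? ?]; case: xP => ?; lra.
have p0 := mulr_gt0 r0 s0.
by split; [exact: ltW|apply/punctured_sphereP; left => E; rewrite E ltxx in p0].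
Qed.

Lemma upper_arc_I0 (x : R) : upper_arc x I0 = real_point x.
Proof.
rewrite /upper_arc val_I0 mulr0 cos0 sin0 mulr1 mulr0.
by congr (Some (_ +i* _)); field.
Qed.

Lemma upper_arc_I1 (x : R) : upper_arc x I1 = real_point 2^-1.
Proof.
rewrite /upper_arc val_I1 mulr1 cospi sinpi mulr0 mulrN1.
by congr (Some (_ +i* _)); field.
Qed.

(** On the punctured sphere, the case distinction of [path_to_half] amounts to membership in the
    slit sphere. *)
Variant path_to_half_spec (y : P1 R) : (I01 -> P1 R) -> Prop :=
| PathSegment z : y = Some z -> slit_sphere y -> path_to_half_spec y (segment_to_half z)
| PathArc x : y = real_point x -> ~ slit_sphere y -> x < 0 \/ 1 < x ->
    path_to_half_spec y (upper_arc x).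

Lemma path_to_halfP (y : P1 R) : A y -> path_to_half_spec y (path_to_half y).
Proof.
case: y => [[a b]|nA]; last by exfalso; apply: nA; right.
rewrite /path_to_half => yA; case: ifPn => /=.
  move=> /andP[/eqP b0 /orP aP]; subst b; constructor => //.
  move/slit_sphereP => [//|/andP[a0 a1]].
  by case: aP => aP; [have := lt_trans a0 aP|have := lt_trans a1 aP]; rewrite ltxx.
move=> nb; constructor => //; apply/slit_sphereP.
have [b0|b0] := eqVneq b 0; last by left; exact/eqP.
move: nb; rewrite b0 eqxx /= negb_or -!leNgt => /andP[a0 a1]; right.
move/punctured_sphereP : yA => [//|[/eqP a0' /eqP a1']].
by rewrite !lt_neqAle a0 a1 a1' eq_sym a0'.
Qed.

Lemma path_to_half_in (y : P1 R) : A y -> path_in A (path_to_half y).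
Proof.
move=> /path_to_halfP[z -> zS|x _ _ /upper_arc_in_upper[? xH]].
  by have [? zA] := segment_in_slit zS; split => // t; exact: slit_sphere_punctured.
by split => // t; exact: upper_punctured.
Qed.

Lemma path_to_half_I0 (y : P1 R) : A y -> path_to_half y I0 = y.
Proof.
by move=> /path_to_halfP[z -> _|x -> _ _]; [exact: segment_to_half_I0|exact: upper_arc_I0].
Qed.

Lemma path_to_half_I1 (y : P1 R) : A y -> path_to_half y I1 = real_point 2^-1.
Proof.
by move=> /path_to_halfP[z _ _|x _ _ _]; [exact: segment_to_half_I1|exact: upper_arc_I1].
Qed.

End paths_to_half.

Section sheets.
Context {R : realType}.
Variables (X : riemannSurface R) (f : X -> P1 R).
Hypothesis bc : branched_cover f.
Local Notation I01 := (I01 R).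
Local Notation A := (@punctured_sphere R).
Local Notation H := (@punctured_upper_half_plane R).

(** The two components of a sheet meet in some [z], which lies over both regions. The segment from
    [f z] to 1/2 stays in both, so its lift ends at a common point [h] over 1/2; in either component
    [h] is the only one, by [star_injective] with centre 1/2 or [i]. *)
Lemma sheet_half (S : set X) a b : sheet f S -> S a -> S b ->
  f a = real_point 2^-1 -> f b = real_point 2^-1 -> a = b.
Proof.
move=> [_ [_ [[b0 Bb0 <-] [t0 Tt0 <-] [z [zB zT]] ->]]].
have zS : slit_sphere (f z) by exact: (path_component_sub zB).
have zH : H (f z) by exact: (path_component_sub zT).
have [h [hB hT fh]] : exists h, [/\ path_component R (f @^-1` slit_sphere) b0 h,
    path_component R (f @^-1` H) t0 h & f h = real_point 2^-1].
  have [w wE] : exists w, f z = Some w.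
    by case: (f z) zH => [w|[_ nA]]; [exists w|exfalso; apply: nA; right].
  rewrite wE in zS zH.
  have sS := segment_in_slit zS; have sH := segment_in_upper zS zH.
  have sA : path_in A (segment_to_half w).
    by case: sH => ? h; split => // t; exact: upper_punctured.
  have [q [ql q0]] : exists q, is_lift f (segment_to_half w) q /\ q I0 = z.
    by apply: (lift_exists bc) => //; rewrite segment_to_half_I0.
  exists (q I1); split.
  - by apply: path_component_ext; [rewrite q0; exact: zB|exact: is_lift_path_in ql sS].
  - by apply: path_component_ext; [rewrite q0; exact: zT|exact: is_lift_path_in ql sH].
  - by case: ql => _ /(congr1 (fun p => p I1)) /= ->; rewrite segment_to_half_I1.
have uniq c : ((path_component R (f @^-1` slit_sphere) b0 `|`
    path_component R (f @^-1` H) t0) `\` f @^-1` cusps R) c -> f c = real_point 2^-1 -> c = h.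
  move=> [[cB|cT] _] fc.
    have [u [uS u0 u1]] := path_component_joined cB hB; rewrite -u0 -u1.
    apply: (star_injective bc (@slit_sphere_punctured R) _ uS); last by rewrite u0 u1 fc.
    by move=> z' t; exact: slit_sphere_star.
  have [u [uS u0 u1]] := path_component_joined cT hT; rewrite -u0 -u1.
  apply: (star_injective bc (@upper_punctured R) _ uS); last by rewrite u0 u1 fc.
  by move=> z' t; exact: upper_star_i.
by move=> aS bS fa fb; rewrite (uniq a)// (uniq b).
Qed.

(** From a point of the slit component the path is a segment inside the slit sphere; from a point of
    the upper component it is a segment or an arc, in both cases inside the upper half plane. *)
Lemma sheet_lift (S : set X) x q : sheet f S -> S x ->
  is_lift f (path_to_half (f x)) q -> q I0 = x -> S (q I1).
Proof.
move=> [_ [_ [[b0 Bb0 <-] [t0 Tt0 <-] _ ->]]] [xBT xA] ql q0.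
have qA : ~ cusps R (f (q I1)).
  have [_ /(congr1 (fun p => p I1)) /= ->] := ql.
  by rewrite path_to_half_I1//; apply: real_point_punctured; exact: half_itv.
split=> //; case: xBT => [xB|xT].
  left; apply: path_component_ext; first by rewrite q0; exact: xB.
  apply: (is_lift_path_in ql).
  have xS : slit_sphere (f x) by exact: (path_component_sub xB).
  case: (path_to_halfP xA) => [z E _|//]; apply: segment_in_slit; by rewrite -E.
right; apply: path_component_ext; first by rewrite q0; exact: xT.
apply: (is_lift_path_in ql).
have xH : H (f x) by exact: (path_component_sub xT).
case: (path_to_halfP xA) => [z E zS|x' _ _]; last exact: upper_arc_in_upper.
by rewrite E in xH zS; exact: segment_in_upper.
Qed.

(** For the converse the sheet is made of the two components of [e Ihalf]: [x] belongs to it by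
    running [q] backwards, and the open edge by running along itself within the slit sphere. *)
Lemma edge_in_sheetP (x : X) (e : edge f) q : A (f x) ->
  is_lift f (path_to_half (f x)) q -> q I0 = x ->
  edge_in_sheet_of x e <-> e Ihalf = q I1.
Proof.
move=> xA ql q0.
have fq1 : f (q I1) = real_point 2^-1.
  by have [_ /(congr1 (fun p => p I1)) /= ->] := ql; rewrite path_to_half_I1.
split.
  move=> [S [Ssh Sx Se]]; apply: (sheet_half Ssh).
  - by apply: Se; rewrite val_Ihalf half_itv.
  - exact: (sheet_lift Ssh Sx ql q0).
  - exact: edge_half.
  - exact: fq1.
move=> eq1; pose h := e Ihalf.
have fh : f h = real_point 2^-1 by exact: edge_half.
have hS : slit_sphere (f h) by rewrite fh; apply/slit_sphereP; right; exact: half_itv.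
have hH : H (f h).
  by rewrite fh; split; [exact: lexx|apply: real_point_punctured; exact: half_itv].
pose B := path_component R (f @^-1` slit_sphere) h.
pose T := path_component R (f @^-1` H) h.
exists ((B `|` T) `\` f @^-1` cusps R); split.
- exists B, T; split => //; [by exists h|by exists h|].
  by exists h; split; exact: path_component_refl.
- split => //; have [E|[E]] : path_in slit_sphere (path_to_half (f x)) \/
      path_in H (path_to_half (f x)).
  + case: (path_to_halfP xA) => [z E zS|x' _ _ h']; [left|right].
      by apply: segment_in_slit; rewrite -E.
    exact: upper_arc_in_upper.
  + left; rewrite /B -q0 -(rev_path_I1 q); apply: path_component_ext.
      by rewrite rev_path_I0 -eq1; exact: path_component_refl.
    by apply: path_in_rev; exact: is_lift_path_in ql E.
  + move=> EH; right; rewrite /T -q0 -(rev_path_I1 q); apply: path_component_ext.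
      by rewrite rev_path_I0 -eq1; exact: path_component_refl.
    by apply: path_in_rev; apply: (is_lift_path_in ql); split.
move=> t t01; split; last first.
  by rewrite /= edge_section; exact: real_point_punctured.
left; exists (fun s => e (clamp ((val t - 2^-1) * val s + 2^-1))); split.
- split.
    have := @affine_clamp_continuous R X e (val t - 2^-1) 2^-1 (edge_continuous (e := e)).
    by move=> c s; exact: (continuous_at_comp (@val_continuous R s) (c _)).
  move=> s; rewrite /= edge_section; apply/slit_sphereP; right.
  have /andP[s0 s1] := I01_itv s; have /andP[h0 h1] := @half_itv R.
  move: t01 => /andP[t0 t1].
  have [u0 u1] : 0 < (val t - 2^-1) * val s + 2^-1 /\ (val t - 2^-1) * val s + 2^-1 < 1.
    by split; nra.
  by rewrite val_clamp ?(ltW u0) ?(ltW u1)// u0 u1.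
- by rewrite val_I0 mulr0 add0r.
- by rewrite val_I1 mulr1 subrK clamp_val.
Qed.

End sheets.

(** * The monodromy of a composition *)

Section endpoint_relation.
Context {R : realType}.
Local Notation I01 := (I01 R).
Local Notation A := (@punctured_sphere R).

(** Keeping only the endpoints of lifts turns concatenation and reversal of paths into composition
    and converse of relations. *)
Definition lifts_to (X : topologicalType) (f : X -> P1 R) (p : I01 -> P1 R) (x x' : X) : Prop :=
  exists q, [/\ is_lift f p q, q I0 = x & q I1 = x'].

Lemma lifts_to_rev (X : topologicalType) (f : X -> P1 R) p x x' :
  lifts_to f p x x' -> lifts_to f (rev_path p) x' x.
Proof.
move=> [q [ql q0 q1]]; exists (rev_path q); split; first exact: is_lift_rev.
  by rewrite rev_path_I0.
by rewrite rev_path_I1.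
Qed.

Lemma lifts_to_cat (X : topologicalType) (f : X -> P1 R) p p' x y z :
  lifts_to f p x y -> lifts_to f p' y z -> lifts_to f (cat_path p p') x z.
Proof.
move=> [q [ql q0 q1]] [q' [ql' q0' q1']]; exists (cat_path q q'); split.
- by apply: is_lift_cat => //; rewrite q1 q0'.
- by rewrite cat_path_I0.
- by rewrite cat_path_I1.
Qed.

Lemma rev_pathK (T : Type) (p : I01 -> T) : rev_path (rev_path p) = p.
Proof.
apply/funext => t; rewrite /rev_path val_clamp; first by rewrite subKr clamp_val.
by have /andP[t0 t1] := I01_itv t; rewrite subr_ge0 t1 gerBl.
Qed.

Section branched.
Variables (X : topologicalType) (f : X -> P1 R).
Hypothesis bc : branched_cover f.

Lemma lifts_to_fun p x a b : (forall t, A (p t)) ->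
  lifts_to f p x a -> lifts_to f p x b -> a = b.
Proof.
move=> pA [q [ql q0 <-]] [q' [ql' q0' <-]].
by rewrite (is_lift_unique (t0 := I0) bc pA ql ql')// q0.
Qed.

Lemma lifts_to_ex p x : path_in A p -> f x = p I0 -> exists x', lifts_to f p x x'.
Proof.
move=> pA fx; have [q [ql q0]] := lift_exists bc pA fx.
by exists (q I1); exists q.
Qed.

Lemma lifts_to_end p x x' : lifts_to f p x x' -> f x' = p I1.
Proof. by move=> [q [[_ <-] _ <-]]. Qed.

Lemma based_loops_lift_end (lambda : pi1 R) l l' x a b :
  loops_of lambda l -> loops_of lambda l' ->
  lifts_to f l x a -> lifts_to f l' x b -> a = b.
Proof.
have [p0 [p0A p00 p01] ->] := pi1P lambda.
move=> [[lA l0 l1] p0l] [[lA' l0' l1'] p0l'] [q [ql q0 <-]] [q' [ql' q0' <-]].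
have fx : f x = p0 I0.
  by rewrite p00 -l0 -q0; case: ql => _ <-.
have [q2 [ql2 q20]] := lift_exists bc p0A fx.
have E1 := homotopic_lift bc p0l ql2 ql; have E2 := homotopic_lift bc p0l' ql2 ql'.
by rewrite -E1 ?q20// -E2 ?q20.
Qed.

End branched.

Lemma loop_based (lambda : pi1 R) l : loops_of lambda l -> based_loop l.
Proof. by have [p0 _ ->] := pi1P lambda; case. Qed.

Lemma homotopic_refl (p : I01 -> P1 R) : path_in A p -> homotopic A p p.
Proof.
move=> [pc pA]; exists (fun u => p u.2); split => //.
by move=> u; apply: (@continuous_comp _ _ _ snd p); [exact: cvg_snd|exact: pc].
Qed.

Lemma pi1_nonempty (lambda : pi1 R) : exists l, loops_of lambda l.
Proof.
have [p0 p0P E] := pi1P lambda; exists p0; rewrite E; split => //.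
by apply: homotopic_refl; case: p0P.
Qed.

Lemma close_path_based (p : I01 -> P1 R) : path_in A p -> based_loop (close_path p).
Proof.
move=> pA; have [_ pt] := pA.
have h0 := path_to_half_in (pt I0); have h1 := path_to_half_in (pt I1).
split.
- apply: path_in_cat => //; last by rewrite cat_path_I1 path_to_half_I0.
  apply: path_in_cat => //; first exact: path_in_rev.
  by rewrite rev_path_I1 path_to_half_I0.
- by rewrite /close_path !cat_path_I0 rev_path_I0 path_to_half_I1.
- by rewrite /close_path cat_path_I1 path_to_half_I1.
Qed.

Section monodromy_edges.
Variables (X : riemannSurface R) (f : X -> P1 R).
Hypothesis bc : branched_cover f.

(** The default of [xget] is ruled out by [edge_through]. The edge it picks may come from another
    loop of the class, with the same lifted endpoint; this endpoint lies over 1/2, so the edge meets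
    it at parameter 1/2. *)
Lemma monodromy_lifts_to (e : edge f) (lambda : pi1 R) l : loops_of lambda l ->
  lifts_to f l (e Ihalf) (monodromy e lambda Ihalf).
Proof.
move=> ll; have [lA l0 l1] := loop_based ll.
have fe : f (e Ihalf) = l I0 by rewrite edge_half l0.
have [x lx] := lifts_to_ex bc lA fe.
have [q [ql q0 q1]] := lx.
have fx : f x = real_point 2^-1 by rewrite (lifts_to_end lx).
have [e' e'x] := edge_through bc fx.
rewrite /monodromy; case: xgetP => [M _ [l' [q' [ll' ql' q0' [t _ Mt]]]]|/(_ e')]; last first.
  by case; exists l, q; split => //; rewrite q1; exists Ihalf.
have [_ _ l1'] := loop_based ll'.
have tE : t = Ihalf.
  apply: (@edge_value_half _ _ f M); rewrite Mt -l1'.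
  by case: ql' => _ <-.
have lx' : lifts_to f l' (e Ihalf) (M Ihalf) by exists q'; rewrite -Mt tE.
by rewrite -(based_loops_lift_end bc ll ll' lx lx').
Qed.

Lemma edge_of_point x : A (f x) -> exists e : edge f,
  lifts_to f (path_to_half (f x)) x (e Ihalf).
Proof.
move=> fxA; have fx : f x = path_to_half (f x) I0 by rewrite path_to_half_I0.
have [x' lx] := lifts_to_ex bc (path_to_half_in fxA) fx.
have fx' := lifts_to_end lx; rewrite path_to_half_I1// in fx'.
by have [e eE] := edge_through bc fx'; exists e; rewrite eE.
Qed.

Lemma edge_in_sheet_lifts_to x (e : edge f) : A (f x) ->
  edge_in_sheet_of x e <-> lifts_to f (path_to_half (f x)) x (e Ihalf).
Proof.
move=> fxA; have [e' [q [ql q0 q1]]] := edge_of_point fxA.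
rewrite (edge_in_sheetP bc e fxA ql q0); split => [->|]; first by exists q.
move=> h; apply: (lifts_to_fun bc (path_to_half_in fxA).2 h).
by exists q.
Qed.

End monodromy_edges.

(** [xget] settles on a loop [l] of its own; it is handed out together with its lift so that all
    monodromies can be computed with this same [l]. *)
Lemma extending_patternP (b : P1 R -> P1 R) (lambda : pi1 R) (eb : edge b) :
  branched_cover b -> b @` cusps R `<=` cusps R ->
  exists l q, [/\ loops_of lambda l, is_lift b l q, q I0 = eb Ihalf, path_in A q &
    loops_of (extending_pattern lambda eb) (close_path q)].
Proof.
move=> bc bcusps.
have liftA l q : loops_of lambda l -> is_lift b l q -> path_in A q.
  move=> /loop_based[[_ lA] _ _] [qc bq]; split => // t qt; apply: (lA t).
  by rewrite -bq; apply: bcusps; exists (q t).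
have [l ll] := pi1_nonempty lambda; have [lA l0 l1] := loop_based ll.
have fe : b (eb Ihalf) = l I0 by rewrite edge_half l0.
have [q [ql q0]] := lift_exists bc lA fe.
have qA := liftA _ _ ll ql; have cq := close_path_based qA.
pose m := Pi1 (ex_intro2 _ _ (close_path q) cq (erefl (homotopy_class (close_path q)))).
rewrite /extending_pattern; case: xgetP => [m' _ [l' [q' [ll' ql' q0' mq]]]|/(_ m)].
  by exists l', q'; split => //; exact: liftA ll' ql'.
case; exists l, q; split => //; split => //.
by apply: homotopic_refl; have [] := cq.
Qed.

End endpoint_relation.

(** * Edges of a composition as pairs of edges *)

Section edge_bijection.
Context {R : realType}.
Variables (X : riemannSurface R) (b : P1 R -> P1 R) (g : X -> P1 R).
Hypotheses (bB : branched_cover b) (gB : branched_cover g).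
Hypothesis bcusps : b @` cusps R `<=` cusps R.
Local Notation A := (@punctured_sphere R).

Let bgB : branched_cover (b \o g). Proof. exact: branched_cover_comp. Qed.

Lemma edge_half_punctured (e : edge b) : A (e Ihalf).
Proof.
move=> ec; have : A (b (e Ihalf)).
  by rewrite edge_half; apply: real_point_punctured; exact: half_itv.
by apply; apply: bcusps; exists (e Ihalf).
Qed.

(** The graph of the identification, with the sheet condition already replaced by the lift of the
    closing path. *)
Definition edge_pair (e : edge (b \o g)) (pr : edge g * edge b) : Prop :=
  lifts_to g (path_to_half (g (e Ihalf))) (e Ihalf) (pr.1 Ihalf) /\
  pr.2 Ihalf = g (e Ihalf).

Lemma image_edge (e : edge (b \o g)) : exists eb : edge b, forall t, eb t = g (e t).
Proof.
unshelve eexists (@Edge _ _ b (g \o e) _ _) => //.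
- move=> t; apply: continuous_comp; first exact: edge_continuous.
  exact: (branched_continuous gB).
- by move=> t; rewrite -(edge_section e).
Qed.

Lemma edge_comp_punctured (e : edge (b \o g)) : A (g (e Ihalf)).
Proof. by have [eb <-] := image_edge e; exact: edge_half_punctured. Qed.

Lemma edge_pair_ex e : exists pr, edge_pair e pr.
Proof.
have [eb ebE] := image_edge e.
have [eg egE] := edge_of_point gB (@edge_comp_punctured e).
by exists (eg, eb).
Qed.

Lemma edge_pair_fun e pr pr' : edge_pair e pr -> edge_pair e pr' -> pr = pr'.
Proof.
case: pr pr' => [eg eb] [eg' eb'] [/= h1 h2] [/= h1' h2'].
congr (_, _); last by apply: (edge_inj bB); rewrite h2.
apply: (edge_inj gB).
exact: (lifts_to_fun gB (path_to_half_in (@edge_comp_punctured e)).2 h1 h1').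
Qed.

Lemma edge_pair_inj e e' pr : edge_pair e pr -> edge_pair e' pr -> e = e'.
Proof.
move=> [/lifts_to_rev h1 h2] [/lifts_to_rev h1' h2']; apply: (edge_inj bgB).
rewrite -h2' h2 in h1'.
apply: (lifts_to_fun gB _ h1 h1') => t.
by have [_] := path_in_rev (path_to_half_in (@edge_comp_punctured e)).
Qed.

(** Lifting the reversed closing path from [eg Ihalf] finds the point where the edge of the
    composition has its midpoint. *)
Lemma edge_pair_surj pr : exists e, edge_pair e pr.
Proof.
case: pr => eg eb; have yA := @edge_half_punctured eb; set y := eb Ihalf in yA.
have geg : g (eg Ihalf) = rev_path (path_to_half y) I0.
  by rewrite rev_path_I0 path_to_half_I1// edge_half.
have [x lx] := lifts_to_ex gB (path_in_rev (path_to_half_in yA)) geg.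
have gx : g x = y by rewrite (lifts_to_end lx) rev_path_I1 path_to_half_I0.
have bgx : (b \o g) x = real_point 2^-1 by rewrite /= gx edge_half.
have [e ex] := edge_through bgB bgx; exists e.
rewrite /edge_pair /= ex gx; split => //.
by move: (lifts_to_rev lx); rewrite rev_pathK.
Qed.

Lemma monodromy_edge_pair (e : edge (b \o g)) eg eb (lambda : pi1 R) :
  edge_pair e (eg, eb) ->
  edge_pair (monodromy e lambda)
    (monodromy eg (extending_pattern lambda eb), monodromy eb lambda).
Proof.
move=> [/= lx yx]; set x := e Ihalf in lx yx.
have [l [q [ll ql q0 qA mq]]] := extending_patternP lambda eb bB bcusps.
have [[lc lA] l0 l1] := loop_based ll.
have [r [[rc rl] r0 r1]] := monodromy_lifts_to bgB e ll.
have grl : is_lift b l (g \o r).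
  split; last by [].
  by move=> t; apply: continuous_comp; [exact: rc|exact: (branched_continuous gB)].
(* Both are lifts of [l] by [b] from the same point, so [r] is also a lift of [q] by [g]. *)
have qE : q = g \o r.
  by apply: (is_lift_unique (t0 := I0) bB lA ql grl); rewrite q0 yx /= r0.
have rq : lifts_to g q x (monodromy e lambda Ihalf).
  by exists r; split => //; split => //; rewrite qE.
have qI1 : q I1 = g (monodromy e lambda Ihalf) by rewrite qE /= r1.
have [pr [h1 h2]] := edge_pair_ex (monodromy e lambda).
suff -> : (monodromy eg (extending_pattern lambda eb), monodromy eb lambda) = pr by [].
case: pr h1 h2 => a b' /= h1 h2; congr (_, _); last first.
  apply: (edge_inj bB); rewrite h2 -qI1.
  apply: (lifts_to_fun bB lA (monodromy_lifts_to bB eb ll)).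
  by exists q.
apply: (edge_inj gB).
have [[_ cqA] _ _] := loop_based mq.
apply: (lifts_to_fun gB cqA (monodromy_lifts_to gB eg mq)).
apply: lifts_to_cat; last by rewrite qI1; exact: h1.
apply: (lifts_to_cat (y := x)) rq.
by rewrite q0 yx; exact: lifts_to_rev.
Qed.

End edge_bijection.

Theorem theorem3p14 (R : realType) (X : riemannSurface R)
    (beta : P1 R -> P1 R) (gamma : X -> P1 R)
    (hbeta : dynamical_belyi beta) (hgamma : belyi gamma) :
  exists Phi : edge (beta \o gamma) -> edge gamma * edge beta,
    [/\ splits_edges Phi, bijective Phi &
      forall (lambda : pi1 R) (e_gamma : edge gamma) (e_beta : edge beta)
             (e : edge (beta \o gamma)),
        Phi e = (e_gamma, e_beta) ->
        Phi (monodromy e lambda) =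
          (monodromy e_gamma (extending_pattern lambda e_beta),
           monodromy e_beta lambda)].
Proof.
case: hbeta => bB bcusps.
have A2 : punctured_sphere (real_point 2^-1 : P1 R).
  by apply: real_point_punctured; exact: half_itv.
(* If one of the maps takes only cusps as values, neither the composition nor the product has any
   edge, and the empty function does. *)
have [[[y yA] [x xA]]|empty] := pselect ((exists y, punctured_sphere (beta y)) /\
    (exists x, punctured_sphere (gamma x))); last first.
  have no_pair : edge gamma * edge beta -> False.
    move=> [eg eb]; apply: empty; split.
      by exists (eb Ihalf); rewrite edge_half.
    by exists (eg Ihalf); rewrite edge_half.
  have no_edge : edge (beta \o gamma) -> False.
    move=> e; apply: empty.
    have h : beta (gamma (e Ihalf)) = real_point 2^-1 by exact: (edge_half e).
    split; first by exists (gamma (e Ihalf)); rewrite h.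
    exists (e Ihalf) => c; apply: A2; rewrite -h.
    by apply: bcusps; exists (gamma (e Ihalf)).
  exists (fun e => False_rect _ (no_edge e)); split.
  - by move=> e; case: (no_edge e).
  - by exists (fun pr => False_rect _ (no_pair pr)) => z; [case: (no_edge z)|case: (no_pair z)].
  - by move=> lambda eg eb e; case: (no_edge e).
have {y yA}betaB := belyi_branched_cover bB yA.
have {x xA}gammaB := belyi_branched_cover hgamma xA.
(* [edge_pair] is a total, functional, injective and surjective relation, so choice in both
   directions gives mutually inverse maps. *)
have /choice[Phi PhiP] := edge_pair_ex gammaB bcusps.
have /choice[Psi PsiP] := edge_pair_surj betaB gammaB bcusps.
have PhiE e pr : edge_pair e pr -> Phi e = pr.
  exact: (edge_pair_fun betaB gammaB bcusps (PhiP e)).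
exists Phi; split.
- move=> e; have eA := @edge_comp_punctured _ _ _ _ gammaB bcusps e; split; last first.
    have [eb ebE] := image_edge gammaB e.
    have -> : (Phi e).2 = eb by apply: (edge_inj betaB); rewrite (PhiP e).2 ebE.
    exact: ebE.
  split; first by apply/(edge_in_sheet_lifts_to gammaB _ eA); exact: (PhiP e).1.
  move=> eg /(edge_in_sheet_lifts_to gammaB _ eA) h; apply: (edge_inj gammaB).
  exact: (lifts_to_fun gammaB (path_to_half_in eA).2 (PhiP e).1 h).
- exists Psi => [e|pr]; last by apply: PhiE.
  exact: (edge_pair_inj betaB gammaB bcusps (PsiP (Phi e)) (PhiP e)).
- move=> lambda eg eb e Ee; apply: PhiE.
  by apply: monodromy_edge_pair => //; rewrite -Ee.
Qed.
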